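(* Let $S$ be a complete smooth toric surface, $\psi:\hat S\to S$ its blowup at a torus fixed point, with exceptional curve $E$, and let $X=K_S$, $\hat X=K_{\hat S}$ be the total spaces of the canonical bundles (toric Calabi--Yau threefolds). Let $p,\hat p$ be the natural isomorphisms from $H_2(S,\mathbb R)$, $H_2(\hat S,\mathbb R)$ to the groups of curve classes on $X,\hat X$. Then for all $g\ge0$: (i) For $\beta\in H_2(\hat S,\mathbb Z)$ such that $\beta$ is not a multiple of $[E]$ and satisfying $\beta.E<0$, $$N_{g,\hat p(\beta)}(\hat X)=0.$$ (ii) For $\beta\in H_2(\hat S,\mathbb Z)$ such that $\beta.E=0$, $$N_{g,\hat p(\beta)}(\hat X)=N_{g,p(\psi_*(\beta))}(X).$$ (iii) For multiples of $[E]$, i.e. for all $d\ge1$, $$N_{g,d[E]}(\hat X)=N_{g,d[\mathbb P^1]}\big(\mathcal O_{\mathbb P^1}(-1)\oplus\mathcal O_{\mathbb P^1}(-1)\big).$$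
   Context: **Topological vertex.** $\mathcal P$ is the set of partitions, $\mu^t$ the conjugate of $\mu$, $|\mu|=\sum_j\mu_j$, $\kappa(\mu)=|\mu|+\sum_{j}\mu_j(\mu_j-2j)$ (sum over the nonzero parts). For partitions $\lambda,\mu,\nu$, $s_{\lambda/\mu}(q^{\nu+\rho})$ is the skew Schur function specialized at $x_i=q^{\nu_i-i+1/2}$ ($i\ge1$), regarded as an element of $\mathbb Q(q^{1/2})$ (the series converges for $|q|>1$ to a rational function); $q^{\rho}$ is the case $\nu=\emptyset$. Put $$C_{\lambda_1,\lambda_2,\lambda_3}(q)=q^{\frac12\kappa(\lambda_3)}s_{\lambda_2}(q^\rho)\sum_{\mu\in\mathcal P}s_{\lambda_1/\mu}(q^{\lambda_2^t+\rho})\,s_{\lambda_3^t/\mu}(q^{\lambda_2+\rho}).$$ It is invariant under cyclic permutations of $(\lambda_1,\lambda_2,\lambda_3)$. **TCY threefolds.** A toric Calabi--Yau (TCY) threefold is a smooth 3-dimensional toric variety $X$ over $\mathbb C$ with fan $\Sigma$ in $\mathbb R^3$ (lattice $\mathbb Z^3$) such that (i) the primitive generator of each 1-cone has third coordinate $1$; (ii) all maximal cones are 3-dimensional; (iii) $|\Sigma|\cap\{z=1\}$ is simply connected, where $|\Sigma|$ is the support and $z$ the third coordinate. $\Sigma_n$ is the set of $n$-cones; $\Sigma_2'\subset\Sigma_2$ is the set of 2-cones not contained in the boundary of $|\Sigma|$. $D_\rho$ is the torus invariant divisor of $\rho\in\Sigma_1$, and $C_\tau\cong\mathbb P^1$ the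 torus invariant curve of $\tau\in\Sigma_2'$. $N_1^T(X)$ is the group generated by the $C_\tau$, $\tau\in\Sigma_2'$, modulo numerical equivalence (a class $Z$ is determined by the numbers $D_\rho.Z$). For $X=K_S$, where $S$ has rays with primitive generators $v_1,\dots,v_r$ in cyclic order, the fan has 3-cones spanned by $(0,0,1),(v_i,1),(v_{i+1},1)$; the interior 2-cones correspond to the torus invariant curves of $S$, embedded in $X$ via the zero section. **Toric graph.** $\Gamma_X$ is the planar dual graph of the triangulation $\Sigma\cap\{z=1\}$ of a region in the oriented plane: a trivalent vertex $v_\sigma$ for each $\sigma\in\Sigma_3$ (the set $V_3(\Gamma_X)$), an edge $e_\tau$ joining $v_\sigma,v_{\sigma'}$ for each $\tau=\sigma\cap\sigma'\in\Sigma_2'$ (the set $E_3(\Gamma_X)$), and an edge ending in a univalent vertex for each $\tau\in\Sigma_2\setminus\Sigma_2'$; $e_\tau$ crosses the segment $\tau\cap\{z=1\}$. Edges are directed arbitrarily. For $e_\tau\in E_3(\Gamma_X)$ the framing is $n(e_\tau)=\frac12(D_{\rho_1}.C_\tau-D_{\rho_2}.C_\tau)$, where $\rho_1$ (resp. $\rho_2$) is the 1-cone of $\tau$ lying to the right (resp. left) of the directed edge $e_\tau$. **Partition function.** Associate a formal variable $Q_e$ to each $e\in E_3(\Gamma_X)$. Then $$Z_X(q,\vec Q)=\sum_{\vec\lambda:E_3(\Gamma_X)\to\mathcal P}\ \prod_{e\in E_3(\Gamma_X)}(-1)^{|\vec\lambda(e)|(n(e)+1)}q^{\frac{\kappa(\vec\lambda(e))}2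 n(e)}Q_e^{|\vec\lambda(e)|}\prod_{v\in V_3(\Gamma_X)}C_{\vec\lambda_v}(q),$$ a formal power series in the $Q_e$ with coefficients in $\mathbb Q(q^{1/2})$. Here $\vec\lambda_v$ is the triple of partitions on the three edges at $v$, listed counterclockwise, using $\vec\lambda(e)$ if $e$ is directed out of $v$ and $\vec\lambda(e)^t$ if it is directed into $v$; $\vec\lambda(e)=\emptyset$ for $e\notin E_3(\Gamma_X)$. $Z_X$ does not depend on the directions. **Gromov--Witten invariants.** Let $F_{\vec d}(q)$ be the coefficient of $\vec Q^{\vec d}=\prod_eQ_e^{d_e}$ in $\log Z_X(q,\vec Q)$. Then $N_{g,\beta}(X)$ is given by $$\sum_{g\ge0}N_{g,\beta}(X)\,g_s^{2g-2}=\sum_{\vec d:\ \sum_ed_e[C_e]=\beta}F_{\vec d}\big(e^{\sqrt{-1}g_s}\big)$$ (Laurent expansion at $g_s=0$), where $\vec d$ runs over tuples of nonnegative integers indexed by $E_3(\Gamma_X)$ and $C_e=C_\tau$ for $e=e_\tau$. The same definition applies to the TCY threefold $\mathcal O_{\mathbb P^1}(-1)\oplus\mathcal O_{\mathbb P^1}(-1)$ (total space), with $[\mathbb P^1]$ the class of the zero section. **Maps.** $p:H_2(S,\mathbb R)\to N_1^T(X)\otimes\mathbb R$ and $\hat p:H_2(\hat S,\mathbb R)\to N_1^T(\hat X)\otimes\mathbb R$ are the isomorphisms sending the class of a torus invariant curve in the surface to its class in the threefold via the zero section. $\psi_*:H_2(\hat S)\to H_2(S)$ is push-forward; $\beta.E$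 is the intersection number on $\hat S$; $[E]$ also denotes $\hat p([E])$. *)

(* Defs.v *)
From HB Require Import structures.
From mathcomp Require Import all_boot all_order all_algebra.
From mathcomp Require Import generic_quotient ring_quotient.
From mathcomp Require Import boolp classical_sets functions cardinality fsbigop.
From mathcomp Require Import complex Rstruct.
From mathcomp Require Import mpoly.
From mathcomp Require Import ring zify.

Set Implicit Arguments.
Unset Strict Implicit.
Unset Printing Implicit Defensive.

Import Order.TTheory GRing.Theory Num.Theory.

Local Open Scope quotient_scope.
Local Open Scope classical_set_scope.
Local Open Scope ring_scope.

Notation CC := (complex Rdefinitions.R).

(* The sums over infinite index sets below are the [\sum_(i \in A)] of
   fsbigop, which is meaningful when only finitely many terms are nonzero. *)

(** * Partitions *)

Definition is_part (s : seq nat) : bool := sorted geq s && (0%N \notin s).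

Record part := Part { parts :> seq nat; _ : is_part parts }.
HB.instance Definition _ := [isSub for parts].
HB.instance Definition _ := [Countable of part by <:].

Definition part0 : part := @Part [::] isT.

Definition conj_seq (s : seq nat) : seq nat :=
  [seq count (ltn j) s | j <- iota 0 (head 0%N s)].

Lemma conj_seq_part (s : seq nat) : is_part (conj_seq s).
Proof.
apply/andP; split; last first.
  apply/mapP => -[j]; rewrite mem_iota add0n => /andP[_].
  by case: s => //= a s ->.
rewrite /conj_seq; set m := head _ _; move: m => m.
apply: (homo_sorted (e := ltn)); last exact: iota_ltn_sorted.
move=> i j ltij; apply: sub_count => p /=; exact: ltn_trans ltij.
Qed.

Definition conj_part (mu : part) : part := Part (conj_seq_part mu).

Definition psize (mu : part) : nat := sumn mu.

Definition kappa (mu : part) : int :=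
  (psize mu)%:Z +
  \sum_(j < size mu) (nth 0%N mu j)%:Z * ((nth 0%N mu j)%:Z - (2 * j.+1)%:Z).

(** * Skew Schur functions and their specialization at [q^(nu + rho)] *)

(* [la / mu] is a horizontal strip. *)
Definition hstrip (la mu : part) : Prop :=
  forall i, (nth 0 la i.+1 <= nth 0 mu i <= nth 0 la i)%N.

(* Generating function of semistandard tableaux of shape [la / mu], a tableau
   being the chain of partitions in which each step is the horizontal strip of
   cells with a given entry. *)
Fixpoint skew_schur (F : fieldType) (x : seq F) (la mu : part) : F :=
  if x is y :: x' then
    \sum_(nu \in [set nu | hstrip nu mu])
       y ^+ (psize nu - psize mu) * skew_schur x' la nu
  else (la == mu)%:R.

(* Q(q^(1/2)) *)
Notation ratfun := {fraction {poly rat}}.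

Definition qhalf : ratfun := tofrac 'X.

Definition poly_at (a : {poly rat}) (z : CC) : CC := (map_poly ratr a).[z].

(* [z] stands for q^(1/2); with indices starting from 0, the i-th variable
   is z ^ (2 nu_i - 2 i - 1). *)
Definition is_schur_q (la mu nu : part) (r : ratfun) : Prop :=
  exists a b : {poly rat}, r = tofrac a / tofrac b /\
    forall z : CC, 1 < `|z| ->
      poly_at b z != 0 /\
      forall eps : CC, 0 < eps -> exists N0, forall N, (N0 <= N)%N ->
        `| skew_schur
             [seq z ^ ((2 * nth 0%N nu i)%:Z - (2 * i).+1%:Z) | i <- iota 0 N]
             la mu
           - poly_at a z / poly_at b z | < eps.

Definition schur_q (la mu nu : part) : ratfun :=
  xget 0 [set r | is_schur_q la mu nu r].

(** * The topological vertex *)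

Definition vertexC (la1 la2 la3 : part) : ratfun :=
  qhalf ^ kappa la3 * schur_q la2 part0 part0 *
  \sum_(mu \in [set: part])
     schur_q la1 mu (conj_part la2) * schur_q (conj_part la3) mu la2.

(** * Toric Calabi-Yau threefolds *)

Definition det2 (a b : int * int) : int := a.1 * b.2 - a.2 * b.1.

(* det((a,1), (b,1), (c,1)) *)
Definition det3 (a b c : int * int) : int := det2 (b - a) (c - a).

Lemma mulrz_pair (x : int * int) (m : int) : x *~ m = (x.1 *~ m, x.2 *~ m).
Proof. by rewrite -!raddfMz -surjective_pairing. Qed.

Lemma wall_relation (a b c d : int * int) :
  det3 a b c = 1 -> det3 b a d = 1 ->
  c + d = a *~ det3 d b c + b *~ det3 a d c /\ 1 + 1 = det3 d b c + det3 a d c.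
Proof.
move: a b c d => [a1 a2] [b1 b2] [c1 c2] [d1 d2] abc bad; split; last first.
  transitivity (det3 (a1, a2) (b1, b2) (c1, c2) + det3 (b1, b2) (a1, a2) (d1, d2)).
    by rewrite abc bad.
  by rewrite /det3 /det2 /=; ring.
rewrite !mulrz_pair; congr pair; rewrite /= !mulrzz.
- transitivity (c1 * det3 (b1, b2) (a1, a2) (d1, d2)
                + d1 * det3 (a1, a2) (b1, b2) (c1, c2)).
    by rewrite abc bad !mulr1.
  by rewrite /det3 /det2 /=; ring.
- transitivity (c2 * det3 (b1, b2) (a1, a2) (d1, d2)
                + d2 * det3 (a1, a2) (b1, b2) (c1, c2)).
    by rewrite abc bad !mulr1.
  by rewrite /det3 /det2 /=; ring.
Qed.

(* Combinatorial data of the fan: the i-th ray is generated by [(gen i, 1)],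
   and each 3-cone occurs in [cones] as exactly one triple of rays, listed
   counterclockwise in the plane z = 1 (so that det3 is 1 on it, by
   smoothness). *)
Record tcy_fan := TCYFan {
  nrays : nat;
  gen : 'I_nrays -> int * int;
  cones : {set 'I_nrays * 'I_nrays * 'I_nrays} }.

Definition flip (T : Type) (e : T * T) : T * T := (e.2, e.1).

Section Threefold.
Variable X : tcy_fan.
Notation ray := 'I_(nrays X).

Definition is_cone (a b c : ray) : bool :=
  [|| (a, b, c) \in cones X, (b, c, a) \in cones X | (c, a, b) \in cones X].

(* [(a, b)] is a side, traversed counterclockwise, of some triangle. *)
Definition is_side (e : ray * ray) : bool := [exists c, is_cone e.1 e.2 c].

(* The interior 2-cones, equivalently the edges in E_3; the 2-cone spanned by
   the rays a < b is the pair (a, b). *)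
Definition E3 : {set ray * ray} :=
  [set e : ray * ray | [&& (e.1 < e.2)%N, is_side e & is_side (flip e)]]%SET.

(* The vector of the numbers D_r . C_e, i.e. the class of C_e in N_1^T(X).
   If the 2-cone e = (a, b) is the common face of (a, b, c) and (b, a, d),
   the intersection numbers are the coefficients of the wall relation
   u_c + u_d + (D_a . C_e) u_a + (D_b . C_e) u_b = 0 between the primitive
   generators; see [wall_relation]. *)
Definition curve (e : ray * ray) : 'rV[int]_(nrays X) :=
  \sum_(c | is_cone e.1 e.2 c) \sum_(d | is_cone e.2 e.1 d)
    (delta_mx 0 c + delta_mx 0 d
     - det3 (gen d) (gen e.2) (gen c) *: delta_mx 0 e.1
     - det3 (gen e.1) (gen d) (gen c) *: delta_mx 0 e.2).

(* Directions of the dual edges. If s = (a, b) is a counterclockwise side of a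
   triangle, the dual edge leaving this triangle through s has the ray a on its
   right and the ray b on its left; a directed edge is thus encoded as the pair
   (right ray, left ray), and [directed o e] is e or its flip. *)
Definition direction := ray * ray -> bool.
Variable o : direction.

Definition directed (e : ray * ray) : ray * ray := if o e then e else flip e.

(* The numerator is even, as D_a . C_e + D_b . C_e = -2. *)
Definition framing (e : ray * ray) : int :=
  let: (r, l) := directed e in divz (curve e 0 r - curve e 0 l) 2.

(* The partition carried by the edge crossing s, as seen from the vertex dual
   to the triangle with counterclockwise side s. *)
Definition leg (la : ray * ray -> part) (s : ray * ray) : part :=
  let e := if (s.1 < s.2)%N then s else flip s in
  if directed e == s then la e else conj_part (la e).

Definition weight (la : ray * ray -> part) : ratfun :=
  (\prod_(e in E3)
     ((-1) ^ ((psize (la e))%:Z * (framing e + 1)) *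
      qhalf ^ (kappa (la e) * framing e))) *
  \prod_(s in cones X)
     vertexC (leg la (s.1.1, s.1.2)) (leg la (s.1.2, s.2)) (leg la (s.2, s.1.1)).

(* Monomials in the variables Q_e; the j-th variable belongs to the edge
   [enum_val j]. *)
Notation mono := 'X_{1..#|E3|}.

Definition Zcoef (d : mono) : ratfun :=
  \sum_(la \in [set la : {ffun ray * ray -> part} |
                 (forall e, e \notin E3 -> la e = part0) /\
                 (forall j : 'I_#|E3|, psize (la (enum_val j)) = d j)])
     weight la.

End Threefold.

(* Coefficient at d of the logarithm of a power series with constant term 1. *)
Definition log_coef (n : nat) (Z : 'X_{1..n} -> ratfun) (d : 'X_{1..n}) : ratfun :=
  let u : {mpoly ratfun[n]} :=
    \sum_(m : 'X_{1..n < (mdeg d).+1}) Z m *: 'X_[m] - 1 in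
  \sum_(1 <= k < (mdeg d).+1) (-1) ^+ k.-1 / k%:R * (u ^+ k)@_d.

(** * Gromov-Witten invariants *)

(* Coefficient of u^k in a(e^(i u / 2)): q^(1/2) = e^(i g_s / 2). *)
Definition exp_coef (a : {poly rat}) (k : int) : CC :=
  if k is Posz n then
    \sum_(j < size a) ratr a`_j * ('i * j%:R / 2) ^+ n / n`!%:R
  else 0.

Definition is_laurent (r : ratfun) (c : int -> CC) : Prop :=
  (exists m : int, forall k, k < m -> c k = 0) /\
  exists a b : {poly rat}, [/\ b != 0, r = tofrac a / tofrac b &
    forall k : int,
      \sum_(j \in [set: int]) exp_coef b j * c (k - j) = exp_coef a k].

(* Laurent expansion at g_s = 0, as a function of the exponent. *)
Definition laurent (r : ratfun) : int -> CC :=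
  xget (fun=> 0) [set c | is_laurent r c].

Section GromovWitten.
Variables (X : tcy_fan) (o : direction X).

Definition curve_class (d : 'X_{1..#|E3 X|}) : 'rV[int]_(nrays X) :=
  \sum_(j < #|E3 X|) curve (enum_val j) *+ d j.

Definition GW (g : nat) (beta : 'rV[int]_(nrays X)) : CC :=
  laurent (\sum_(d \in [set d | curve_class d = beta]) log_coef (Zcoef o) d)
          (2 * g%:Z - 2).

End GromovWitten.

(* Total space of O(-1) + O(-1) over P^1: the unit square cut by a diagonal,
   which is dual to the zero section. *)
Definition conifold : tcy_fan :=
  @TCYFan 4
    (fun i => nth (0, 0) [:: (0, 0); (1, 0); (1, 1); (0, 1)] i)
    [set (inord 0, inord 1, inord 2); (inord 0, inord 2, inord 3)]%SET.

Definition conifold_P1 : 'rV[int]_(nrays conifold) :=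
  @curve conifold (inord 0, inord 2).

(** * Toric surfaces *)

Definition smooth_rays (n : nat) (v : 'I_n -> int * int) : Prop :=
  forall i, det2 (v i) (v (ordS i)) = 1.

(* v_0, ..., v_(n-1) are the primitive ray generators, in counterclockwise
   order, of a complete smooth fan. The second clause says that the cones form
   a fan with support the whole plane: the half-open cones spanned by v_i and
   v_(i+1), with the ray of v_i included and that of v_(i+1) excluded,
   partition the nonzero lattice points. *)
Definition complete_smooth (n : nat) (v : 'I_n -> int * int) : Prop :=
  smooth_rays v /\
  (forall w : int * int, w != 0 -> exists! i, exists a b : int,
     [/\ 0 < a, 0 <= b & w = v i *~ a + v (ordS i) *~ b]).

Section Surface.
Variables (n : nat) (v : 'I_n -> int * int).

(* The intersection number D_i . D_j, where
   v_(i-1) + v_(i+1) = - (D_i . D_i) v_i. *)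
Definition surf_int (i j : 'I_n) : int :=
  (j == ordS i)%:R + (i == ordS j)%:R
  - (i == j)%:R * det2 (v (ord_pred i)) (v (ordS i)).

(* Divisors of characters. H_2(S, Z) is the group of torus invariant 1-cycles
   modulo these. *)
Definition principal : {pred 'rV[int]_n} :=
  [pred a : 'rV[int]_n | `[< exists m : int * int,
                 forall i, a 0 i = m.1 * (v i).1 + m.2 * (v i).2 >]].

Lemma principal_zmod_closed : zmod_closed principal.
Proof.
split=> [|a b /asboolP[m am] /asboolP[m' bm']]; apply/asboolP.
  by exists (0, 0) => i; rewrite mxE !mul0r addr0.
exists (m.1 - m'.1, m.2 - m'.2) => i.
by rewrite !mxE am bm' /= !mulrBl opprD addrACA.
Qed.

HB.instance Definition _ :=
  GRing.isZmodClosed.Build 'rV[int]_n principal principal_zmod_closed.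

Definition H2 := Quotient.quot principal.
HB.instance Definition _ := GRing.Zmodule.on H2.
HB.instance Definition _ := Quotient.on H2.

Definition KS : tcy_fan :=
  @TCYFan n.+1
    (fun j => if unlift ord0 j is Some i then v i else 0)
    [set (ord0, lift ord0 i, lift ord0 (ordS i)) | i : 'I_n]%SET.

(* The 2-cones spanned by (0,0,1) and (v_i,1) give the curves D_i in the zero
   section of K_S. *)
Definition zero_section (beta : H2) : 'rV[int]_(nrays KS) :=
  \sum_i @curve KS (ord0, lift ord0 i) *~ (repr beta) 0 i.

End Surface.

Section SurfaceTheory.
Variables (n : nat) (v : 'I_n -> int * int).
Hypothesis smv : smooth_rays v.

Lemma surf_wall i :
  v (ord_pred i) + v (ordS i) = v i *~ det2 (v (ord_pred i)) (v (ordS i)).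
Proof.
have := smv (ord_pred i); rewrite ord_predK; have := smv i.
case: (v i) (v (ordS i)) (v (ord_pred i)) => [a1 a2] [b1 b2] [c1 c2] ab ca.
rewrite mulrz_pair; congr pair; rewrite /= mulrzz.
  transitivity (c1 * det2 (a1, a2) (b1, b2) + b1 * det2 (c1, c2) (a1, a2)).
    by rewrite ab ca !mulr1.
  by rewrite /det2 /=; ring.
transitivity (c2 * det2 (a1, a2) (b1, b2) + b2 * det2 (c1, c2) (a1, a2)).
  by rewrite ab ca !mulr1.
by rewrite /det2 /=; ring.
Qed.

Lemma principal_surf_int (a : 'rV[int]_n) j :
  a \in principal v -> \sum_i a 0 i * surf_int v i j = 0.
Proof.
case/asboolP=> m am.
transitivity (a 0 (ord_pred j) + a 0 (ordS j) -
              a 0 j * det2 (v (ord_pred j)) (v (ordS j))).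
  have sum1 (f : 'I_n -> int) k : \sum_i f i * (i == k)%:R = f k.
    rewrite (bigD1 k) //= eqxx mulr1 big1 ?addr0 // => i /negPf->.
    by rewrite mulr0.
  have eqS i : (j == ordS i) = (i == ord_pred j).
    by apply/eqP/eqP => [->|->]; rewrite ?ordSK ?ord_predK.
  rewrite -(sum1 (a 0)) -(sum1 (a 0)) -big_split /=.
  rewrite -(sum1 (fun i => a 0 i * det2 (v (ord_pred i)) (v (ordS i)))) -sumrB.
  by apply: eq_bigr => i _; rewrite /surf_int eqS; ring.
have /(congr1 (fun x => m.1 * x.1 + m.2 * x.2)) := surf_wall j.
rewrite mulrz_pair !am /= !mulrzz => E; apply/eqP; rewrite subr_eq0; apply/eqP.
transitivity (m.1 * ((v (ord_pred j)).1 + (v (ordS j)).1) +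
              m.2 * ((v (ord_pred j)).2 + (v (ordS j)).2)); first by ring.
by rewrite E; ring.
Qed.

Lemma KS_cone0 i c :
  is_cone (X := KS v) ord0 (lift ord0 i) c = (c == lift ord0 (ordS i)).
Proof.
rewrite /is_cone; apply/idP/eqP => [|->]; last first.
  by apply/orP; left; apply/imsetP; exists i.
case/or3P => /imsetP[j _] //.
by case=> E ->; have -> : i = j by apply: val_inj.
Qed.

Lemma KS_cone1 i d :
  is_cone (X := KS v) (lift ord0 i) ord0 d = (d == lift ord0 (ord_pred i)).
Proof.
rewrite /is_cone; apply/idP/eqP => [|->]; last first.
  apply/or3P; apply: Or32; apply/imsetP; exists (ord_pred i) => //.
  by rewrite ord_predK.
case/or3P => /imsetP[j _] //.
case=> -> E; have -> : i = ordS j by apply: val_inj; case: E.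
by rewrite ordSK.
Qed.

Lemma curve_KS i : @curve (KS v) (ord0, lift ord0 i) =
  \row_j if unlift ord0 j is Some j' then surf_int v i j'
         else - \sum_j' surf_int v i j'.
Proof.
rewrite /curve /=; under eq_bigl do rewrite KS_cone0; rewrite big_pred1_eq.
under eq_bigl do rewrite KS_cone1; rewrite big_pred1_eq.
apply/rowP => j; rewrite !mxE /= unlift_none !liftK.
have eqP' j' : (j' == ord_pred i) = (i == ordS j').
  by apply/eqP/eqP => [->|->]; rewrite ?ordSK ?ord_predK.
have d0 x y : det3 0 x y = det2 x y by rewrite /det3 !subr0.
rewrite d0; case: unliftP => [j'|] -> {j}.
  rewrite !(inj_eq (@lift_inj _ _)) -(inj_eq val_inj (lift _ _)) /= mulr0 subr0.
  by rewrite /surf_int eqP' (eq_sym i j') [_%:R * _]mulrC.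
rewrite eqxx !(negPf (neq_lift _ _)) !mulr0n add0r mulr0 subr0 mulr1; congr (- _).
have sum1 (k : 'I_n) : \sum_j (j == k)%:R = 1%R :> int.
  by rewrite (bigD1 k) //= eqxx big1 ?addr0 // => j /negPf->.
have := smv (ord_pred i); rewrite ord_predK => smp.
transitivity (det2 (v (ord_pred i)) (v i) + det2 (v i) (v (ordS i))
              - det2 (v (ord_pred i)) (v (ordS i))).
  by rewrite /det3 /det2 /=; ring.
rewrite smp smv /surf_int sumrB big_split /= -mulr_suml.
have sum1' (k : 'I_n) : \sum_j (k == j)%:R = 1%R :> int.
  by under eq_bigr do rewrite eq_sym; exact: sum1.
have -> : \sum_j (i == ordS j)%:R = 1%R :> int.
  by under eq_bigr do rewrite -eqP'; exact: sum1.
by rewrite sum1 sum1' mul1r.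
Qed.

Lemma zero_section_pi (a : 'rV[int]_n) :
  zero_section (\pi_(H2 v) a) =
  \sum_i @curve (KS v) (ord0, lift ord0 i) *~ a 0 i.
Proof.
apply/eqP; rewrite -subr_eq0 -sumrB; apply/eqP.
set b := repr _; have : b - a \in principal v.
  by rewrite Quotient.idealrBE; apply/eqP; rewrite reprK.
move=> /principal_surf_int bP; apply/rowP => j; rewrite summxE mxE.
under eq_bigr => i _ do rewrite -mulrzBr curve_KS -scaler_int !mxE intz.
have E i : b 0 i - a 0 i = (b - a) 0 i by rewrite !mxE.
case: unliftP => [j'|] _; first by under eq_bigr => i _ do rewrite E; exact: bP.
under eq_bigr => i _ do rewrite E mulrN mulr_sumr.
by rewrite sumrN exchange_big /= big1 ?oppr0 // => j' _; exact: bP.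
Qed.

End SurfaceTheory.

Section Blowup.
Variables (n : nat) (v : 'I_n -> int * int) (k : 'I_n).

(* The ray of the exceptional curve is inserted in position k + 1, between
   v_k and v_(k+1). *)
Definition exc : 'I_n.+1 := lift ord0 k.

Definition blowup (j : 'I_n.+1) : int * int :=
  if unlift exc j is Some i then v i else v k + v (ordS k).

Definition exc_class : H2 blowup := \pi_(H2 blowup) (delta_mx 0 exc).

Definition dot_exc (beta : H2 blowup) : int :=
  \sum_j (repr beta) 0 j * surf_int blowup j exc.

(* E is contracted, and the other torus invariant curves map birationally onto
   their images. *)
Definition pushforward (beta : H2 blowup) : H2 v :=
  \pi_(H2 v) (\row_i (repr beta) 0 (lift exc i)).

End Blowup.

Section BlowupTheory.
Variables (n : nat) (v : 'I_n -> int * int) (k : 'I_n).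

Lemma ordS_exc : ordS (exc k) = lift (exc k) (ordS k).
Proof.
apply: val_inj; rewrite /= /bump /= !add1n.
have := ltn_ord k; rewrite leq_eqVlt => /orP[/eqP nk|lt].
  by rewrite nk !modnn -nk.
by rewrite !modn_small //; lia.
Qed.

Lemma ordS_lift_exc i :
  ordS (lift (exc k) i) = if i == k then exc k else lift (exc k) (ordS i).
Proof.
case: eqVneq => [->|neq]; apply: val_inj; rewrite /= /bump /= !add1n.
  by rewrite ltnn add0n modn_small // ltnS.
have {}neq : (i : nat) != k by [].
have := ltn_ord i; rewrite leq_eqVlt => /orP[/eqP ni|lt].
  have := ltn_ord k; rewrite ni modnn => kn.
  by rewrite (_ : (k < i)%N) ?add1n ?ni ?modnn //; lia.
have kn := ltn_ord k; rewrite [in RHS]modn_small //.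
rewrite /= in lt; case: (ltngtP k i) neq => // ki _.
  by rewrite ltnS (ltnW ki) modn_small //= ltnS.
by rewrite ltnS leqNgt ki modn_small //= ltnS ltnW // ltnW.
Qed.

Lemma smooth_blowup : smooth_rays v -> smooth_rays (blowup v k).
Proof.
move=> smv j; case: (unliftP (exc k) j) => [i|] ->.
  rewrite ordS_lift_exc; case: eqVneq => [->|_]; rewrite /blowup ?liftK ?smv //.
  rewrite unlift_none -[RHS](smv k) /det2 /=; ring.
rewrite ordS_exc /blowup liftK unlift_none -[RHS](smv k) /det2 /=; ring.
Qed.

Lemma dot_exc_pi (a : 'rV[int]_n.+1) : smooth_rays v ->
  dot_exc (\pi_(H2 (blowup v k)) a) =
  \sum_j a 0 j * surf_int (blowup v k) j (exc k).
Proof.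
move=> /smooth_blowup smb; apply/eqP; rewrite -subr_eq0 -sumrB; apply/eqP.
set b := repr _; have : b - a \in principal (blowup v k).
  by rewrite Quotient.idealrBE; apply/eqP; rewrite reprK.
move/(principal_surf_int smb (exc k)) => {2}<-; apply: eq_bigr => j _.
by rewrite !mxE mulrBl.
Qed.

Lemma pushforward_pi (a : 'rV[int]_n.+1) :
  pushforward (\pi_(H2 (blowup v k)) a) =
  \pi_(H2 v) (\row_i a 0 (lift (exc k) i)).
Proof.
rewrite /pushforward; set b := repr _.
have : b - a \in principal (blowup v k).
  by rewrite Quotient.idealrBE; apply/eqP; rewrite reprK.
case/asboolP => m bam; apply/eqP; rewrite -Quotient.idealrBE; apply/asboolP.
exists m => i; have := bam (lift (exc k) i).
by rewrite !mxE /blowup liftK.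
Qed.

End BlowupTheory.

(* Main.v *)
(* For K_S the middle leg of every vertex is empty, so that Z is a sum over
   labels la_i of the curves D_i of framing factors times the product of the
   C(la_i, 0, la_(i+1)^t). In the blowup the label eta of E only occurs in two
   vertices, and the key identity is

     sum_eta (-Q)^|eta| C(al, 0, eta^t) C(eta, 0, be) = Zc(Q) P_(al,be)(-Q),

   where Zc is the partition function of the resolved conifold and P_(al,be) is a
   polynomial of degree at most |al| + |be| whose coefficient in this degree is
   q^((kappa(be) - kappa(al))/2) C(al, 0, be). Hence the partition function of the
   blowup is Zc(Q_E) Z', where Z' is supported on the d with d.E >= 0 and agrees
   with the partition function of K_S on the face d.E = 0. Taking logarithms
   gives (i), (ii) and (iii), since a power series and its logarithm have
   compatible restrictions to faces.

   For the key identity let S be the matrix of the s_(la/mu)(q^rho), H = S S^T,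
   W = q^(-kappa/2) H, U and V the operators adding a box of content c with weight
   q^-c and 1, and P the diagonal matrix of the regularized power sums
   -p_1(q^(-la-rho)). Splitting off one variable of S gives commutation relations
   of S with U, V and P, hence relations such as U^T H = H P. By induction on the
   number of boxes of al they imply that the matrix S^T W has the same columns as
   W, up to the coefficients of Zc(Q) times the product of the 1 - Q q^-c over the
   boxes of al. *)

From HB Require Import structures.
Require Import Defs.
From mathcomp Require Import all_boot all_order all_algebra.
From mathcomp Require Import generic_quotient ring_quotient.
From mathcomp Require Import boolp classical_sets functions cardinality fsbigop.
From mathcomp Require Import complex Rstruct mpoly.
From mathcomp Require Import ring zify.

Set Implicit Arguments.
Unset Strict Implicit.
Unset Printing Implicit Defensive.

Import Order.TTheory GRing.Theory Num.Theory.
Local Open Scope ring_scope.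

(** * Partitions *)

(** Behind the key identity stands a skew Cauchy identity. By [boxV_Wm] the entries W(la, al), as
    functions of la, obey a Pieri rule: their sum over the partitions obtained by adding a box to la
    is W(la, al) times an eigenvalue P(al). So column al of W behaves like the values of the Schur
    functions at a point attached to al, and summing S(eta, nu) W(eta, al) over eta should reproduce
    W(nu, al) times a Cauchy product. The products for al and for the empty partition differ by one
    factor for each box of al. The obstacle is that s_(la/mu)(q^rho) is given by limits in finitely
    many variables for |q| > 1, so identities of symmetric functions do not apply directly. What is
    extracted from the limits is that S is unitriangular for the size and satisfies [S_rec]. As q is
    not a root of unity, this leaves no freedom: a row of blocks that obeys the same homogeneous
    recursion and vanishes in top degrees is zero ([dilation_vanish]). Each commutation relation of
    S is proved by showing that the difference of its sides is such a row. *)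

Lemma lt_size_part (mu : part) i : (i < size mu)%N = (0 < nth 0%N mu i)%N.
Proof.
case: ltnP => [lt|ge]; last by rewrite nth_default.
have /andP[_ n0] := valP mu; symmetry; rewrite lt0n.
by apply: contra n0 => /eqP <-; exact: mem_nth.
Qed.

Lemma nth_part_le (mu : part) i j : (i <= j)%N -> (nth 0%N mu j <= nth 0%N mu i)%N.
Proof.
move=> ij; case: (ltnP j (size mu)) => [lt|ge]; last by rewrite (nth_default _ ge).
have /andP[srt _] := valP mu.
have := @sorted_leq_nth _ geq _ _ 0%N mu srt; apply => //.
- by move=> a b c; rewrite /geq /= => ba ac; exact: leq_trans ac ba.
- by move=> a; rewrite /geq /=.
- by rewrite inE (leq_ltn_trans ij).
Qed.

Lemma part_ext (mu nu : part) :
  (forall i, nth 0%N mu i = nth 0%N nu i) -> mu = nu.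
Proof.
move=> E; apply: val_inj => /=; apply: (@eq_from_nth _ 0%N) => [|i _]; last exact: E.
have lt i : (i < size mu)%N = (i < size nu)%N by rewrite !lt_size_part E.
apply/eqP; rewrite eqn_leq; apply/andP; split; rewrite leqNgt.
  by rewrite lt ltnn.
by rewrite -lt ltnn.
Qed.

Lemma psizeE (mu : part) N : (size mu <= N)%N ->
  psize mu = (\sum_(i < N) nth 0%N mu i)%N.
Proof.
move=> le; rewrite /psize sumnE (big_nth 0%N) big_mkord.
rewrite (big_ord_widen N (fun i => nth 0%N mu i) le) [RHS](bigID (fun i : 'I_N => (i < size mu)%N)) /=.
rewrite [X in (_ = _ + X)%N]big1 ?addn0 // => i; rewrite -leqNgt => ge.
by rewrite nth_default.
Qed.

Lemma size_psize (mu : part) : (size mu <= psize mu)%N.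
Proof.
rewrite (psizeE (leqnn _)) -[leqLHS]muln1 -[in leqLHS](card_ord (size mu)) -sum_nat_const.
by apply: leq_sum => i _; rewrite -lt_size_part.
Qed.

Lemma nth_psize (mu : part) i : (nth 0%N mu i <= psize mu)%N.
Proof.
case: (ltnP i (size mu)) => [lt|ge]; last by rewrite nth_default.
by rewrite (psizeE (leqnn _)) (bigD1 (Ordinal lt)) //= leq_addr.
Qed.

Lemma psize0 : psize part0 = 0%N. Proof. by []. Qed.

Lemma psize_eq0 (mu : part) : psize mu = 0%N -> mu = part0.
Proof.
move=> E; apply: part_ext => i; rewrite nth_nil; apply/eqP.
by rewrite -leqn0 -{2}E nth_psize.
Qed.

Definition part_of_seq (s : seq nat) : part :=
  insubd part0 [seq i <- s | (0 < i)%N].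

Lemma nth_part_of_seq (f : nat -> nat) N i :
    (forall i, (f i.+1 <= f i)%N) -> f N = 0%N ->
  nth 0%N (part_of_seq (mkseq f N)) i = f i.
Proof.
move=> fle fN.
have homo j k : (j <= k)%N -> (f k <= f j)%N.
  move=> /subnK <-; elim: (k - j)%N => // m IH; rewrite addSn.
  exact: leq_trans (fle _) IH.
have P : is_part [seq i <- mkseq f N | (0 < i)%N].
  rewrite /is_part mem_filter /= andbT; apply: sorted_filter.
    by move=> a b c; rewrite /geq /= => ba ac; exact: leq_trans ac ba.
  apply: (homo_sorted (e := ltn)); last exact: iota_ltn_sorted.
  by move=> a b /ltnW/homo.
rewrite /part_of_seq /= -[parts _]/(val _) val_insubd P.
elim: N f fle fN homo i {P} => [|N IH] f fle fN homo i.
  by rewrite /mkseq /= nth_nil; apply/esym/eqP; rewrite -leqn0 -fN homo.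
rewrite /mkseq /= (iotaDl 1 0) -map_comp.
case: (posnP (f 0%N)) => [f0|f0].
  have z j : f j = 0%N by apply/eqP; rewrite -leqn0 -f0 homo.
  rewrite (eq_map (g := fun=> 0%N)) => [|j]; last by rewrite /= z.
  by rewrite z; elim: (iota _ _) => /= [|_ s]; rewrite ?nth_nil.
case: i => [//|i] /=.
have -> := esym (IH (fun j => f j.+1) (fun j => fle j.+1) fN (fun j k jk => homo j.+1 k.+1 jk) i).
by [].
Qed.

(* [hstrip] for arbitrary row functions, since adding a box to a partition may
   not give a partition. *)
Definition hstripf (a b : nat -> nat) : Prop :=
  forall i, (a i.+1 <= b i <= a i)%N.

(** A partition of n has at most n rows, of length at most n, so functions from 'I_n to 'I_n.+1
    reach all of them. Different functions may give the same partition, whence [undup]. *)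
Definition partsn (n : nat) : seq part :=
  undup [seq mu <- [seq part_of_seq (mkseq (fun i => oapp (fun j : 'I_n => f j : nat) 0%N (insub i)) n)
                    | f : {ffun 'I_n -> 'I_n.+1}] | psize mu == n].

Lemma partsn_uniq n : uniq (partsn n). Proof. exact: undup_uniq. Qed.

Lemma mem_partsn n mu : (mu \in partsn n) = (psize mu == n).
Proof.
rewrite mem_undup mem_filter; case: eqP => //= E; apply/mapP.
have lt (j : 'I_n) : (nth 0%N mu j < n.+1)%N by rewrite ltnS; apply: (leq_trans (nth_psize _ _)); rewrite E.
exists [ffun j => Ordinal (lt j)]; first by rewrite mem_enum.
apply: part_ext => i.
set f := fun _ => _.
have fE j : f j = nth 0%N mu j.
  rewrite /f; case: insubP => [k _ <-|]; first by rewrite /= ffunE.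
  rewrite -leqNgt => ge; rewrite nth_default // (leq_trans (size_psize _)) ?E //.
rewrite nth_part_of_seq ?fE //; first by move=> j; rewrite !fE nth_part_le.
by rewrite nth_default // -E size_psize.
Qed.

Lemma partsn0 : partsn 0 = [:: part0].
Proof.
apply: perm_small_eq => //; apply: uniq_perm; rewrite ?partsn_uniq // => mu.
rewrite mem_partsn inE; apply/eqP/eqP => [/psize_eq0//|->//].
Qed.

Definition covers (la mu : part) i : Prop :=
  forall j, nth 0%N la j = (nth 0%N mu j + (j == i))%N.

Lemma covers_size la mu i : covers la mu i -> psize la = (psize mu).+1.
Proof.
move=> c; pose N := maxn (maxn (size la) (size mu)) i.+1.
have laN : (size la <= N)%N by rewrite /N; lia.
have muN : (size mu <= N)%N by rewrite /N; lia.
have iN : (i < N)%N by rewrite /N; lia.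
rewrite (psizeE laN) (psizeE muN).
under eq_bigr => j _ do rewrite c.
rewrite big_split /= [X in (_ + X)%N](bigD1 (Ordinal iN)) //= eqxx.
rewrite [X in (_ + (_ + X))%N]big1 ?addn0 ?addn1 // => j.
by rewrite -val_eqE /= => /negPf->.
Qed.

Lemma covers_lt_size la mu i : covers la mu i -> (i < size la)%N.
Proof. by move=> c; rewrite lt_size_part c eqxx addn1. Qed.

Lemma covers_inj la mu i j : covers la mu i -> covers la mu j -> i = j.
Proof. by move=> ci cj; have := ci i; rewrite cj eqxx; case: eqP => //; lia. Qed.

(** The box removed is the end of the last row, which always leaves a partition. *)
Lemma part_box_ind (Q : part -> Prop) :
  Q part0 -> (forall la mu i, covers la mu i -> Q mu -> Q la) -> forall la, Q la.
Proof.
move=> Q0 QS la; have [n le] := ubnP (psize la); elim: n la le => // n IH la le.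
case: (posnP (size la)) => [/size0nil la0|].
  by have -> : la = part0 by apply: val_inj.
move=> s0; pose i := (size la).-1.
have iS : i.+1 = size la by rewrite prednK.
pose f j := (nth 0%N la j - (j == i))%N.
have [lai lai1] : (0 < nth 0%N la i)%N /\ nth 0%N la i.+1 = 0%N.
  by rewrite -lt_size_part -iS ltnSn iS nth_default.
have fE j : nth 0%N (part_of_seq (mkseq f (size la))) j = f j.
  apply: nth_part_of_seq => [k|]; last by rewrite /f nth_default.
  rewrite /f; have := @nth_part_le la k k.+1; case: (eqVneq k i) => [->|]; lia.
have c : covers la (part_of_seq (mkseq f (size la))) i.
  by move=> j; rewrite fE /f; case: eqP => [->|]; lia.
by apply: (QS _ _ _ c); apply: IH; have := covers_size c; lia.
Qed.

(** This form shows that kappa is twice the sum of the contents j - i of the boxes; it yields both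
    [kappa_cov] and [kappa_conj]. *)
Lemma kappaE (mu : part) N : (size mu <= N)%N ->
  kappa mu = \sum_(i < N) \sum_(j < nth 0%N mu i) (2 * (j%:Z - i%:Z)).
Proof.
move=> le; rewrite /kappa (psizeE (leqnn _)) -[X in X + _]natz natr_sum -big_split /=.
rewrite (big_ord_widen N (fun i => (nth 0 mu i)%:R + (nth 0 mu i)%:Z * ((nth 0 mu i)%:Z - (2 * i.+1)%N%:Z)) le).
rewrite [RHS](bigID (fun i : 'I_N => (i < size mu)%N)) /=.
rewrite [X in (_ = _ + X)]big1 ?addr0 => [|i]; last first.
  by rewrite -leqNgt => ge; rewrite nth_default // big_ord0.
apply: eq_bigr => i _; elim: (nth 0%N mu i) => [|k IH]; first by rewrite big_ord0; lia.
rewrite big_ord_recr /= -IH !natz; lia.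
Qed.

Lemma kappa_cov la mu i : covers la mu i ->
  kappa la = kappa mu + 2 * ((nth 0%N mu i)%:Z - i%:Z).
Proof.
move=> c; pose N := maxn (maxn (size la) (size mu)) i.+1.
have laN : (size la <= N)%N by rewrite /N; lia.
have muN : (size mu <= N)%N by rewrite /N; lia.
have iN : (i < N)%N by rewrite /N; lia.
rewrite (kappaE laN) (kappaE muN) (bigD1 (Ordinal iN)) //= [in RHS](bigD1 (Ordinal iN)) //=.
rewrite c eqxx addn1 big_ord_recr /= -!addrA; congr (_ + _).
rewrite addrC; congr (_ + _).
apply: eq_bigr => j; rewrite -val_eqE /= c => /negPf ->; by rewrite addn0.
Qed.

Lemma count_lt_part (mu : part) j i : (i < count (ltn j) mu)%N = (j < nth 0%N mu i)%N.
Proof.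
have /andP[srt _] := valP mu; move: srt => /=; elim: (parts mu) i => [|a s IH] i.
  by rewrite nth_nil.
move=> srt; have {}IH := IH ^~ (path_sorted srt).
have alls : all (geq a) s.
  by move: srt; rewrite /= path_sortedE => [/andP[]//|x y z]; rewrite /geq /=; lia.
rewrite [count _ _]/=; case: (ltnP j a) => ja; last first.
  have z k : (nth 0%N (a :: s) k <= j)%N.
    case: k => [|k] //=; case: (ltnP k (size s)) => [lt|ge]; last by rewrite nth_default.
    by apply: leq_trans ja; apply: (allP alls); exact: mem_nth.
  rewrite add0n [RHS]ltnNge z /=.
  suff -> : count (ltn j) s = 0%N by [].
  apply/eqP; rewrite -leqn0 leqNgt -has_count; apply/hasPn => x xs /=.
  by rewrite -leqNgt; apply: leq_trans ja; exact: (allP alls).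
by case: i => [|i] //=; rewrite add1n ltnS IH.
Qed.

Lemma nth_conj (mu : part) j : nth 0%N (conj_part mu) j = count (ltn j) mu.
Proof.
rewrite /= /conj_seq; case: (ltnP j (head 0%N mu)) => [lt|ge].
  by rewrite (nth_map 0%N) ?size_iota // nth_iota // add0n.
rewrite nth_default ?size_map ?size_iota //.
apply/esym/eqP; rewrite -leqn0 leqNgt count_lt_part -leqNgt.
by case: (parts mu) ge.
Qed.

Lemma lt_conj (mu : part) i j :
  (i < nth 0%N (conj_part mu) j)%N = (j < nth 0%N mu i)%N.
Proof. by rewrite nth_conj count_lt_part. Qed.

Lemma conj_partK : involutive conj_part.
Proof.
move=> mu; apply: part_ext => i.
have E j : (j < nth 0%N (conj_part (conj_part mu)) i)%N = (j < nth 0%N mu i)%N.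
  by rewrite !lt_conj.
apply/eqP; rewrite eqn_leq; apply/andP; split; rewrite leqNgt.
  by rewrite E ltnn.
by rewrite -E ltnn.
Qed.

Lemma conj_part0 : conj_part part0 = part0. Proof. exact: val_inj. Qed.

Lemma sum_cells (V : zmodType) (mu : part) (f : nat -> nat -> V) N :
  (psize mu <= N)%N ->
  \sum_(i < N) \sum_(j < nth 0%N mu i) f i j =
  \sum_(i < N) \sum_(j < N) (if (j < nth 0%N mu i)%N then f i j else 0).
Proof.
move=> le; apply: eq_bigr => i _.
have le' : (nth 0%N mu i <= N)%N by apply: leq_trans le; exact: nth_psize.
by rewrite (big_ord_widen N (f i) le') big_mkcond.
Qed.

Lemma psize_conj (mu : part) : psize (conj_part mu) = psize mu.
Proof.
pose N := (psize mu + psize (conj_part mu))%N.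
have szE nu : (psize nu <= N)%N -> ((psize nu)%:Z = \sum_(i < N) \sum_(j < N) if (j < nth 0%N nu i)%N then 1 else 0).
  move=> le; rewrite -(sum_cells (fun=> fun=> 1) le) (@psizeE nu N); last first.
    exact: leq_trans (size_psize _) le.
  rewrite -natz natr_sum; apply: eq_bigr => i _.
  by rewrite sumr_const card_ord.
apply/eqP; rewrite -eqz_nat; apply/eqP; rewrite !szE ?leq_addr ?leq_addl //.
rewrite exchange_big /=; apply: eq_bigr => i _; apply: eq_bigr => j _.
by rewrite lt_conj.
Qed.

Lemma kappa_conj (mu : part) : kappa (conj_part mu) = - kappa mu.
Proof.
have kE nu : psize nu = psize mu -> kappa nu = \sum_(i < psize mu) \sum_(j < psize mu)
    if (j < nth 0%N nu i)%N then 2 * (j%:Z - i%:Z) else 0.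
  move=> E; rewrite -(@sum_cells _ _ (fun i j => 2 * (j%:Z - i%:Z))) ?E //.
  by rewrite -kappaE // -E size_psize.
rewrite !kE ?psize_conj // exchange_big -sumrN /=; apply: eq_bigr => i _.
rewrite -sumrN; apply: eq_bigr => j _; rewrite lt_conj; case: ifP => _; lia.
Qed.

(** * Adding boxes to horizontal strips *)
Notation ind P := (`[< P >]%:R).

Section HStripBox.
Variable F : fieldType.

(** Matrix entry of the operator that adds a box of content c with weight [f c]. At most one term of
    the sum is nonzero. *)
Definition box_ker (f : int -> F) (la mu : part) : F :=
  \sum_(i < psize la) ind (covers la mu i) * f ((nth 0%N mu i)%:Z - i%:Z).

Lemma box_kerE f la mu N : (psize la <= N)%N ->
  box_ker f la mu = \sum_(i < N) ind (covers la mu i) * f ((nth 0%N mu i)%:Z - i%:Z).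
Proof.
move=> le; rewrite /box_ker.
rewrite (big_ord_widen N (fun i : nat => ind (covers la mu i) * f ((nth 0%N mu i)%:Z - i%:Z)) le).
rewrite [RHS](bigID (fun i : 'I_N => (i < psize la)%N)) /=.
rewrite [X in (_ = _ + X)]big1 ?addr0 // => i; rewrite -leqNgt => ge.
rewrite asboolF ?mul0r // => /covers_lt_size lt.
by have := leq_trans lt (size_psize la); rewrite ltnNge ge.
Qed.

Lemma box_ker_eq0 f la mu : psize la != (psize mu).+1 -> box_ker f la mu = 0.
Proof.
move=> ne; rewrite /box_ker big1 // => i _; rewrite asboolF ?mul0r // => /covers_size E.
by rewrite E eqxx in ne.
Qed.

Lemma box_ker_cov f la mu i : covers la mu i ->
  box_ker f la mu = f ((nth 0%N mu i)%:Z - i%:Z).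
Proof.
move=> c; have lt := leq_trans (covers_lt_size c) (size_psize la).
rewrite /box_ker (bigD1 (Ordinal lt)) //= asboolT // mul1r big1 ?addr0 // => j ne.
rewrite asboolF ?mul0r // => c'; move: ne; rewrite -val_eqE /=.
by rewrite (covers_inj c c') eqxx.
Qed.

Lemma box_ker_nocov f la mu : (forall i, ~ covers la mu i) -> box_ker f la mu = 0.
Proof. by move=> nc; rewrite /box_ker big1 // => i _; rewrite asboolF ?mul0r. Qed.

(* A partition with a given row function, when it exists, is unique; this turns
   sums over partitions into sums over rows. *)
Lemma sum_covers_up (Q : (nat -> nat) -> Prop) f mu N :
    (forall g, Q g -> forall i, (g i.+1 <= g i)%N) -> (psize mu < N)%N ->
  \sum_(nu <- partsn (psize mu).+1) ind (Q (nth 0%N nu)) * box_ker f nu mu =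
  \sum_(i < N) ind (Q (fun j => nth 0%N mu j + (j == i))%N) *
     f ((nth 0%N mu i)%:Z - i%:Z).
Proof.
move=> Qmon lt.
transitivity (\sum_(nu <- partsn (psize mu).+1) \sum_(i < N)
   ind (Q (nth 0%N nu)) * ind (covers nu mu i) * f ((nth 0%N mu i)%:Z - i%:Z)).
  apply: eq_big_seq => nu; rewrite mem_partsn => /eqP E.
  rewrite (@box_kerE _ _ _ N) ?E // mulr_sumr.
  by apply: eq_bigr => i _; rewrite mulrA.
rewrite exchange_big /=; apply: eq_bigr => i _; rewrite -mulr_suml; congr (_ * _).
case: asboolP => [QQ|nQ]; last first.
  rewrite big1 // => nu _; case: asboolP => c; rewrite ?mul0r //.
  case: asboolP => d; rewrite ?mulr0 //; exfalso; apply: nQ.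
  by rewrite (_ : (fun j => _) = nth 0%N nu) //; apply/funext => j; rewrite d.
pose nu0 := part_of_seq (mkseq (fun j => nth 0%N mu j + (j == i))%N N).
have nuE j : nth 0%N nu0 j = (nth 0%N mu j + (j == i))%N.
  apply: nth_part_of_seq; first exact: Qmon QQ.
  rewrite nth_default ?(leq_trans (size_psize _) (ltnW lt)) //.
  by rewrite gtn_eqF.
have c0 : covers nu0 mu i by [].
rewrite (bigD1_seq nu0) ?partsn_uniq ?mem_partsn ?(covers_size c0) //=.
rewrite [in X in X + _]asboolT; last first.
  by rewrite (_ : nth 0%N _ = (fun j => nth 0%N mu j + (j == i))%N) //; apply/funext.
rewrite asboolT // mulr1 big1 ?addr0 // => nu ne.
rewrite [X in _ * (nat_of_bool X)%:R]asboolF ?mulr0 // => c; case/eqP: ne; apply: part_ext => j.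
by rewrite nuE c.
Qed.

Lemma sum_covers_down (Q : (nat -> nat) -> Prop) f mu N :
    (forall g, Q g -> forall i, (g i.+1 <= g i)%N) -> (psize mu <= N)%N ->
  \sum_(nu <- partsn (psize mu).-1) ind (Q (nth 0%N nu)) * box_ker f mu nu =
  \sum_(i < N) ind ((0 < nth 0%N mu i)%N /\ Q (fun j => nth 0%N mu j - (j == i))%N) *
     f ((nth 0%N mu i)%:Z - 1 - i%:Z).
Proof.
move=> Qmon le.
transitivity (\sum_(nu <- partsn (psize mu).-1) \sum_(i < N)
   ind (Q (nth 0%N nu)) * ind (covers mu nu i) * f ((nth 0%N mu i)%:Z - 1 - i%:Z)).
  apply: eq_big_seq => nu; rewrite mem_partsn => /eqP E.
  rewrite (@box_kerE _ _ _ N) // mulr_sumr.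
  apply: eq_bigr => i _; rewrite mulrA; case: (asboolP (covers _ _ _)) => c.
    by congr (_ * f _); rewrite c eqxx; lia.
  by rewrite mulr0 !mul0r.
rewrite exchange_big /=; apply: eq_bigr => i _; rewrite -mulr_suml; congr (_ * _).
case: asboolP => [[mui QQ]|nQ]; last first.
  rewrite big1 // => nu _; case: asboolP => c; rewrite ?mul0r //.
  case: asboolP => d; rewrite ?mulr0 //; exfalso; apply: nQ.
  split; first by rewrite d eqxx addn1.
  rewrite (_ : (fun j => _) = nth 0%N nu) //; apply/funext => j; rewrite d; lia.
pose nu0 := part_of_seq (mkseq (fun j => nth 0%N mu j - (j == i))%N N).
have nuE j : nth 0%N nu0 j = (nth 0%N mu j - (j == i))%N.
  apply: nth_part_of_seq; first exact: Qmon QQ.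
  by rewrite nth_default ?(leq_trans (size_psize _) le).
have c0 : covers mu nu0 i by move=> j; rewrite nuE; case: eqP => [->|]; lia.
rewrite (bigD1_seq nu0) ?partsn_uniq ?mem_partsn ?(covers_size c0) //=.
rewrite [in X in X + _]asboolT; last first.
  by rewrite (_ : nth 0%N _ = (fun j => nth 0%N mu j - (j == i))%N) //; apply/funext.
rewrite asboolT // mulr1 big1 ?addr0 // => nu ne.
rewrite [X in _ * (nat_of_bool X)%:R]asboolF ?mulr0 // => c; case/eqP: ne; apply: part_ext => j.
by rewrite nuE c addnK.
Qed.

Lemma hstripf_monor a b : hstripf a b -> forall i, (b i.+1 <= b i)%N.
Proof. by move=> h i; have := h i; have := h i.+1; lia. Qed.

Lemma hstripf_monol a b : hstripf a b -> forall i, (a i.+1 <= a i)%N.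
Proof. by move=> h i; have := h i; lia. Qed.

Section RowFunctions.
Variables (a b : nat -> nat) (N : nat) (f : int -> F).
Hypotheses (amon : forall i, (a i.+1 <= a i)%N) (bmon : forall i, (b i.+1 <= b i)%N).
Hypotheses (aN : a N = 0%N) (bN : b N = 0%N).

(** If a/b is a strip, row i contributes to both sums exactly when b_i < a_i, and otherwise the two
    values of [f] coincide. If it is not, the only defect that one box can repair is a_(i+1) = b_i +
    1, and growing row i of b or shrinking row i+1 of a both repair it, with the same argument of
    [f]. The two sums then cancel after a shift of the index. *)
Lemma hstrip_grow_inner :
  \sum_(i < N.+1) ind (hstripf a (fun j => b j + (j == i))%N) * f ((b i)%:Z - i%:Z) -
  \sum_(i < N.+1) ind ((0 < a i)%N /\ hstripf (fun j => a j - (j == i))%N b) *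
     f ((a i)%:Z - i%:Z) =
  ind (hstripf a b) * \sum_(i < N.+1) (f ((b i)%:Z - i%:Z) - f ((a i)%:Z - i%:Z)).
Proof.
case: (asboolP (hstripf a b)) => [h|nh].
  rewrite mul1r -sumrB; apply: eq_bigr => -[i ltiN] _ /=.
  case: (ltnP (b i) (a i)) => [lt|ge].
    rewrite !asboolT ?mul1r //; last first.
      by move=> j; have := h j; case: eqP => [?|?]; subst; lia.
    by split; [lia | move=> j; have := h j; do 2 case: eqP => [?|?]; subst; lia].
  have E : b i = a i by have := h i; lia.
  rewrite E subrr !asboolF ?mul0r ?subrr //.
    by case=> a0 /(_ i); rewrite eqxx; lia.
  by move=> /(_ i); rewrite eqxx; lia.
rewrite mul0r [X in _ - X]big_ord_recl big_ord_recr /=.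
rewrite [in X in X - _]asboolF; last by move=> /(_ N); rewrite eqxx aN bN; lia.
rewrite asboolF; last first.
  by case=> a0 h; apply: nh => j; have := h j; case: eqP => [?|?]; lia.
rewrite !mul0r addr0 add0r -sumrB big1 // => -[i ltiN] _ /=; apply/eqP; rewrite subr_eq0; apply/eqP.
rewrite /bump /= add1n.
case: (eqVneq (a i.+1) (b i).+1) => [e|ne].
  congr (_%:R * f _); last by rewrite e; lia.
  congr nat_of_bool; apply: asbool_equiv_eq; split => [h|[_ h]].
    split; first by rewrite e.
    move=> j; have := h j; have := bmon i; rewrite eqSS.
    by do 2 case: eqP => [?|?]; subst; lia.
  move=> j; have := h j; have := amon i; rewrite eqSS.
  by do 2 case: eqP => [?|?]; subst; lia.
rewrite !asboolF ?mul0r //.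
  case=> a0 h; apply: nh => j; have := h j; rewrite eqSS.
  by do 2 case: eqP => [?|?]; subst; lia.
move=> h; apply: nh => j; have := h j.
by case: eqP => [?|?]; subst; lia.
Qed.

(** For a strip, row 0 of a can always grow, and row i+1 of a can grow exactly when row i of b can
    shrink. If a/b is not a strip, the repairable defect is b_i = a_i + 1, and growing row i of a or
    shrinking row i of b repairs it with the same argument of [f]. *)
Lemma hstrip_grow_outer :
  \sum_(i < N.+2) ind (hstripf (fun j => a j + (j == i))%N b) * f ((a i)%:Z - i%:Z) -
  \sum_(i < N.+1) ind ((0 < b i)%N /\ hstripf a (fun j => b j - (j == i))%N) *
     f ((b i)%:Z - 1 - i%:Z) =
  ind (hstripf a b) * (f (a 0%N) +
     \sum_(i < N.+1) (f ((a i.+1)%:Z - i.+1%:Z) - f ((b i)%:Z - i.+1%:Z))).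
Proof.
case: (asboolP (hstripf a b)) => [h|nh].
  rewrite mul1r big_ord_recl /= asboolT; last first.
    by move=> j; have := h j; case: eqP => [?|?]; subst; lia.
  rewrite mul1r subr0 -addrA; congr (_ + _).
  rewrite -sumrB; apply: eq_bigr => -[i ltiN] _ /=; rewrite /bump /= add1n.
  have -> : (b i)%:Z - 1 - i%:Z = (b i)%:Z - i.+1%:Z by lia.
  case: (ltnP (a i.+1) (b i)) => [lt|ge].
    rewrite !asboolT ?mul1r //.
      by split; [lia | move=> j; have := h j; case: eqP => [?|?]; subst; lia].
    by move=> j; have := h j; rewrite eqSS; do 2 case: eqP => [?|?]; subst; lia.
  have E : b i = a i.+1 by have := h i; lia.
  rewrite E subrr !asboolF ?mul0r ?subrr //.
    by case=> a0 /(_ i); rewrite eqxx; lia.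
  by move=> /(_ i); rewrite eqxx; lia.
rewrite mul0r big_ord_recr /= asboolF ?mul0r ?addr0; last first.
  by move=> /(_ N); rewrite eqxx bN; lia.
rewrite -sumrB big1 // => -[i ltiN] _ /=; apply/eqP; rewrite subr_eq0; apply/eqP.
case: (eqVneq (b i) (a i).+1) => [e|ne].
  congr (_%:R * f _); last by rewrite e; lia.
  congr nat_of_bool; apply: asbool_equiv_eq; split => [h|[_ h]].
    split; first by rewrite e.
    by move=> j; have := h j; have := amon i; do 2 case: eqP => [?|?]; subst; lia.
  move=> j; have := h j; have := bmon j; have := amon j.
  by case: (j.+1 =P i) => ?; case: (j =P i) => ?; subst; lia.
rewrite !asboolF ?mul0r //.
  case=> a0 h; apply: nh => j; have := h j.
  by case: (j =P i) => ?; subst; lia.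
move=> h; apply: nh => j; have := h j.
by do 2 case: eqP => [?|?]; subst; lia.
Qed.

End RowFunctions.

End HStripBox.

(** * Matrices graded by size *)
Section GradedMatrices.
Variable F : fieldType.

Notation np n := (size (partsn n)).

Definition pidx n (i : 'I_(np n)) : part := nth part0 (partsn n) i.

Lemma psize_pidx n (i : 'I_(np n)) : psize (pidx i) = n.
Proof. by apply/eqP; rewrite -mem_partsn mem_nth. Qed.

Lemma pidx_inj n : injective (@pidx n).
Proof.
move=> i j E; apply: val_inj; apply/eqP.
by rewrite -(nth_uniq part0 (ltn_ord i) (ltn_ord j) (partsn_uniq n)); apply/eqP.
Qed.

Lemma pidxP mu n : psize mu = n -> exists i : 'I_(np n), pidx i = mu.
Proof.
move=> /eqP; rewrite -mem_partsn => muP.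
have lt : (index mu (partsn n) < np n)%N by rewrite index_mem.
by exists (Ordinal lt); rewrite /pidx nth_index.
Qed.

Lemma big_pidx n (f : part -> F) : \sum_(i < np n) f (pidx i) = \sum_(mu <- partsn n) f mu.
Proof. by rewrite (big_nth part0) big_mkord. Qed.

(** Infinite matrices indexed by partitions are cut into blocks by size. All products become finite,
    and matrix algebra applies to them. *)
Definition kmx (A : part -> part -> F) m n : 'M[F]_(np m, np n) :=
  \matrix_(i, j) A (pidx i) (pidx j).

Definition dmx (d : part -> F) n : 'M[F]_(np n) := diag_mx (\row_i d (pidx i)).

Lemma kmxM A B m j n : kmx A m j *m kmx B j n =
  kmx (fun la mu => \sum_(nu <- partsn j) A la nu * B nu mu) m n.
Proof.
apply/matrixP => i k; rewrite !mxE -(big_pidx j (fun nu => A (pidx i) nu * B nu (pidx k))).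
by apply: eq_bigr => l _; rewrite !mxE.
Qed.

Lemma eq_kmx A B m n :
  (forall la mu, psize la = m -> psize mu = n -> A la mu = B la mu) ->
  kmx A m n = kmx B m n.
Proof. by move=> E; apply/matrixP => i j; rewrite !mxE E ?psize_pidx. Qed.

Lemma kmx_inj A B m n : kmx A m n = kmx B m n ->
  forall la mu, psize la = m -> psize mu = n -> A la mu = B la mu.
Proof.
move=> /matrixP E la mu /pidxP[i <-] /pidxP[j <-].
by have := E i j; rewrite !mxE.
Qed.

Lemma kmx0 A m n : (forall la mu, psize la = m -> psize mu = n -> A la mu = 0) ->
  kmx A m n = 0.
Proof. by move=> E; apply/matrixP => i j; rewrite !mxE E ?psize_pidx. Qed.

Lemma kmx_tr A m n : (kmx A m n)^T = kmx (fun la mu => A mu la) n m.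
Proof. by apply/matrixP => i j; rewrite !mxE. Qed.

Lemma kmxB A B m n : kmx A m n - kmx B m n = kmx (fun la mu => A la mu - B la mu) m n.
Proof. by apply/matrixP => i j; rewrite !mxE. Qed.

Lemma kmxZ c A m n : c *: kmx A m n = kmx (fun la mu => c * A la mu) m n.
Proof. by apply/matrixP => i j; rewrite !mxE. Qed.

Lemma dmxE d n r (M : 'M_(np n, r)) i j : (dmx d n *m M) i j = d (pidx i) * M i j.
Proof. by rewrite mul_diag_mx !mxE. Qed.

Lemma mx_dmxE d n r (M : 'M_(r, np n)) i j : (M *m dmx d n) i j = M i j * d (pidx j).
Proof. by rewrite mul_mx_diag !mxE. Qed.

Lemma dmx_kmx d A m n : dmx d m *m kmx A m n = kmx (fun la mu => d la * A la mu) m n.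
Proof. by apply/matrixP => i j; rewrite dmxE !mxE. Qed.

Lemma kmx_dmx d A m n : kmx A m n *m dmx d n = kmx (fun la mu => A la mu * d mu) m n.
Proof. by apply/matrixP => i j; rewrite mx_dmxE !mxE. Qed.

Lemma dmx_tr d n : (dmx d n)^T = dmx d n. Proof. exact: tr_diag_mx. Qed.

Lemma dmxC d e n : dmx d n *m dmx e n = dmx e n *m dmx d n.
Proof. exact: diag_mxC. Qed.

End GradedMatrices.

(** * Matrices of horizontal strips and of box additions *)

Section StripMatrices.
Variable F : fieldType.

Definition Emx m n := kmx (fun la mu => ind (hstrip la mu) : F) m n.
Definition Bmx (f : int -> F) m n := kmx (box_ker f) m n.

Lemma Emx_small m n : (m < n)%N -> Emx m n = 0.
Proof.
move=> lt; apply: kmx0 => la mu lam mun; rewrite asboolF // => h.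
pose N := maxn (size la) (size mu).
have laN : (size la <= N)%N by rewrite /N; lia.
have muN : (size mu <= N)%N by rewrite /N; lia.
suff : (psize mu <= psize la)%N by rewrite lam mun leqNgt lt.
rewrite (psizeE laN) (psizeE muN).
by apply: leq_sum => i _; have := h i; lia.
Qed.

Lemma Emx_diag n : Emx n n = 1%:M.
Proof.
apply/matrixP => i j; rewrite !mxE; congr _%:R; congr nat_of_bool.
apply/asboolP/eqP => [h|->]; last first.
  by move=> k; rewrite leqnn andbT nth_part_le.
apply: pidx_inj; set la := pidx i in h *; set mu := pidx j in h *.
pose N := maxn (size la) (size mu).
have laN : (size la <= N)%N by rewrite /N; lia.
have muN : (size mu <= N)%N by rewrite /N; lia.
have le k : (nth 0%N mu k <= nth 0%N la k)%N by have := h k; lia.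
have : psize la = psize mu by rewrite !psize_pidx.
rewrite (psizeE laN) (psizeE muN) => E; apply: part_ext => k.
case: (ltnP k N) => [kN|ge]; last by rewrite !nth_default ?(leq_trans _ ge).
apply/eqP; rewrite eqn_leq le andbT.
have : (\sum_(i < N) nth 0%N mu i <= \sum_(i < N) nth 0%N la i ?= iff
       [forall i : 'I_N, nth 0%N mu i == nth 0%N la i])%N.
  by apply: leqif_sum => l _; split.
by case=> _; rewrite E eqxx => /esym/forallP /(_ (Ordinal kN)) /eqP /= ->.
Qed.

Lemma Bmx_small f m n : m != n.+1 -> Bmx f m n = 0.
Proof.
by move=> ne; apply: kmx0 => la mu lam mun; rewrite box_ker_eq0 // lam mun.
Qed.

(** For the constant weight 1 the right-hand side of [hstrip_grow_inner] vanishes term by term. *)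
Lemma box_Emx j n :
  Bmx (fun=> 1) j.+1 j *m Emx j n = Emx j.+1 n.+1 *m Bmx (fun=> 1) n.+1 n.
Proof.
rewrite !kmxM; apply: eq_kmx => la mu laj mun.
pose N := maxn (psize la) (psize mu).
have laN : (psize la <= N)%N by rewrite /N; lia.
have muN : (psize mu <= N)%N by rewrite /N; lia.
have szla := leq_trans (size_psize la) laN; have szmu := leq_trans (size_psize mu) muN.
under eq_bigr do rewrite mulrC.
rewrite -[in partsn j]/(j.+1.-1) -laj (@sum_covers_down _ (fun g => hstripf g (nth 0%N mu)) _ _ N.+1) //; first last.
- exact: leqW.
- by move=> g; exact: hstripf_monol.
rewrite -mun (@sum_covers_up _ (hstripf (nth 0%N la)) _ _ N.+1) //; last first.
  by move=> g; exact: hstripf_monor.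
apply/esym/eqP; rewrite -subr_eq0; apply/eqP.
transitivity (ind (hstripf (nth 0%N la) (nth 0%N mu)) * \sum_(i < N.+1) (1 - 1 : F)).
  apply: (@hstrip_grow_inner F (nth 0%N la) (nth 0%N mu) N (fun=> 1)).
  - by move=> i; rewrite nth_part_le.
  - by move=> i; rewrite nth_part_le.
  - by rewrite nth_default.
  - by rewrite nth_default.
by rewrite big1 ?mulr0 // => i _; rewrite subrr.
Qed.

End StripMatrices.

(** * Commutation of horizontal strips with weighted box additions *)

Section BoxRelations.
Variables (F : fieldType) (z : F).
Hypothesis zn0 : z != 0.
Hypothesis z2 : z ^+ 2 != 1.

Local Notation K := (z - z^-1).

Definition qcont (c : int) : F := z ^ (- (2 * c)).

(* Regularization of the divergent sum of the [- z q^(i - la_i)], [q = z ^ 2]. *)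
Definition pval (la : part) : F :=
  K^-1 + z * \sum_(i < size la) (qcont (- i%:Z) - qcont ((nth 0%N la i)%:Z - i%:Z)).

Lemma pvalE (la : part) N : (size la <= N)%N ->
  pval la = K^-1 + z * \sum_(i < N) (qcont (- i%:Z) - qcont ((nth 0%N la i)%:Z - i%:Z)).
Proof.
move=> le; rewrite /pval.
rewrite (big_ord_widen N (fun i : nat => qcont (- i%:Z) - qcont ((nth 0%N la i)%:Z - i%:Z)) le).
rewrite [in RHS](bigID (fun i : 'I_N => (i < size la)%N)) /=.
rewrite [X in _ = _ + _ * (_ + X)]big1 ?addr0 // => i; rewrite -leqNgt => ge.
by rewrite nth_default // sub0r subrr.
Qed.

Lemma pval0 : pval part0 = K^-1.
Proof. by rewrite /pval big_ord0 mulr0 addr0. Qed.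

Lemma qcontD c d : qcont (c + d) = qcont c * qcont d.
Proof. by rewrite /qcont -expfzDr //; congr (_ ^ _); lia. Qed.

Lemma qcont0 : qcont 0 = 1. Proof. by []. Qed.

Lemma qcont_neq0 c : qcont c != 0. Proof. by rewrite expfz_neq0. Qed.

Lemma qcont1 : qcont 1 = z^-2. Proof. by []. Qed.
Lemma qcontN1 : qcont (-1) = z^+2. Proof. by []. Qed.

Lemma K_neq0 : K != 0.
Proof.
apply: contra z2; rewrite subr_eq0 => /eqP E.
by rewrite expr2 {1}E mulVf.
Qed.

Lemma K_factor : K = z * (1 - z^-2).
Proof. by field. Qed.

Lemma pval_diff (la mu : part) N : (size la <= N)%N -> (size mu <= N)%N ->
  pval la - pval mu =
  z * \sum_(i < N) (qcont ((nth 0%N mu i)%:Z - i%:Z) - qcont ((nth 0%N la i)%:Z - i%:Z)).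
Proof.
move=> laN muN; rewrite (pvalE laN) (pvalE muN) opprD addrACA subrr add0r -mulrBr -sumrB.
by congr (_ * _); apply: eq_bigr => i _; ring.
Qed.

Lemma pval_cov la mu i : covers la mu i ->
  pval la = pval mu + K * qcont ((nth 0%N mu i)%:Z - i%:Z).
Proof.
move=> c; pose N := maxn (maxn (size la) (size mu)) i.+1.
have laN : (size la <= N)%N by rewrite /N; lia.
have muN : (size mu <= N)%N by rewrite /N; lia.
have iN : (i < N)%N by rewrite /N; lia.
apply/eqP; rewrite addrC -subr_eq (pval_diff laN muN) (bigD1 (Ordinal iN)) //= big1 ?addr0.
  rewrite c eqxx (_ : (nth 0%N mu i + true)%N%:Z - i%:Z = ((nth 0%N mu i)%:Z - i%:Z) + 1); last by lia.
  by rewrite (qcontD _ 1) qcont1 K_factor; apply/eqP; ring.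
move=> j; rewrite -val_eqE /= => /negPf ne.
by rewrite c ne addn0 subrr.
Qed.

Local Notation Emx := (Emx F).

(** This is [hstrip_grow_inner] for the weight [qcont], whose right-hand side adds up to a
    difference of values of [pval]. A removed box has content one less than the argument of [f]
    there, so its weight differs by z^2; this is why z and z^-1 appear. *)
Lemma pval_Emx j n :
  dmx pval j *m Emx j n - Emx j n *m dmx pval n =
  z *: (Emx j n.+1 *m Bmx qcont n.+1 n) - z^-1 *: (Bmx qcont j j.-1 *m Emx j.-1 n).
Proof.
rewrite dmx_kmx kmx_dmx !kmxM !kmxZ !kmxB; apply: eq_kmx => la mu laj mun.
pose N := maxn (psize la) (psize mu).
have laN : (psize la <= N)%N by rewrite /N; lia.
have muN : (psize mu <= N)%N by rewrite /N; lia.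
have szla := leq_trans (size_psize la) laN; have szmu := leq_trans (size_psize mu) muN.
have -> : z^-1 * (\sum_(nu <- partsn j.-1) box_ker qcont la nu * ind (hstrip nu mu)) =
   z * (z^-2 * \sum_(nu <- partsn (psize la).-1)
     ind (hstripf (nth 0%N nu) (nth 0%N mu)) * box_ker qcont la nu).
  rewrite mulrA expr2 invfM mulrA divff // mul1r laj; congr (_ * _).
  by apply: eq_bigr => nu _; rewrite mulrC.
rewrite -mun (@sum_covers_up _ (hstripf (nth 0%N la)) _ _ N.+1) //; last first.
  by move=> g; exact: hstripf_monor.
rewrite (@sum_covers_down _ (fun g => hstripf g (nth 0%N mu)) _ _ N.+1) //; first last.
- exact: leqW.
- by move=> g; exact: hstripf_monol.
rewrite [X in z * (z^-2 * X)](_ : _ = z^+2 * \sum_(i < N.+1)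
   ind ((0 < nth 0%N la i)%N /\ hstripf (fun j => nth 0%N la j - (j == i))%N (nth 0%N mu)) *
     qcont ((nth 0%N la i)%:Z - i%:Z)); last first.
  rewrite mulr_sumr; apply: eq_bigr => i _; rewrite mulrCA; congr (_ * _).
  by rewrite -qcontN1 -qcontD; congr qcont; lia.
rewrite mulKf ?expf_neq0 // -[RHS]mulrBr hstrip_grow_inner; first last.
- by rewrite nth_default.
- by rewrite nth_default.
- by move=> i; rewrite nth_part_le.
- by move=> i; rewrite nth_part_le.
by rewrite mulrC -mulrBr (pval_diff (leqW szla) (leqW szmu)) mulrCA.
Qed.

(** This is [hstrip_grow_outer] for the weight [qcont]. The constant K^-1 in [pval] is forced by
    this relation: for two empty partitions the left side is z^-1, the weight of the single box of
    content 0, and the right side is (1 - z^-2) times [pval part0]. *)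
Lemma Emx_pval j n :
  z^-1 *: ((Bmx qcont j.+1 j)^T *m Emx j.+1 n - Emx j n.-1 *m (Bmx qcont n n.-1)^T) =
  Emx j n *m dmx pval n - z^-2 *: (dmx pval j *m Emx j n).
Proof.
rewrite dmx_kmx kmx_dmx !kmx_tr !kmxM !kmxZ !kmxB kmxZ; apply: eq_kmx => la mu laj mun.
pose N := maxn (psize la) (psize mu).
have laN : (psize la <= N)%N by rewrite /N; lia.
have muN : (psize mu <= N)%N by rewrite /N; lia.
have szla := leq_trans (size_psize la) laN; have szmu := leq_trans (size_psize mu) muN.
rewrite [X in X - _](_ : _ = \sum_(nu <- partsn (psize la).+1)
     ind (hstripf (nth 0%N nu) (nth 0%N mu)) * box_ker qcont nu la); last first.
  by rewrite laj; apply: eq_bigr => nu _; rewrite mulrC.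
rewrite (@sum_covers_up _ (fun g => hstripf g (nth 0%N mu)) _ _ N.+2) //; first last.
- exact: leqW.
- by move=> g; exact: hstripf_monol.
rewrite -mun (@sum_covers_down _ (hstripf (nth 0%N la)) _ _ N.+1) //; first last.
- exact: leqW.
- by move=> g; exact: hstripf_monor.
rewrite hstrip_grow_outer; first last.
- by rewrite nth_default.
- by rewrite nth_default.
- by move=> i; rewrite nth_part_le.
- by move=> i; rewrite nth_part_le.
rewrite mulrCA [X in _ - X]mulrA [X in _ - X]mulrC -mulrBr; congr (_ * _).
rewrite (pvalE (leqW szmu)) (pvalE (leqW (leqW szla))) [\sum_(i < N.+2) _]big_ord_recl /=.
rewrite !sumrB.
have E1 (c : int) : qcont (c - 1) = z^+2 * qcont c by rewrite (qcontD _ (-1)) mulrC.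
rewrite [X in qcont _ + (X - _)](_ : _ = \sum_(i < N.+1) qcont ((nth 0%N la (bump 0 i))%:Z - (bump 0 i)%:Z)) //.
rewrite [X in qcont _ + (_ - X)](_ : _ = z^+2 * \sum_(i < N.+1) qcont ((nth 0%N mu i)%:Z - i%:Z)); last first.
  rewrite mulr_sumr; apply: eq_bigr => i _; rewrite -E1; congr qcont; lia.
rewrite [X in _ = _ - _ * (_ + _ * (_ + (X - _)))](_ : _ = z^+2 * \sum_(i < N.+1) qcont (- i%:Z)); last first.
  by rewrite mulr_sumr; apply: eq_bigr => i _; rewrite -E1; congr qcont; rewrite /bump /=; lia.
rewrite oppr0 subr0 qcont0.
have := K_neq0; rewrite K_factor => K0; have z2' : z^+2 - 1 != 0 by rewrite subr_eq0.
by field; rewrite zn0.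
Qed.

End BoxRelations.

(** * Principal specialization of skew Schur functions *)
Section PrincipalSpecialization.
Variables (F : fieldType) (z : F).
Hypothesis zn0 : z != 0.
Hypothesis zX : forall n, (0 < n)%N -> z ^+ n != 1.
(* [z] and [S la mu] stand for q^(1/2) and s_(la/mu)(q^rho). In [S_rec] the
   first variable z^-1 is split off; the other ones are z^-2 times the original
   ones, and homogeneity turns this dilation into powers of [z]. *)
Variable S : part -> part -> F.
Hypothesis S_diag : forall la mu, (psize la <= psize mu)%N -> S la mu = (la == mu)%:R.

Local Notation K := (z - z^-1).
Local Notation Sm m n := (kmx S m n).
Local Notation E m n := (Emx F m n).
Local Notation P n := (dmx (pval z) n).
Local Notation U n := (Bmx (qcont z) n.+1 n).
Local Notation Ud n := (Bmx (qcont z) n n.-1).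
Local Notation V n := (Bmx (fun=> 1 : F) n.+1 n).

Hypothesis S_rec : forall m n N, (m < N)%N ->
  z ^+ (2 * m) *: Sm m n = z ^+ n *: \sum_(j < N) z ^+ j *: (Sm m j *m E j n).

Let z2 : z ^+ 2 != 1. Proof. exact: zX. Qed.
Let zn n : z ^+ n != 0. Proof. exact: expf_neq0. Qed.

Lemma Sm_small m n : (m < n)%N -> Sm m n = 0.
Proof.
move=> lt; apply: kmx0 => la mu lam mun; rewrite S_diag ?lam ?mun 1?ltnW //.
by case: eqP => // e; move: lt; rewrite -lam -mun e ltnn.
Qed.

Lemma Sm_diag n : Sm n n = 1%:M.
Proof.
apply/matrixP => i j; rewrite !mxE S_diag ?psize_pidx //; congr _%:R; congr nat_of_bool.
by apply/eqP/eqP => [/pidx_inj|->].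
Qed.

(* The term j = n on the right is z^(2n) X_n, so X_n is determined by the X_j with
   j > n whenever z^(2n) differs from z^(2e). *)
Lemma dilation_vanish r e N (X : forall n, 'M[F]_(r, size (partsn n))) :
    (e <= N)%N -> (forall n, (e <= n)%N -> X n = 0) ->
    (forall n, z ^+ (2 * e) *: X n = z ^+ n *: \sum_(j < N) z ^+ j *: (X j *m E j n)) ->
  forall n, X n = 0.
Proof.
move=> eN Xe XE; suff H d n : (e <= n + d)%N -> X n = 0.
  by move=> n; apply: (H e); rewrite leq_addl.
elim: d n => [|d IH] n; first by rewrite addn0; exact: Xe.
move=> le; case: (leqP e n) => [|ne]; first exact: Xe.
have nN : (n < N)%N by lia.
have := XE n; rewrite (bigD1 (Ordinal nN)) //= big1 ?addr0 => [|j]; last first.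
  rewrite -val_eqE /= neq_ltn => /orP[lt|lt].
    by rewrite Emx_small // mulmx0 scaler0.
  by rewrite IH ?mul0mx ?scaler0 //; lia.
rewrite Emx_diag mulmx1 scalerA -exprD => /eqP.
rewrite -subr_eq0 -scalerBl scaler_eq0 => /orP[|/eqP//].
have -> : (2 * e = (2 * (e - n)) + (n + n))%N by lia.
rewrite exprD -{2}[_ ^+ (n + n)]mul1r -mulrBl mulf_eq0 (negPf (zn _)) orbF subr_eq0.
by rewrite (negPf (zX _)) //; lia.
Qed.

Lemma Sm_recl r m n N (A : 'M[F]_(r, size (partsn m))) : (m < N)%N ->
  z ^+ (2 * m) *: (A *m Sm m n) = z ^+ n *: \sum_(j < N) z ^+ j *: (A *m Sm m j *m E j n).
Proof.
move=> mN; rewrite scalemxAr (S_rec _ mN) -scalemxAr mulmx_sumr; congr (_ *: _).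
by apply: eq_bigr => j _; rewrite -scalemxAr mulmxA.
Qed.

Lemma Sm_recr r m n N (B : 'M[F]_(size (partsn n), r)) : (m < N)%N ->
  z ^+ (2 * m) *: (Sm m n *m B) = z ^+ n *: \sum_(j < N) z ^+ j *: (Sm m j *m E j n *m B).
Proof.
move=> mN; rewrite scalemxAl (S_rec _ mN) -scalemxAl mulmx_suml; congr (_ *: _).
by apply: eq_bigr => j _; rewrite -scalemxAl.
Qed.

Lemma Bmx00 (f : int -> F) n : Bmx f 0 n = 0.
Proof. exact: Bmx_small. Qed.

(** The difference X_n of the two sides satisfies the recursion of [dilation_vanish]. Moving P past
    E by [pval_Emx] creates two terms: the one with E U is the recursion of S U, and the one with U
    E, after a shift of j by one, cancels the term S U E coming from X_j. *)
Lemma Sm_pval m n : P m *m Sm m n - Sm m n *m P n = Sm m n.+1 *m U n.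
Proof.
apply/eqP; rewrite -subr_eq0; apply/eqP.
pose X n := P m *m Sm m n - Sm m n *m P n - Sm m n.+1 *m U n.
rewrite -/(X n); apply: (@dilation_vanish _ m m.+2 X); first exact: leqW.
  move=> {}n; rewrite leq_eqVlt => /orP[/eqP<-|lt].
    by rewrite /X Sm_diag (Sm_small (ltnSn m)) mul0mx subr0 mulmx1 mul1mx subrr.
  by rewrite /X (Sm_small lt) (Sm_small (ltnW _)) // !mul0mx mulmx0 !subr0.
move=> {}n; rewrite /X !scalerBr (Sm_recl _ _ (leqW (ltnSn m))) !(Sm_recr _ (leqW (ltnSn m))).
have shift : \sum_(j < m.+2) z ^+ j *: (z^-1 *: (Sm m j *m (Ud j *m E j.-1 n))) =
             \sum_(j < m.+2) z ^+ j *: (Sm m j.+1 *m U j *m E j n).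
  rewrite big_ord_recl Bmx00 mul0mx mulmx0 !scaler0 add0r [RHS]big_ord_recr /=.
  rewrite (Sm_small (leqW (ltnSn m))) !mul0mx scaler0 addr0; apply: eq_bigr => j _.
  by rewrite /bump /= add1n scalerA exprSr mulfK // mulmxA.
rewrite exprS [z * _]mulrC -[(_ * z) *: _]scalerA -!scalerBr; congr (_ *: _).
rewrite scaler_sumr -!sumrB.
under [RHS]eq_bigr => j _.
  rewrite !mulmxBl -mulmxA -[X in _ - X - _]mulmxA.
  rewrite (_ : P j *m E j n = E j n *m P n + (z *: (E j n.+1 *m U n) - z^-1 *: (Ud j *m E j.-1 n))); last first.
    by rewrite -pval_Emx // addrC subrK.
  rewrite mulmxDr mulmxBr -!scalemxAr !scalerBr scalerDr scalerBr.
  over.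
rewrite !sumrB !big_split /= sumrN shift.
set A := \sum_(j < _) _; set B := \sum_(j < _) _; set C := \sum_(j < _) _.
set D := \sum_(j < _) _; set B' := \sum_(j < _) _; set C' := \sum_(j < _) _.
have -> : D = A by apply: eq_bigr => j _; rewrite mulmxA.
have -> : B' = B by apply: eq_bigr => j _; rewrite mulmxA.
have -> : C' = C by apply: eq_bigr => j _; rewrite !scalerA mulrC mulmxA.
by rewrite !opprD opprK !addrA addrK.
Qed.

Lemma Sm_box m n : V m *m Sm m n = Sm m.+1 n.+1 *m V n.
Proof.
apply/eqP; rewrite -subr_eq0; apply/eqP.
pose X n := V m *m Sm m n - Sm m.+1 n.+1 *m V n.
rewrite -/(X n); apply: (@dilation_vanish _ m m.+2 X); first exact: leqW.
  move=> {}n; rewrite leq_eqVlt => /orP[/eqP<-|lt].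
    by rewrite /X !Sm_diag mulmx1 mul1mx subrr.
  by rewrite /X (Sm_small lt) (@Sm_small m.+1) // !mul0mx mulmx0 !subr0.
move=> {}n; rewrite /X !scalerBr (Sm_recl _ _ (leqW (ltnSn m))).
have -> : z ^+ (2 * m) *: (Sm m.+1 n.+1 *m V n) =
          z ^+ n *: \sum_(j < m.+2) z ^+ j *: (Sm m.+1 j.+1 *m V j *m E j n).
  apply: (scalerI (zn 2)); rewrite !scalerA -exprD (_ : (2 + 2 * m = 2 * m.+1)%N); last by lia.
  rewrite (Sm_recr _ (leqW (ltnSn m.+1))) big_ord_recl Emx_small // mulmx0 mul0mx scaler0 add0r.
  rewrite -exprD (_ : (2 + n = n.+1 + 1)%N) ; last by lia.
  rewrite exprD -[RHS]scalerA; congr (_ *: _); rewrite scaler_sumr; apply: eq_bigr => j _.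
  by rewrite -!mulmxA -box_Emx scalerA -exprD.
rewrite -scalerBr -sumrB; congr (_ *: _); apply: eq_bigr => j _.
by rewrite -scalerBr mulmxBl.
Qed.

Lemma Sm_box_pval m n :
  (U m)^T *m Sm m.+1 n = Sm m n.-1 *m (Ud n)^T + Sm m n *m P n.
Proof.
apply/eqP; rewrite -subr_eq0 opprD addrA; apply/eqP.
pose X n := (U m)^T *m Sm m.+1 n - Sm m n.-1 *m (Ud n)^T - Sm m n *m P n.
rewrite -/(X n); apply: (@dilation_vanish _ m.+1 m.+2 X) => //.
  move=> {}n; rewrite leq_eqVlt => /orP[/eqP<-|lt].
    by rewrite /X !Sm_diag (Sm_small (ltnSn m)) mul0mx subr0 mulmx1 mul1mx subrr.
  rewrite /X (Sm_small lt) (Sm_small (ltnW lt)) (@Sm_small m n.-1); last by lia.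
  by rewrite !mul0mx mulmx0 !subr0.
move=> {}n.
have E1 j : z *: (Sm m j *m ((U j)^T *m E j.+1 n)) =
    z *: (Sm m j *m E j n.-1 *m (Ud n)^T) +
    (z ^+ 2 *: (Sm m j *m E j n *m P n) - Sm m j *m P j *m E j n).
  have /(congr1 (fun M => z ^+ 2 *: (Sm m j *m M))) := Emx_pval zn0 z2 j n.
  rewrite -scalemxAr scalerA mulmxBr scalerBr !mulmxBr -scalemxAr !scalerBr !scalerA.
  rewrite (_ : z ^+ 2 / z = z); last by rewrite expr2 mulfK.
  by rewrite divff ?scale1r // !mulmxA => <-; rewrite addrC subrK.
have H2 n' : z ^+ (2 * m.+1) *: Sm m n' =
    z ^+ (n' + 2) *: \sum_(j < m.+2) z ^+ j *: (Sm m j *m E j n').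
  rewrite (_ : (2 * m.+1 = 2 * m + 2)%N); last by lia.
  rewrite (exprD z _ 2) (exprD z n' 2) ![_ * z ^+ 2]mulrC -!scalerA; congr (_ *: _).
  by rewrite (S_rec _ (leqW (ltnSn m))).
rewrite /X !scalerBr (Sm_recl _ _ (leqnn m.+2)).
have -> : z ^+ (2 * m.+1) *: (Sm m n.-1 *m (Ud n)^T) =
    z ^+ n *: \sum_(j < m.+2) z ^+ j *: (z *: (Sm m j *m E j n.-1 *m (Ud n)^T)).
  case: n {E1} => [|n].
    rewrite Bmx00 trmx0 mulmx0 scaler0 big1 ?scaler0 // => j _.
    by rewrite mulmx0 !scaler0.
  rewrite scalemxAl H2 -scalemxAl addn2 exprSr -scalerA mulmx_suml scaler_sumr.
  by congr (_ *: _); apply: eq_bigr => j _; rewrite -scalemxAl !scalerA mulrC.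
have -> : z ^+ (2 * m.+1) *: (Sm m n *m P n) =
    z ^+ n *: \sum_(j < m.+2) z ^+ j *: (z ^+ 2 *: (Sm m j *m E j n *m P n)).
  rewrite scalemxAl H2 -scalemxAl exprD -scalerA mulmx_suml scaler_sumr.
  by congr (_ *: _); apply: eq_bigr => j _; rewrite -scalemxAl !scalerA mulrC.
have shift : \sum_(j < m.+2) z ^+ j *: (Sm m j.-1 *m (Ud j)^T *m E j n) =
             \sum_(j < m.+2) z ^+ j *: (z *: (Sm m j *m ((U j)^T *m E j.+1 n))).
  rewrite big_ord_recl Bmx00 trmx0 mulmx0 mul0mx scaler0 add0r [RHS]big_ord_recr /=.
  rewrite (Sm_small (ltnSn m)) mul0mx !scaler0 addr0; apply: eq_bigr => j _.
  by rewrite scalerA mulrC -exprS mulmxA.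
rewrite -!scalerBr; congr (_ *: _).
under [RHS]eq_bigr do rewrite !mulmxBl !scalerBr.
rewrite !sumrB shift.
under [X in _ = _ - X - _]eq_bigr do rewrite E1 !scalerDr scalerN.
rewrite !big_split /= sumrN.
set A := \sum_(j < _) _; set B := \sum_(j < _) _; set C := \sum_(j < _) _.
set D := \sum_(j < _) _.
by rewrite !opprD opprK !addrA addrK.
Qed.

(** * Relations for H and W *)

Definition Hm a b := \sum_(j < a.+1) Sm a j *m (Sm b j)^T.

Lemma HmE a b N : (a < N)%N -> Hm a b = \sum_(j < N) Sm a j *m (Sm b j)^T.
Proof.
move=> aN; rewrite /Hm (big_ord_widen N (fun j : nat => Sm a j *m (Sm b j)^T) aN).
rewrite [RHS](bigID (fun j : 'I_N => (j < a.+1)%N)) /=.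
rewrite [X in _ = _ + X]big1 ?addr0 // => j; rewrite -leqNgt => lt.
by rewrite Sm_small ?mul0mx.
Qed.

Lemma Hm_tr a b : (Hm a b)^T = Hm b a.
Proof.
rewrite (@HmE a b (a + b).+1) ?(@HmE b a (a + b).+1) ?ltnS ?leq_addr ?leq_addl //.
by rewrite linear_sum; apply: eq_bigr => j _; rewrite /= trmx_mul trmxK.
Qed.

(** By [Sm_box_pval], U^T S S^T = S U^T S^T + S P S^T. The transpose of [Sm_pval] turns U^T S^T into
    S^T P - P S^T, and the terms S P S^T cancel. *)
Lemma box_Hm a b : (U a)^T *m Hm a.+1 b = Hm a b *m P b.
Proof.
rewrite (HmE _ (ltnSn a.+1)) (HmE _ (leqW (ltnSn a))) mulmx_sumr mulmx_suml.
under eq_bigr do rewrite mulmxA Sm_box_pval mulmxDl -mulmxA -trmx_mul.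
rewrite big_split /= big_ord_recl Bmx00 mulmx0 trmx0 mulmx0 add0r.
under [X in X + _]eq_bigr => j _.
  rewrite /= -Sm_pval linearB /= !trmx_mul !dmx_tr mulmxBr !mulmxA.
  over.
rewrite sumrB [RHS]big_ord_recr [X in _ + X = _]big_ord_recr /=.
by rewrite (Sm_small (ltnSn a)) !mul0mx !addr0 subrK.
Qed.

Lemma Hm_box a b : Hm b a.+1 *m U a = P b *m Hm b a.
Proof. by apply: trmx_inj; rewrite !trmx_mul !Hm_tr dmx_tr box_Hm. Qed.

Definition qcont2 c := qcont z c * qcont z c.
Local Notation U2 n := (Bmx qcont2 n.+1 n).

Lemma commutator_pval_box n : K *: U2 n = P n.+1 *m U n - U n *m P n.
Proof.
rewrite dmx_kmx kmx_dmx kmxZ kmxB; apply: eq_kmx => la mu _ _.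
case: (pselect (exists i, covers la mu i)) => [[i c]|nc]; last first.
  have {}nc i : ~ covers la mu i by move=> c; apply: nc; exists i.
  by rewrite !box_ker_nocov // !mulr0 mul0r subrr.
by rewrite !(box_ker_cov _ c) (pval_cov zn0 z2 c) /qcont2; ring.
Qed.

(** Up to the nonzero factor K, U2 is the commutator of P and U, and [box_Hm] and [Hm_box] carry
    both of these through H. *)
Lemma box2_Hm a b : (U2 a)^T *m Hm a.+1 b = Hm a b.+1 *m U2 b.
Proof.
apply: (scalerI (K_neq0 zn0 z2)).
rewrite scalemxAl -linearZ /= scalemxAr !commutator_pval_box.
rewrite linearB /= !trmx_mul !dmx_tr mulmxBl mulmxBr.
rewrite -[in X in X - _ = _]mulmxA -(Hm_box b a.+1) [in X in X - _ = _]mulmxA box_Hm.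
by rewrite -[in X in _ - X = _]mulmxA box_Hm [in X in _ - X = _]mulmxA -(Hm_box b a) !mulmxA.
Qed.

Definition kapd (la : part) : F := z ^ (- kappa la).
Definition Wm a b := dmx kapd a *m Hm a b.

(** A box of content c raises kappa by 2 c. Passing a box addition through the framing factor thus
    multiplies its weight by q^-c and leads from V to U and from U to U2. *)
Lemma kapd_box f n :
  dmx kapd n.+1 *m Bmx f n.+1 n = Bmx (fun c => f c * qcont z c) n.+1 n *m dmx kapd n.
Proof.
rewrite dmx_kmx kmx_dmx; apply: eq_kmx => la mu _ _.
case: (pselect (exists i, covers la mu i)) => [[i c]|nc]; last first.
  have {}nc i : ~ covers la mu i by move=> c; apply: nc; exists i.
  by rewrite !box_ker_nocov // mulr0 mul0r.
rewrite !(box_ker_cov _ c) mulrC -mulrA; congr (_ * _); rewrite /kapd (kappa_cov c).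
by rewrite /qcont -expfzDr //; congr (_ ^ _); lia.
Qed.

(** This has the shape of the Pieri rule for p_1 times a Schur function, with [pval] in the role of
    the value of p_1. *)
Lemma boxV_Wm a b : (V a)^T *m Wm a.+1 b = Wm a b *m P b.
Proof.
rewrite /Wm -mulmxA -box_Hm !mulmxA; congr (_ *m _).
rewrite -[in LHS](dmx_tr kapd a.+1) -[in RHS](dmx_tr kapd a) -!trmx_mul kapd_box.
congr (_ *m _)^T; apply: eq_kmx => la mu _ _; congr (box_ker _ _ _).
by apply/funext => c; rewrite mul1r.
Qed.

Lemma boxU_Wm a b : (U a)^T *m Wm a.+1 b = Wm a b.+1 *m U2 b.
Proof.
rewrite /Wm -[RHS]mulmxA -box2_Hm !mulmxA; congr (_ *m _).
by rewrite -[in LHS](dmx_tr kapd a.+1) -[in RHS](dmx_tr kapd a) -!trmx_mul kapd_box.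
Qed.

Lemma Wm_box a b : Wm a b.+1 *m U b = P a *m Wm a b.
Proof. by rewrite /Wm -mulmxA Hm_box !mulmxA [dmx kapd a *m _]dmxC. Qed.

(** * The skew Cauchy identity for W *)

Hypothesis pval_neq : forall la, la != part0 -> pval z la != K^-1.

(** The variable stands for -Q, so the factors are the 1 - Q q^-c. *)
Definition cpoly (la : part) : {poly F} :=
  \prod_(i < size la) \prod_(j < nth 0%N la i) (1 + qcont z (j%:Z - i%:Z) *: 'X).

Lemma cpolyE (la : part) N : (size la <= N)%N -> cpoly la =
  \prod_(i < N) \prod_(j < nth 0%N la i) (1 + qcont z (j%:Z - i%:Z) *: 'X).
Proof.
move=> le; rewrite /cpoly (big_ord_widen N
  (fun i : nat => \prod_(j < nth 0%N la i) (1 + qcont z (j%:Z - i%:Z) *: 'X)) le).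
rewrite [RHS](bigID (fun i : 'I_N => (i < size la)%N)) /=.
rewrite [X in _ = _ * X]big1 ?mulr1 // => i; rewrite -leqNgt => ge.
by rewrite nth_default // big_ord0.
Qed.

Lemma cpoly0 : cpoly part0 = 1. Proof. by rewrite /cpoly big_ord0. Qed.

Lemma cpoly_cov la mu i : covers la mu i ->
  cpoly la = (1 + qcont z ((nth 0%N mu i)%:Z - i%:Z) *: 'X) * cpoly mu.
Proof.
move=> c; pose N := maxn (maxn (size la) (size mu)) i.+1.
have laN : (size la <= N)%N by rewrite /N; lia.
have muN : (size mu <= N)%N by rewrite /N; lia.
have iN : (i < N)%N by rewrite /N; lia.
rewrite (cpolyE laN) (cpolyE muN) (bigD1 (Ordinal iN)) //= [in RHS](bigD1 (Ordinal iN)) //=.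
rewrite c eqxx addn1 big_ord_recr /= mulrA; congr (_ * _); first by rewrite mulrC.
by apply: eq_bigr => j; rewrite -val_eqE /= c => /negPf ->; rewrite addn0.
Qed.

Lemma size_cpoly la : (size (cpoly la) <= (psize la).+1)%N.
Proof.
elim/part_box_ind: la => [|la mu i c IH]; first by rewrite cpoly0 size_poly1.
rewrite (cpoly_cov c) (covers_size c); apply: leq_trans (size_polyMleq _ _) _.
have : (size (1 + qcont z ((nth 0%N mu i)%:Z - i%:Z) *: 'X : {poly F})%R <= 2)%N.
  apply: leq_trans (size_polyD _ _) _; rewrite geq_max size_poly1 /=.
  by apply: leq_trans (size_scale_leq _ _) _; rewrite size_polyX.
lia.
Qed.

Lemma lead_cpoly la : (cpoly la)`_(psize la) = kapd la.
Proof.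
elim/part_box_ind: la => [|la mu i c IH].
  by rewrite cpoly0 coef1 /kapd /kappa big_ord0.
rewrite (cpoly_cov c) (covers_size c) mulrDl mul1r coefD -scalerAl coefZ coefXM /= IH.
rewrite nth_default ?size_cpoly // add0r /kapd (kappa_cov c) /qcont -expfzDr //.
by congr (_ ^ _); lia.
Qed.

(** Coefficient of (-Q)^m in Zc(Q); see [zeta0_E] for its expression by vertices. *)
Definition zeta0 m : F := \sum_(eta <- partsn m) S eta part0 * (kapd eta * S eta part0).

Definition zeta la m : F := \sum_(i < m.+1) (cpoly la)`_i * zeta0 (m - i).

(** Coefficient of degree m in 'X^n times the series with coefficients [zeta la]. Including the
    shift gives [zeta_cov] the same shape for all m and n. *)
Definition zetas m n la : F := if (n <= m)%N then zeta la (m - n) else 0.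

Lemma zeta_cov la mu i m n : covers la mu i ->
  zetas m n la = zetas m n mu + qcont z ((nth 0%N mu i)%:Z - i%:Z) * zetas m n.+1 mu.
Proof.
move=> c; rewrite /zetas; case: (ltngtP n m) => [lt|gt|->].
- rewrite subnS -[(m - n)%N]prednK ?subn_gt0 //=; set k := (m - n).-1.
  rewrite /zeta (cpoly_cov c); under eq_bigr do rewrite mulrDl mul1r coefD mulrDl.
  rewrite big_split /=; congr (_ + _); rewrite big_ord_recl -scalerAl coefZ coefXM mulr0 mul0r add0r.
  rewrite mulr_sumr; apply: eq_bigr => j _.
  by rewrite coefZ coefXM /= subSS mulrA.
- by rewrite mulr0 addr0.
- rewrite subnn mulr0 addr0 /zeta !big_ord_recl !big_ord0 (cpoly_cov c).
  by rewrite mulrDl mul1r coefD -scalerAl coefZ coefXM /= mulr0 !addr0.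
Qed.

Lemma zeta_part0 m n : zetas m n part0 = if (n <= m)%N then zeta0 (m - n) else 0.
Proof.
rewrite /zetas; case: ifP => // le; rewrite /zeta cpoly0 big_ord_recl coef1 /= subn0 mul1r.
by rewrite big1 ?addr0 // => i _; rewrite coef1 /= mul0r.
Qed.

Local Notation Z m n b := (dmx (zetas m n) b).

Lemma zeta_box m n b : Z m n b.+1 *m U b = U b *m Z m n b + U2 b *m Z m n.+1 b.
Proof.
rewrite dmx_kmx !kmx_dmx; apply/matrixP => i j; rewrite !mxE.
move: (pidx i) (pidx j) => la mu.
case: (pselect (exists i, covers la mu i)) => [[k c]|nc]; last first.
  have {}nc k : ~ covers la mu k by move=> c; apply: nc; exists k.
  by rewrite !box_ker_nocov // mulr0 !mul0r addr0.
by rewrite !(box_ker_cov _ c) (zeta_cov _ _ c) /qcont2; ring.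
Qed.

Lemma Hm0 a : Hm a 0 = Sm a 0.
Proof.
rewrite /Hm big_ord_recl Sm_diag trmx1 mulmx1 big1 ?addr0 // => j _.
by rewrite (@Sm_small 0) // trmx0 mulmx0.
Qed.

Lemma U0E : U 0 = V 0.
Proof.
apply: eq_kmx => la mu _ /psize_eq0 ->.
case: (pselect (exists i, covers la part0 i)) => [[k c]|nc]; last first.
  have {}nc k : ~ covers la part0 k by move=> c; apply: nc; exists k.
  by rewrite !box_ker_nocov.
have k0 : k = 0%N.
  case: k c => // k c; have := nth_part_le la (leq0n k.+1); rewrite !c.
  by rewrite nth_default // eqxx.
by rewrite !(box_ker_cov _ c) k0.
Qed.

Lemma dmx_part0 (d : part -> F) : dmx d 0 = (d part0)%:M.
Proof.
apply/matrixP => i j; rewrite !mxE.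
by rewrite (psize_eq0 (psize_pidx i)).
Qed.

(** In the column of the empty partition P acts as K^-1, and U 0 = V 0 because the only box has
    content 0. Then [Sm_box] moves V to the left of S, and the framing factor turns it into U. *)
Lemma pval_W0 n : P n.+1 *m Wm n.+1 0 = K^-1 *: Wm n.+1 0 + U n *m Wm n 0.
Proof.
rewrite /Wm !Hm0.
have -> : U n *m (dmx kapd n *m Sm n 0) = dmx kapd n.+1 *m (V n *m Sm n 0).
  rewrite !mulmxA kapd_box; congr (_ *m _ *m _).
  by apply: eq_kmx => la mu _ _; congr (box_ker _ _ _); apply/funext => c; rewrite mul1r.
rewrite Sm_box -U0E -Sm_pval dmx_part0 pval0 mul_mx_scalar mulmxBr -scalemxAr addrC subrK.
by rewrite !mulmxA [dmx kapd _ *m _]dmxC.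
Qed.

Lemma boxU_W0 n : (U n)^T *m Wm n.+1 0 = P n *m Wm n 0.
Proof.
rewrite boxU_Wm -Wm_box; congr (_ *m _); apply: eq_kmx => la mu _ /psize_eq0 ->.
case: (pselect (exists i, covers la part0 i)) => [[k c]|nc]; last first.
  have {}nc k : ~ covers la part0 k by move=> c; apply: nc; exists k.
  by rewrite !box_ker_nocov.
have k0 : k = 0%N.
  case: k c => // k c; have := nth_part_le la (leq0n k.+1); rewrite !c.
  by rewrite nth_default // eqxx.
by rewrite !(box_ker_cov _ c) k0 /qcont2 mulr1.
Qed.

(* Its vanishing says that the sum over the eta of size m of S(eta, nu) W(eta, al)
   is a multiple of W(nu, al); summed against S(be^t, nu), this is [vertex_sum]. *)
Definition defect m n b := (Sm m n)^T *m Wm m b - Wm n b *m Z m n b.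

Lemma defect_small m n b : (m < n)%N -> defect m n b = 0.
Proof.
move=> lt; rewrite /defect Sm_small // trmx0 mul0mx sub0r.
rewrite (_ : Z m n b = 0) ?mulmx0 ?oppr0 //.
by apply/matrixP => i j; rewrite !mxE /zetas leqNgt lt mul0rn.
Qed.

(** The transpose of [Sm_pval] exchanges P with S^T, [pval_W0] resolves P W, and the transpose of
    [Sm_box_pval] moves the resulting U to the left of S^T. *)
Lemma Sm_tr_W0 m n : P n *m ((Sm m.+1 n)^T *m Wm m.+1 0) =
  K^-1 *: ((Sm m.+1 n)^T *m Wm m.+1 0) + Ud n *m ((Sm m n.-1)^T *m Wm m 0) +
  P n *m ((Sm m n)^T *m Wm m 0) - (U n)^T *m ((Sm m.+1 n.+1)^T *m Wm m.+1 0).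
Proof.
have := congr1 (fun M => M^T *m Wm m.+1 0) (Sm_pval m.+1 n).
rewrite linearB /= !trmx_mul !dmx_tr mulmxBl -!mulmxA pval_W0 => <-.
rewrite opprB addrCA; apply/esym/eqP; rewrite -subr_eq0 addrAC subrr add0r subr_eq0; apply/eqP/esym.
rewrite mulmxDr -scalemxAr -addrA; congr (_ + _).
have := congr1 (fun M => M^T *m Wm m 0) (Sm_box_pval m n).
rewrite linearD /= !trmx_mul !dmx_tr !trmxK mulmxDl -!mulmxA => ->.
by [].
Qed.

Lemma defect_rec m n : P n *m defect m.+1 n 0 - K^-1 *: defect m.+1 n 0 =
  Ud n *m defect m n.-1 0 + P n *m defect m n 0 - (U n)^T *m defect m.+1 n.+1 0.
Proof.
rewrite /defect !mulmxBr Sm_tr_W0.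
have E : P n *m (Wm n 0 *m Z m.+1 n 0) - K^-1 *: (Wm n 0 *m Z m.+1 n 0) =
    Ud n *m (Wm n.-1 0 *m Z m n.-1 0) + P n *m (Wm n 0 *m Z m n 0) -
    (U n)^T *m (Wm n.+1 0 *m Z m.+1 n.+1 0).
  rewrite !dmx_part0 !mul_mx_scalar -!scalemxAr boxU_W0 !zeta_part0.
  rewrite addrK; case: n => [|n].
    by rewrite Bmx00 mul0mx scaler0 /Wm mulmxA dmx_part0 pval0 mul_scalar_mx
      -!scalemxAl scalerA mulrC -scalerA subrr.
  by rewrite pval_W0 scalerDr !scalerA [_ * K^-1]mulrC addrC addKr ?ltnS ?subSS.
rewrite scalerBr.
set A := K^-1 *: (_ *m _); set B := P n *m (Wm n 0 *m _) in E *.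
move: E; set B' := K^-1 *: _; set C := _ *m _; set D := _ *m _; set G := _ *m _ => E.
set A1 := Ud n *m _; set A2 := P n *m _; set A3 := (U n)^T *m _.
have -> : B = B' + (C + D - G) by rewrite -E addrC subrK.
by apply/matrixP => i j; rewrite !mxE; ring.
Qed.

(* [pval] takes the value K^-1 only at the empty partition, so [defect_rec]
   determines the other rows. *)
Lemma defect0 m n : defect m n 0 = 0.
Proof.
(* The induction is on the bound for m - n and then on n. In [defect_rec] the other terms have a
   smaller difference m - n, or the same difference and a smaller n. *)
suff H j : forall m n, (m < n + j)%N -> defect m n 0 = 0.
  by apply: (H m.+1); rewrite addnS ltnS leq_addl.
elim: j {m n} => [|j IH] m n; first by rewrite addn0; exact: defect_small.
rewrite addnS ltnS leq_eqVlt => /orP[/eqP|]; last exact: IH.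
elim: n m => [|n IHn] m mE.
  (* For n = 0 the factor P - K^-1 of [defect_rec] vanishes, and the claim is the definition of
     [zeta0]. *)
  rewrite /defect dmx_part0 zeta_part0 leq0n subn0 mul_mx_scalar; apply/matrixP => i k.
  rewrite /Wm !Hm0 !dmx_kmx kmx_tr kmxM !mxE.
  rewrite (psize_eq0 (psize_pidx i)) (psize_eq0 (psize_pidx k)).
  by rewrite [X in kapd _ * X]S_diag // /kapd /kappa big_ord0 !mulr1 subrr.
rewrite mE; have := defect_rec (n + j) n.+1.
rewrite IHn // (IH (n + j)%N) ?addSn // (IH (n + j).+1 n.+2) ?addSn // !mulmx0 addr0 subr0.
move=> /matrixP E; apply/matrixP => i k; have := E i k.
rewrite mxE dmxE !mxE -[X in _ + X]mulNr -mulrDl => /eqP.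
rewrite mulf_eq0 => /orP[|/eqP->//]; rewrite subr_eq0 (negPf (pval_neq _)) //.
by apply/eqP => e; have := psize_pidx i; rewrite e.
Qed.

(** On W the factor U becomes P on the left. The transpose of [Sm_pval] splits S^T P into P S^T and
    U^T S^T, and these match the two summands of [zeta_box]. *)
Lemma defect_box m n b :
  defect m n b.+1 *m U b = P n *m defect m n b + (U n)^T *m defect m n.+1 b.
Proof.
rewrite /defect; move: (Wm_box m b) (Wm_box n b) (boxU_Wm n b).
move: (Wm m b.+1) (Wm n b.+1) (Wm m b) (Wm n b) (Wm n.+1 b) => w1 w2 w3 w4 w5 E1 E2 E3.
have := congr1 trmx (Sm_pval m n); rewrite linearB /= !trmx_mul !dmx_tr => /eqP.
rewrite subr_eq addrC => /eqP ES.
rewrite mulmxBl !mulmxBr -(mulmxA _ w1) E1 -(mulmxA w2) zeta_box mulmxDr (mulmxA w2) E2.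
rewrite (mulmxA w2) -E3 (mulmxA _ (P m)) ES mulmxDl !mulmxA.
by rewrite opprD addrACA.
Qed.

Lemma defect_boxV m n b : (V n)^T *m defect m.+1 n.+1 b = defect m n b *m P b.
Proof.
rewrite /defect; move: (boxV_Wm m b) (boxV_Wm n b).
move: (Wm m b) (Wm n b) (Wm m.+1 b) (Wm n.+1 b) => w1 w2 w3 w4 E1 E2.
have := congr1 trmx (Sm_box m n); rewrite !trmx_mul => E.
rewrite mulmxBl !mulmxBr (mulmxA (V n)^T) -E -mulmxA E1 -(mulmxA w2).
by rewrite (_ : Z m.+1 n.+1 b = Z m n b) // [Z m n b *m _]dmxC (mulmxA w2) -E2 !mulmxA.
Qed.

Lemma qcont_inj c d : qcont z c = qcont z d -> c = d.
Proof.
wlog le : c d / (c <= d)%R.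
  by move=> H; case/orP: (le_total c d) => h E; [exact: H | exact/esym/H].
move=> E; apply/eqP; apply: contraT => ne.
have lt : c < d by rewrite lt_neqAle ne.
have : z ^+ absz (2 * (d - c)) = 1.
  rewrite -[LHS]/(z ^ (absz (2 * (d - c)) : int)).
  have -> : (absz (2 * (d - c)) : int) = - (2 * c) + 2 * d by lia.
  by rewrite expfzDr // -/(qcont z c) E /qcont -expfzDr // addNr expr0z.
by move/eqP; rewrite (negPf (zX _)) //; lia.
Qed.

(** Boxes that can be added to the same partition in different rows have different contents, and
    [qcont] is injective since z is not a root of unity. *)
Lemma pval_cov_inj la la' mu i i' : covers la mu i -> covers la' mu i' ->
  pval z la = pval z la' -> la = la'.
Proof.
move=> c c'; rewrite (pval_cov zn0 z2 c) (pval_cov zn0 z2 c') => /addrI/(mulfI (K_neq0 zn0 z2))/qcont_inj E.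
have ii : i = i'.
  case: (ltngtP i i') E => // lt; first by have := nth_part_le mu (ltnW lt); lia.
  by have := nth_part_le mu (ltnW lt); lia.
by apply: part_ext => j; rewrite c c' ii.
Qed.

(* By [defect_box] and [defect_boxV], U annihilates [defect m n b.+1] even after
   multiplication by a polynomial in the diagonal matrix of the [pval la], and
   [pval] separates the partitions covering a given one. *)
Lemma defect_eq0 b m n : defect m n b = 0.
Proof.
elim: b m n => [|b IH] m n; first exact: defect0.
have DU k m' n' : defect m' n' b.+1 *m dmx (fun la => pval z la ^+ k) b.+1 *m U b = 0.
  elim: k m' n' => [|k IHk] m' n'.
    rewrite (_ : dmx _ _ = 1%:M) ?mulmx1; last first.
      by apply/matrixP => i j; rewrite !mxE expr0.
    by rewrite defect_box !IH !mulmx0 addr0.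
  rewrite (_ : dmx _ _ = P b.+1 *m dmx (fun la => pval z la ^+ k) b.+1); last first.
    by apply/matrixP => i j; rewrite dmxE !mxE exprS mulrnAr.
  by rewrite mulmxA -defect_boxV -!mulmxA [X in _ *m X]mulmxA IHk mulmx0.
have Dp (p : {poly F}) : defect m n b.+1 *m dmx (fun la => p.[pval z la]) b.+1 *m U b = 0.
  rewrite (_ : dmx _ _ = \sum_(k < size p) p`_k *: dmx (fun la => pval z la ^+ k) b.+1); last first.
    apply/matrixP => i j; rewrite !mxE summxE horner_coef.
    by rewrite -sumrMnl; apply: eq_bigr => k _; rewrite !mxE mulrnAr.
  rewrite mulmx_sumr mulmx_suml big1 // => k _.
  by rewrite -scalemxAr -scalemxAl DU scaler0.
apply/matrixP => i l; rewrite [RHS]mxE.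
have [mu [k c]] : exists mu k, covers (pidx l) mu k.
  have : psize (pidx l) != 0%N by rewrite psize_pidx.
  by elim/part_box_ind: (pidx l) => [//|la mu k c _ _]; exists mu, k.
have [j jE] : exists j : 'I_(size (partsn b)), pidx j = mu.
  by apply: (@pidxP _ b); have := covers_size c; rewrite psize_pidx => -[].
pose p : {poly F} :=
  \prod_(la <- partsn b.+1 | `[< exists k, covers la mu k >] && (la != pidx l)) ('X - (pval z la)%:P).
have := congr1 (fun M : 'M__ => M i j) (Dp p); rewrite mxE [RHS]mxE (bigD1 l) //= big1 ?addr0.
  rewrite mx_dmxE [Bmx _ _ _ _ _]mxE jE (box_ker_cov _ c) => /eqP; rewrite !mulf_eq0.
  rewrite (negPf (qcont_neq0 zn0 _)) orbF => /orP[/eqP//|].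
  rewrite /p horner_prod prodf_seq_eq0 => /hasP[la _ /andP[/andP[/asboolP[k' c'] ne]]].
  rewrite hornerXsubC subr_eq0 => /eqP /(pval_cov_inj c c') E.
  by rewrite E eqxx in ne.
move=> l' ne; rewrite mx_dmxE [Bmx _ _ _ _ _]mxE jE.
case: (pselect (exists k, covers (pidx l') mu k)) => [[k' c']|nc]; last first.
  by rewrite box_ker_nocov ?mulr0 // => k' c'; apply: nc; exists k'.
rewrite (_ : p.[_] = 0) ?mulr0 ?mul0r //; rewrite /p.
rewrite horner_prod; apply/eqP; rewrite prodf_seq_eq0; apply/hasP; exists (pidx l').
  by rewrite mem_partsn psize_pidx.
rewrite hornerXsubC subrr eqxx andbT; apply/andP; split; first by apply/asboolP; exists k'.
by apply: contra ne => /eqP/pidx_inj->.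
Qed.

(** * Summation over the label of the exceptional curve *)

Definition hopf (la mu : part) : F :=
  \sum_(n < (psize la).+1) \sum_(nu <- partsn n) S la nu * S mu nu.

Lemma Hm_kmx a b : Hm a b = kmx hopf a b.
Proof.
apply/matrixP => i j; rewrite summxE mxE /hopf psize_pidx; apply: eq_bigr => n _.
by rewrite kmx_tr kmxM mxE.
Qed.

Lemma hopfC la mu : hopf la mu = hopf mu la.
Proof.
have := Hm_tr (psize la) (psize mu); rewrite !Hm_kmx kmx_tr => /kmx_inj E.
by rewrite E.
Qed.

(** This is C(al, 0, be) when S consists of the s_(la/mu)(q^rho); see [vertexC_mid0]. *)
Definition vertex2 (al be : part) : F := z ^ kappa be * hopf al (conj_part be).

Definition vertex_coef al be n : F :=
  z ^ kappa be * \sum_(nu <- partsn n) kapd nu * hopf nu al * S (conj_part be) nu.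

(** The polynomial P_(al,be) of the overview. The first factor comes from [defect_eq0]; the second
    collects the products W(nu, al) S(be^t, nu) by the size of nu. *)
Definition vertex_poly al be : {poly F} :=
  cpoly al * \poly_(n < (psize be).+1) vertex_coef al be n.

Lemma zetasE la m n :
  zetas m n la = \sum_(i < m.+1) (cpoly la * 'X^n)`_i * zeta0 (m - i).
Proof.
under eq_bigr do rewrite coefMXn.
rewrite /zetas; case: (leqP n m) => le; last first.
  by rewrite big1 // => i _; rewrite (leq_ltn_trans (leq_ord i) le) mul0r.
rewrite /zeta -(big_mkord xpredT (fun i => (if (i < n)%N then 0 else (cpoly la)`_(i - n)) * zeta0 (m - i))).
rewrite (@big_cat_nat _ _ _ n) //=; last exact: leqW.
rewrite [X in _ = X + _]big_nat [X in _ = X + _]big1 ?add0r => [|i /andP[_ ->]]; last by rewrite mul0r.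
rewrite -[in X in _ = \big[_/_]_(X <= _ < _) _](add0n n) big_addn subSn // big_mkord; apply: eq_bigr => i _.
by rewrite ltnNge leq_addl /= addnK subnDA subnAC.
Qed.

(** C(al, 0, eta^t) is W(eta, al), and C(eta, 0, be) expands into the S(eta, nu) S(be^t, nu). For
    fixed nu the sum over eta is then evaluated by [defect_eq0]. *)
Lemma vertex_sum al be m :
  \sum_(eta <- partsn m) vertex2 al (conj_part eta) * vertex2 eta be =
  \sum_(i < m.+1) (vertex_poly al be)`_i * zeta0 (m - i).
Proof.
set a := psize al; set b := psize be.
have wE n : (Wm n a)^T = kmx (fun la nu => kapd nu * hopf nu la) a n.
  by rewrite /Wm Hm_kmx dmx_kmx kmx_tr.
transitivity (z ^ kappa be *
  \sum_(n < b.+1) zetas m n al * \sum_(nu <- partsn n) kapd nu * hopf nu al * S (conj_part be) nu).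
  transitivity (z ^ kappa be * \sum_(eta <- partsn m) kapd eta * hopf eta al * hopf eta (conj_part be)).
    rewrite mulr_sumr; apply: eq_bigr => eta _.
    rewrite /vertex2 conj_partK kappa_conj (hopfC al) /kapd; ring.
  congr (_ * _).
  have : (Wm m a)^T *m Hm m b = kmx (fun la mu =>
      \sum_(n < b.+1) zetas m n la * \sum_(nu <- partsn n) kapd nu * hopf nu la * S mu nu) a b.
    rewrite -Hm_tr /Hm linear_sum /= mulmx_sumr; apply/matrixP => i j; rewrite summxE mxE.
    apply: eq_bigr => n _; rewrite (trmx_mul (Sm b n)) trmxK mulmxA -[Sm m n]trmxK -trmx_mul.
    have /eqP := defect_eq0 a m n; rewrite subr_eq0 => /eqP ->.
    by rewrite (trmx_mul (Wm n a)) dmx_tr -mulmxA dmxE wE kmx_tr kmxM mxE.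
  rewrite wE Hm_kmx kmxM => /kmx_inj; apply=> //; exact: psize_conj.
rewrite mulr_sumr; under [RHS]eq_bigr => i _.
  rewrite /vertex_poly poly_def [cpoly al * _]mulr_sumr coef_sum mulr_suml.
  over.
rewrite exchange_big /=; apply: eq_bigr => n _.
rewrite zetasE mulrCA -/(vertex_coef al be n) mulr_suml; apply: eq_bigr => i _.
by rewrite -scalerAr coefZ; ring.
Qed.

Lemma size_vertex_poly al be i : (psize al + psize be < i)%N -> (vertex_poly al be)`_i = 0.
Proof.
move=> lt; rewrite nth_default //; apply: leq_trans (size_polyMleq _ _) _.
have := size_cpoly al; have := size_poly (psize be).+1 (vertex_coef al be).
by rewrite -/(\poly_(n < _) _); lia.
Qed.

(** In top degree only nu = be^t survives, and [cpoly al] contributes its leading coefficient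
    q^(-kappa(al)/2). *)
Lemma lead_vertex_poly al be :
  (vertex_poly al be)`_(psize al + psize be) = z ^ (kappa be - kappa al) * vertex2 al be.
Proof.
rewrite coefM.
have lt : (psize al < (psize al + psize be).+1)%N by rewrite ltnS leq_addr.
rewrite (bigD1 (Ordinal lt)) //= big1 ?addr0 => [|j ne]; last first.
  case: (ltngtP j (psize al)) => [lt'|gt|jE].
  - by rewrite [X in _ * X]nth_default ?mulr0 //; apply: leq_trans (size_poly _ _) _; lia.
  - by rewrite nth_default ?mul0r // (leq_trans (size_cpoly _)).
  - by move: ne; rewrite -val_eqE /= jE eqxx.
rewrite lead_cpoly addKn coef_poly ltnSn /vertex_coef (bigD1_seq (conj_part be)) ?partsn_uniq //=; last first.
  by rewrite mem_partsn psize_conj.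
rewrite big_seq_cond big1 ?addr0 => [|nu /andP[]]; last first.
  rewrite mem_partsn => /eqP nuE ne; rewrite S_diag ?psize_conj ?nuE //.
  by rewrite eq_sym (negPf ne) mulr0.
rewrite S_diag // eqxx mulr1 /vertex2 hopfC /kapd kappa_conj opprK expfzDr //; ring.
Qed.

Lemma vertex_poly0 : vertex_poly part0 part0 = 1.
Proof.
rewrite /vertex_poly cpoly0 mul1r; apply/polyP => i; rewrite coef_poly coef1.
case: i => [|i] //=; rewrite /vertex_coef partsn0 big_seq1 conj_part0 /hopf big_ord_recl big_ord0.
by rewrite partsn0 big_seq1 S_diag // eqxx /kapd /kappa big_ord0 /= !addr0 psize0 oppr0 !expr0z !mul1r.
Qed.

Lemma zeta0_E m : zeta0 m =
  \sum_(eta <- partsn m) vertex2 part0 (conj_part eta) * vertex2 eta part0.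
Proof.
rewrite vertex_sum vertex_poly0 big_ord_recl coef1 mul1r subn0 big1 ?addr0 // => i _.
by rewrite coef1 mul0r.
Qed.

Lemma vertex2_0 : vertex2 part0 part0 = 1.
Proof.
rewrite /vertex2 conj_part0 /hopf big_ord_recl big_ord0 partsn0 big_seq1 S_diag // eqxx.
by rewrite /kappa big_ord0 /= !addr0 psize0 expr0z !mul1r.
Qed.

End PrincipalSpecialization.

(** * Limits and rational functions *)
Section ComplexLimits.

Definition conv (u : nat -> CC) (l : CC) := forall eps : CC, 0 < eps ->
  exists N0, forall N, (N0 <= N)%N -> `|u N - l| < eps.

Lemma CC_archi (x : CC) : 0 <= x -> exists n, x < n%:R.
Proof.
move=> x0; have /complex_realP[r xr] := ger0_real x0.
have r0 : 0 <= r by rewrite -ler0c -xr.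
exists (Num.bound r); rewrite xr -(rmorph_nat (real_complex _)) ltcR.
exact: archi_boundP.
Qed.

Lemma geometric_small (r M eps : CC) : 0 <= r -> r < 1 -> 0 <= M -> 0 < eps ->
  exists k, r ^+ k * M < eps.
Proof.
move=> r0 r1 M0 eps0; case: (eqVneq r 0) => [->|rn0].
  by exists 1%N; rewrite expr1 mul0r.
have rp : 0 < r by rewrite lt_def rn0.
have h0 : 0 < r^-1 - 1 by rewrite subr_gt0 invf_gt1.
have [k kM] : exists k, M / (eps * (r^-1 - 1)) < k%:R.
  by apply: CC_archi; rewrite divr_ge0 // mulr_ge0 ?ltW.
(* Bernoulli's inequality for 1/r. *)
have bern : k%:R * (r^-1 - 1) <= r^-1 ^+ k.
  elim: (k) => [|j IH]; first by rewrite mul0r expr0 ler01.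
  rewrite exprS -[j.+1]addn1 natrD mulrDl mul1r.
  have r1' : 1 <= r^-1 by rewrite ltW // invf_gt1.
  have -> : r^-1 * r^-1 ^+ j = r^-1 ^+ j + (r^-1 - 1) * r^-1 ^+ j by ring.
  apply: lerD => //; rewrite -{1}[_ - 1]mulr1; apply: ler_pM; rewrite ?ler01 //.
    exact: ltW.
  exact: exprn_ege1.
exists k; rewrite mulrC -ltr_pdivlMr ?exprn_gt0 // -exprVn.
move: kM; rewrite ltr_pdivrMr; last by rewrite mulr_gt0.
move=> /lt_le_trans; apply; rewrite mulrCA.
by apply: ler_wpM2l => //; exact: ltW.
Qed.

Lemma conv_cst l : conv (fun=> l) l.
Proof. by move=> eps e0; exists 0%N => N _; rewrite subrr normr0. Qed.

Lemma conv_ext u v l : u =1 v -> conv u l -> conv v l.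
Proof.
move=> uv cu eps /cu[N0 H]; exists N0 => N /H; by rewrite uv.
Qed.

Lemma conv_add u v l m : conv u l -> conv v m -> conv (fun N => u N + v N) (l + m).
Proof.
move=> cu cv eps e0; have e2 : 0 < eps / 2%:R by rewrite divr_gt0 ?ltr0n.
have [N1 H1] := cu _ e2; have [N2 H2] := cv _ e2.
exists (maxn N1 N2) => N; rewrite geq_max => /andP[/H1 h1 /H2 h2].
rewrite opprD addrACA; apply: le_lt_trans (ler_normD _ _) _.
by rewrite [X in _ < X]splitr; exact: ltrD.
Qed.

Lemma conv_mull c u l : conv u l -> conv (fun N => c * u N) (c * l).
Proof.
move=> cu eps e0; have c0 : 0 < `|c| + 1 by rewrite ltr_wpDl ?normr_ge0 ?ltr01.
have [N0 H] := cu _ (divr_gt0 e0 c0); exists N0 => N /H.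
rewrite -mulrBr normrM ltr_pdivlMr // mulrC => h; apply: le_lt_trans h.
by apply: ler_wpM2r => //; rewrite lerDl ler01.
Qed.

Lemma conv_sum (I : Type) (r : seq I) (u : I -> nat -> CC) (l : I -> CC) :
  (forall i, conv (u i) (l i)) ->
  conv (fun N => \sum_(i <- r) u i N) (\sum_(i <- r) l i).
Proof.
move=> H; elim: r => [|i r IH].
  by rewrite big_nil; apply: conv_ext (conv_cst 0) => N; rewrite big_nil.
rewrite big_cons; apply: conv_ext (conv_add (H i) IH) => N.
by rewrite big_cons.
Qed.

Lemma conv_unique u l m : conv u l -> conv u m -> l = m.
Proof.
move=> cl cm; apply/eqP; rewrite -subr_eq0 -normr_eq0; apply: contraT => ne.
have d0 : 0 < `|l - m| by rewrite lt_def ne normr_ge0.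
have e2 : 0 < `|l - m| / 2%:R by rewrite divr_gt0 ?ltr0n.
have [N1 H1] := cl _ e2; have [N2 H2] := cm _ e2.
have := ltrD (H1 _ (leq_maxl N1 N2)) (H2 _ (leq_maxr N1 N2)).
rewrite -splitr => lt.
have := le_lt_trans (ler_distD (u (maxn N1 N2)) l m) (le_lt_trans _ lt).
by rewrite ltxx; apply; rewrite distrC.
Qed.

(** The limit is the fixed point of x -> rho x + l, and the distance to it contracts by |rho| up to
    the error of v. *)
Lemma conv_contract (rho : CC) u v l : `|rho| < 1 ->
  (forall N, u N.+1 = rho * u N + v N) -> conv v l -> conv u (l / (1 - rho)).
Proof.
move=> r1 uE cv eps e0; set L := l / _.
have rho1 : 1 - rho != 0.
  by rewrite subr_eq0 eq_sym; apply: contraTneq r1 => ->; rewrite normr1 ltxx.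
have LE : L = rho * L + l by rewrite /L; field.
have e2 : 0 < eps / 2%:R by rewrite divr_gt0 ?ltr0n.
(* With this bound on the errors of v, the error eps/2 is reproduced at each step: |rho| eps/2 + (1
   - |rho|) eps/2 = eps/2. *)
have d0 : 0 < eps / 2%:R * (1 - `|rho|) by rewrite mulr_gt0 ?subr_gt0.
have [N0 HN0] := cv _ d0.
have bnd k : `|u (N0 + k)%N - L| <= `|rho| ^+ k * `|u N0 - L| + eps / 2%:R.
  elim: k => [|k IH]; first by rewrite addn0 expr0 mul1r lerDl ltW.
  rewrite addnS uE [in X in _ - X]LE opprD addrACA -mulrBr.
  apply: le_trans (ler_normD _ _) _; rewrite normrM exprS.
  apply: le_trans (lerD (ler_wpM2l (normr_ge0 rho) IH) (ltW (HN0 (N0 + k)%N (leq_addr _ _)))) _.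
  by rewrite [X in X <= _](_ : _ = `|rho| * `|rho| ^+ k * `|u N0 - L| + eps / 2%:R) //; ring.
have [k0 Hk0] := geometric_small (normr_ge0 rho) r1 (normr_ge0 (u N0 - L)) e2.
exists (N0 + k0)%N => N le.
have -> : N = (N0 + (N - N0))%N by lia.
apply: le_lt_trans (bnd _) _.
rewrite [X in _ < X]splitr ltrD2r; apply: le_lt_trans Hk0; apply: ler_wpM2r => //.
have -> : (N - N0 = (N - N0 - k0) + k0)%N by lia.
rewrite exprD ler_piMl ?exprn_ge0 //; apply: exprn_ile1 => //; exact: ltW.
Qed.

End ComplexLimits.

(** * Rational functions without poles outside the closed unit disc *)

Section RegularFunctions.

(* The field of fractions and its embedding are kept abstract: unification in
   [{fraction {poly rat}}] is prohibitively slow. *)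
Variables (F : fieldType) (phi : {rmorphism {poly rat} -> F}).
Hypothesis phi_eq0 : forall p, (phi p == 0) = (p == 0).
Let qh : F := phi 'X.

Definition regular (r : F) (f : CC -> CC) :=
  exists a b : {poly rat}, r = phi a / phi b /\
    forall z : CC, 1 < `|z| -> poly_at b z != 0 /\ f z = poly_at a z / poly_at b z.

Lemma poly_atD a b z : poly_at (a + b) z = poly_at a z + poly_at b z.
Proof. by rewrite /poly_at rmorphD hornerD. Qed.
Lemma poly_atB a b z : poly_at (a - b) z = poly_at a z - poly_at b z.
Proof. by rewrite /poly_at rmorphB hornerD hornerN. Qed.
Lemma poly_atM a b z : poly_at (a * b) z = poly_at a z * poly_at b z.
Proof. by rewrite /poly_at rmorphM hornerM. Qed.
Lemma poly_at1 z : poly_at 1 z = 1.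
Proof. by rewrite /poly_at rmorph1 hornerC. Qed.
Lemma poly_at0 z : poly_at 0 z = 0.
Proof. by rewrite /poly_at rmorph0 hornerC. Qed.
Lemma poly_atXn n z : poly_at 'X^n z = z ^+ n.
Proof. by rewrite /poly_at map_polyXn hornerXn. Qed.

Lemma gt1_norm2 : 1 < `|2%:R : CC|.
Proof. by rewrite ger0_norm ?ler0n // ltr1n. Qed.

Lemma poly_at_neq0 b z : poly_at b z != 0 -> b != 0.
Proof. by apply: contra => /eqP->; rewrite poly_at0. Qed.

(** The integers from 2 on already provide more roots than a nonzero polynomial can have. *)
Lemma poly_at_eq0 (p : {poly rat}) : (forall z : CC, 1 < `|z| -> poly_at p z = 0) -> p = 0.
Proof.
move=> H; apply/eqP; apply: contraT => p0.
have := @max_poly_roots _ p (mkseq (fun i => (i + 2)%:R) (size p)) p0.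
rewrite size_mkseq ltnn; apply.
  apply/allP => _ /mapP[i _ ->]; rewrite rootE -(fmorph_eq0 (ratr : rat -> CC)).
  rewrite -horner_map /= rmorph_nat; apply/eqP; apply: H.
  by rewrite ger0_norm ?ler0n // ltr1n addn2.
rewrite map_inj_uniq ?iota_uniq // => i j /eqP; rewrite eqr_nat; lia.
Qed.

Lemma regular_inj r s f g : regular r f -> regular s g ->
  (forall z, 1 < `|z| -> f z = g z) -> r = s.
Proof.
move=> [a [b [-> H]]] [c [d [-> H']]] fg.
have b0 : phi b != 0.
  by rewrite phi_eq0; apply: (@poly_at_neq0 _ 2%:R); case: (H _ gt1_norm2).
have d0 : phi d != 0.
  by rewrite phi_eq0; apply: (@poly_at_neq0 _ 2%:R); case: (H' _ gt1_norm2).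
apply/eqP; rewrite eqr_div // -!rmorphM -subr_eq0 -rmorphB phi_eq0; apply/eqP.
apply: poly_at_eq0 => z z1; have [bz E] := H z z1; have [dz E'] := H' z z1.
rewrite poly_atB !poly_atM; apply/eqP; rewrite subr_eq0 -eqr_div //.
by rewrite -E -E' fg.
Qed.

Lemma regular_cst (b : bool) : regular b%:R (fun=> b%:R).
Proof.
exists (b%:R), 1; split; first by rewrite rmorph1 divr1 rmorph_nat.
move=> z _; rewrite poly_at1 oner_eq0 divr1; split => //.
by case: b; rewrite ?poly_at1 ?poly_at0.
Qed.

Lemma regularD r s f g : regular r f -> regular s g -> regular (r + s) (fun z => f z + g z).
Proof.
move=> [a [b [-> H]]] [c [d [-> H']]]; exists (a * d + c * b), (b * d); split.
  have b0 : phi b != 0.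
    by rewrite phi_eq0; apply: (@poly_at_neq0 _ 2%:R); case: (H _ gt1_norm2).
  have d0 : phi d != 0.
    by rewrite phi_eq0; apply: (@poly_at_neq0 _ 2%:R); case: (H' _ gt1_norm2).
  by rewrite rmorphD !rmorphM addf_div.
move=> z z1; have [bz E] := H z z1; have [dz E'] := H' z z1.
by rewrite poly_atD !poly_atM mulf_neq0 // E E' addf_div.
Qed.

Lemma regularM r s f g : regular r f -> regular s g -> regular (r * s) (fun z => f z * g z).
Proof.
move=> [a [b [-> H]]] [c [d [-> H']]]; exists (a * c), (b * d); split.
  by rewrite !rmorphM mulf_div.
move=> z z1; have [bz E] := H z z1; have [dz E'] := H' z z1.
by rewrite !poly_atM mulf_neq0 // E E' mulf_div.
Qed.

Lemma norm_gt1_neq0 (z : CC) : 1 < `|z| -> z != 0.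
Proof. by apply: contraTneq => ->; rewrite normr0 ltr10. Qed.

Lemma regular_Vexp n : regular (qh ^- n) (fun z => z ^- n).
Proof.
exists 1, 'X^n; split; first by rewrite rmorph1 div1r rmorphXn.
move=> z z1; rewrite poly_at1 poly_atXn div1r expf_neq0 //; exact: norm_gt1_neq0.
Qed.

Lemma regular_Vsub n : (0 < n)%N ->
  regular ((1 - qh ^- n)^-1) (fun z => (1 - z ^- n)^-1).
Proof.
move=> n0; exists 'X^n, ('X^n - 1); split.
  have q0 : qh ^+ n != 0 by rewrite expf_neq0 // phi_eq0 polyX_eq0.
  by rewrite rmorphB rmorphXn rmorph1 -/qh -[1 - _](mulKf q0) mulrBr mulr1 divff // invfM invrK.
move=> z z1; have z0 := norm_gt1_neq0 z1.
have zn0 : z ^+ n != 0 by rewrite expf_neq0.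
have zn1 : z ^+ n != 1.
  have h : 1 < `|z| ^+ n by rewrite exprn_egt1 // -lt0n.
  by apply: contraTneq h => E; rewrite -normrX E normr1 ltxx.
rewrite poly_atB poly_atXn poly_at1 subr_eq0 zn1; split => //.
by rewrite -[1 - _](mulKf zn0) mulrBr mulr1 divff // invfM invrK.
Qed.

Lemma regular_sum (I : eqType) (s : seq I) (r : I -> F) (f : I -> CC -> CC) :
  (forall i, i \in s -> regular (r i) (f i)) ->
  regular (\sum_(i <- s) r i) (fun z => \sum_(i <- s) f i z).
Proof.
elim: s => [|i s IH] H.
  rewrite big_nil; have := regular_cst false.
  by congr regular; apply/funext => z; rewrite big_nil.
rewrite big_cons.
have := regularD (H i (mem_head _ _)) (IH (fun j js => H j (mem_behead (s := i :: s) js))).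
by congr regular; apply/funext => z; rewrite big_cons.
Qed.

End RegularFunctions.

(** * Existence of the specialized skew Schur functions *)
Local Open Scope classical_set_scope.

Lemma fsum_seq (T : choiceType) (V : nmodType) (A : set T) (r : seq T) (f : T -> V) :
    uniq r -> (forall i, A i -> i \notin r -> f i = 0) ->
  \sum_(i \in A) f i = \sum_(i <- r | `[< A i >]) f i.
Proof.
move=> ur Af; rewrite fsbig_mkcond (@fsbigE _ _ _ _ _ r) //; last first.
  move=> i _ ir; rewrite /patch; case: ifPn => //.
  by rewrite inE => /Af; apply.
rewrite [RHS]big_mkcond /=; apply: eq_big => i; first by rewrite in_setT.
by rewrite /patch.
Qed.

Definition partslt n : seq part := flatten [seq partsn j | j <- iota 0 n].

Lemma mem_partslt n mu : (mu \in partslt n) = (psize mu < n)%N.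
Proof.
apply/flattenP/idP => [[_ /mapP[j jn ->]]|lt].
  by rewrite mem_partsn mem_iota in jn * => /eqP->.
exists (partsn (psize mu)); last by rewrite mem_partsn.
by apply: map_f; rewrite mem_iota.
Qed.

Lemma partslt_uniq n : uniq (partslt n).
Proof.
rewrite /partslt; elim: n => // n IH.
rewrite -addn1 iotaD map_cat flatten_cat /= cats0 cat_uniq IH partsn_uniq andbT /=.
apply/hasPn => mu; rewrite add0n mem_partsn => /eqP E.
by rewrite [_ \in _]mem_partslt E ltnn.
Qed.

Lemma big_partslt (V : nmodType) n (f : part -> V) :
  \sum_(mu <- partslt n) f mu = \sum_(j < n) \sum_(mu <- partsn j) f mu.
Proof.
by rewrite /partslt big_flatten big_map
  -(big_mkord xpredT (fun j => \sum_(mu <- partsn j) f mu)) /index_iota subn0.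
Qed.

Lemma hstrip_psize la mu : hstrip la mu -> (psize mu <= psize la)%N.
Proof.
move=> h; pose N := maxn (size la) (size mu).
rewrite (@psizeE la N) ?leq_maxl // (@psizeE mu N) ?leq_maxr //.
by apply: leq_sum => i _; have := h i; lia.
Qed.

Lemma hstrip_refl mu : hstrip mu mu.
Proof. by move=> k; rewrite leqnn andbT nth_part_le. Qed.

Lemma hstrip_eq la mu : hstrip la mu -> psize la = psize mu -> la = mu.
Proof.
move=> h E; have [i iE] := pidxP E; have [j jE] := pidxP (erefl (psize mu)).
have /matrixP/(_ i j) := @Emx_diag rat (psize mu); rewrite !mxE iE jE asboolT //.
by case: eqVneq => [e|_ /eqP]; [rewrite -iE e jE | rewrite oner_eq0].
Qed.

Section SkewSchur.
Variable F : fieldType.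
Implicit Types (x : seq F) (la mu nu : part).

Lemma skew_schur_small x la mu : (psize la < psize mu)%N -> skew_schur x la mu = 0.
Proof.
elim: x mu => [|y x IH] mu lt /=; first by case: eqVneq lt => // ->; rewrite ltnn.
apply: fsbig1 => nu /= /hstrip_psize le; rewrite IH ?mulr0 //.
exact: leq_trans lt le.
Qed.

Lemma skew_schur_cons y x la mu : skew_schur (y :: x) la mu =
  \sum_(j < (psize la).+1) \sum_(nu <- partsn j)
     ind (hstrip nu mu) * (y ^+ (j - psize mu) * skew_schur x la nu).
Proof.
rewrite /= (fsum_seq (partslt_uniq (psize la).+1)); last first.
  move=> nu _; rewrite mem_partslt ltnS -ltnNge => lt.
  by rewrite skew_schur_small ?mulr0.
rewrite big_mkcond big_partslt; apply: eq_bigr => j _; apply: eq_big_seq => nu.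
rewrite mem_partsn => /eqP ->; rewrite -/(hstrip nu mu).
by case: ifP => _; rewrite ?mul1r ?mul0r.
Qed.

Lemma skew_schur_scale c x la mu :
  skew_schur (map (fun y => c * y) x) la mu = c ^+ (psize la - psize mu) * skew_schur x la mu.
Proof.
elim: x mu => [|y x IH] mu /=.
  by case: eqVneq => [->|_]; rewrite ?mulr0 // subnn expr0 mul1r.
rewrite -/(skew_schur (c * y :: map (fun y => c * y) x) la mu) -/(skew_schur (y :: x) la mu).
rewrite !skew_schur_cons mulr_sumr; apply: eq_bigr => j _.
rewrite mulr_sumr; apply: eq_big_seq => nu; rewrite mem_partsn => /eqP jE.
case: asboolP => [h|_]; last by rewrite !mul0r mulr0.
have := hstrip_psize h; rewrite jE => le1; have le2 : (j <= psize la)%N := leq_ord j.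
rewrite IH jE exprMn !mul1r [in RHS](_ : (psize la - psize mu = (j - psize mu) + (psize la - j))%N); last by lia.
by rewrite exprD; ring.
Qed.

End SkewSchur.

Definition rho_vars (z : CC) N : seq CC :=
  [seq z ^ ((2 * nth 0%N part0 i)%:Z - (2 * i).+1%:Z) | i <- iota 0 N].

Lemma rho_varsS z N : z != 0 ->
  rho_vars z N.+1 = z^-1 :: map (fun y => z ^- 2 * y) (rho_vars z N).
Proof.
move=> z0; rewrite /rho_vars /= -map_comp (iotaDl 1 0) -map_comp; congr cons.
apply: eq_map => i /=; rewrite !nth_nil exprnN -expfzDr //; congr (_ ^ _); lia.
Qed.

Lemma rho_rec z N la mu : z != 0 -> skew_schur (rho_vars z N.+1) la mu =
  \sum_(j < (psize la).+1) \sum_(nu <- partsn j) ind (hstrip nu mu) *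
     (z ^- (j - psize mu + 2 * (psize la - j)) * skew_schur (rho_vars z N) la nu).
Proof.
move=> z0; rewrite rho_varsS // skew_schur_cons; apply: eq_bigr => j _.
apply: eq_big_seq => nu; rewrite mem_partsn => /eqP jE; congr (_ * _).
rewrite skew_schur_scale jE mulrA; congr (_ * _).
by rewrite -!exprVn exprD exprM !exprVn.
Qed.

Section SchurLimit.

Let phi : {rmorphism {poly rat} -> ratfun} := @tofrac {poly rat}.
Let phi_eq0 (p : {poly rat}) : (phi p == 0) = (p == 0). Proof. exact: tofrac_eq0. Qed.
Let z0 : ratfun := phi 'X.

(** Equivalent to [is_schur_q] for the empty partition. The limit function is separated from its
    rational expression, so that algebraic and analytic statements can be combined independently. *)
Definition schur_limit la mu (r : ratfun) := exists f : CC -> CC, regular phi r f /\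
  forall z : CC, 1 < `|z| -> conv (fun N => skew_schur (rho_vars z N) la mu) (f z).

Lemma is_schur_limit la mu r : is_schur_q la mu part0 r <-> schur_limit la mu r.
Proof.
split=> [[a [b [rE H]]]|[f [[a [b [rE H]]] cf]]].
  exists (fun z => poly_at a z / poly_at b z); split.
    by exists a, b; split=> // z /H[].
  by move=> z /H[].
exists a, b; split=> // z z1; have [bz fz] := H z z1; split=> //.
by rewrite -fz; exact: cf.
Qed.

Lemma schur_limit_inj la mu r s : schur_limit la mu r -> schur_limit la mu s -> r = s.
Proof.
move=> [f [rf cf]] [g [sg cg]]; apply: (regular_inj phi_eq0 rf sg) => z z1.
exact: conv_unique (cf z z1) (cg z z1).
Qed.

Definition strict_parts la mu := [seq nu <- partslt (psize la).+1 | (psize mu < psize nu)%N].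

Lemma rho_recE z N la mu : z != 0 -> (psize mu <= psize la)%N ->
  skew_schur (rho_vars z N.+1) la mu =
  z ^- (2 * (psize la - psize mu)) * skew_schur (rho_vars z N) la mu +
  \sum_(nu <- strict_parts la mu) ind (hstrip nu mu) *
     (z ^- (psize nu - psize mu + 2 * (psize la - psize nu)) * skew_schur (rho_vars z N) la nu).
Proof.
move=> zn0 le; rewrite rho_rec //.
under eq_bigr => j _.
  rewrite (eq_big_seq (fun nu => ind (hstrip nu mu) *
    (z ^- (psize nu - psize mu + 2 * (psize la - psize nu)) * skew_schur (rho_vars z N) la nu))).
    over.
  by move=> nu; rewrite mem_partsn => /eqP ->.
rewrite -(big_partslt _ (fun nu => ind (hstrip nu mu) *
    (z ^- (psize nu - psize mu + 2 * (psize la - psize nu)) * skew_schur (rho_vars z N) la nu))).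
rewrite (bigD1_seq mu) ?partslt_uniq ?mem_partslt //=.
rewrite asboolT; last exact: hstrip_refl.
rewrite mul1r subnn add0n; congr (_ + _).
rewrite /strict_parts big_filter big_mkcond [RHS]big_mkcond; apply: eq_bigr => nu _.
case: eqVneq => [->|ne]; first by rewrite ltnn.
case: ltnP => // ge; case: (asboolP (hstrip nu mu)) => h; rewrite /= ?mul0r //.
exfalso; case/eqP: ne; apply: (hstrip_eq h); apply/eqP; rewrite eqn_leq ge; exact: hstrip_psize.
Qed.

Lemma schur_limit_diag la mu : (psize la <= psize mu)%N -> schur_limit la mu (la == mu)%:R.
Proof.
move=> le; exists (fun=> (la == mu)%:R); split; first exact: regular_cst.
move=> z /norm_gt1_neq0 zn0; apply: conv_ext (conv_cst _) => N.
move: le; rewrite leq_eqVlt => /orP[/eqP E|lt]; last first.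
  by rewrite skew_schur_small //; case: eqVneq lt => // ->; rewrite ltnn.
elim: N => [//|N IH]; rewrite rho_recE ?E // subnn expr0 invr1 mul1r -IH.
rewrite big_seq big1 ?addr0 // => nu; rewrite mem_filter mem_partslt E; lia.
Qed.

Definition strict_sum la mu (S : part -> ratfun) : ratfun :=
  \sum_(nu <- strict_parts la mu) ind (hstrip nu mu) *
     (z0 ^- (psize nu - psize mu + 2 * (psize la - psize nu)) * S nu).

(** By [rho_recE] the approximations satisfy u_(N+1) = rho u_N + v_N, where rho = z^(-2(|la| -
    |mu|)) is the term nu = mu, of absolute value less than 1, and v_N converges by hypothesis. So
    [conv_contract] applies. *)
Lemma schur_limit_step la mu (S : part -> ratfun) : (psize mu < psize la)%N ->
    (forall nu, (psize mu < psize nu)%N -> schur_limit la nu (S nu)) ->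
  schur_limit la mu ((1 - z0 ^- (2 * (psize la - psize mu)))^-1 * strict_sum la mu S).
Proof.
move=> lt H.
have /choice[f Hf] : forall nu, exists f, (psize mu < psize nu)%N -> regular phi (S nu) f /\
    forall z : CC, 1 < `|z| -> conv (fun N => skew_schur (rho_vars z N) la nu) (f z).
  move=> nu; case: (ltnP (psize mu) (psize nu)) => [/H[f Hf]|_]; first by exists f.
  by exists (fun=> 0).
pose e nu := (psize nu - psize mu + 2 * (psize la - psize nu))%N.
exists (fun z => (1 - z ^- (2 * (psize la - psize mu)))^-1 *
  \sum_(nu <- strict_parts la mu) ind (hstrip nu mu) * (z ^- e nu * f nu z)); split.
  apply: regularM; first by apply: regular_Vsub => //; rewrite muln_gt0 subn_gt0.
  apply: (@regular_sum _ phi phi_eq0 _ (strict_parts la mu)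
    (fun nu => ind (hstrip nu mu) * (z0 ^- e nu * S nu))
    (fun nu z => ind (hstrip nu mu) * (z ^- e nu * f nu z))).
  move=> nu; rewrite mem_filter => /andP[lt' _]; apply: regularM; first exact: regular_cst.
  by apply: regularM; [exact: regular_Vexp | case: (Hf nu lt')].
move=> z z1; have zn0 := norm_gt1_neq0 z1; rewrite mulrC.
have zinv : `|z ^- (2 * (psize la - psize mu))| < 1.
  rewrite normrV ?unitfE ?expf_neq0 // normrX invf_lt1 ?exprn_gt0 ?(lt_trans ltr01) //.
  by rewrite exprn_egt1 // -lt0n muln_gt0 subn_gt0.
apply: (@conv_contract _ _ (fun N => \sum_(nu <- strict_parts la mu) ind (hstrip nu mu) *
     (z ^- e nu * skew_schur (rho_vars z N) la nu)) _ zinv).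
  by move=> N; rewrite rho_recE // ltnW.
rewrite /strict_parts big_filter big_mkcond /=.
apply: conv_ext (conv_sum _ _); first by move=> N /=; rewrite big_filter [RHS]big_mkcond.
move=> nu /=; case: ifP => [lt'|_]; last exact: conv_cst.
by do 2 apply: conv_mull; have [_] := Hf nu lt'; exact.
Qed.

Lemma schur_limit_schur_q la mu : schur_limit la mu (schur_q la mu part0).
Proof.
suff [r Hr] : exists r, schur_limit la mu r.
  apply/is_schur_limit; apply: (@xgetPex _ 0 [set r | is_schur_q la mu part0 r]).
  by exists r; apply/is_schur_limit.
suff H d : forall mu, (psize la <= psize mu + d)%N -> exists r, schur_limit la mu r.
  by apply: (H (psize la)); rewrite leq_addl.
elim: d => [|d IH] {}mu le.
  by exists (la == mu)%:R; apply: schur_limit_diag; rewrite addn0 in le.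
case: (leqP (psize la) (psize mu)) => [le'|lt]; first by exists (la == mu)%:R; exact: schur_limit_diag.
have /choice[S HS] : forall nu, exists r, (psize mu < psize nu)%N -> schur_limit la nu r.
  move=> nu; case: (ltnP (psize mu) (psize nu)) => [lt'|_]; last by exists 0.
  by have [|r Hr] := IH nu; [lia | exists r].
by eexists; apply: (schur_limit_step lt HS).
Qed.

Lemma schur_q_diag la mu : (psize la <= psize mu)%N -> schur_q la mu part0 = (la == mu)%:R.
Proof. by move=> le; exact: schur_limit_inj (schur_limit_schur_q la mu) (schur_limit_diag le). Qed.

Lemma schur_q_rec la mu : (psize mu < psize la)%N -> schur_q la mu part0 =
  (1 - z0 ^- (2 * (psize la - psize mu)))^-1 * strict_sum la mu (fun nu => schur_q la nu part0).
Proof.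
move=> lt; apply: schur_limit_inj (schur_limit_schur_q la mu) _.
by apply: schur_limit_step lt _ => nu _; exact: schur_limit_schur_q.
Qed.

End SchurLimit.

(** * The recursion in matrix form *)

Section StrictRecursion.
Variables (F : fieldType) (z : F).
Hypothesis zn0 : z != 0.
Hypothesis zX : forall n, (0 < n)%N -> z ^+ n != 1.
Variable S : part -> part -> F.
Hypothesis S_diag : forall la mu, (psize la <= psize mu)%N -> S la mu = (la == mu)%:R.
Hypothesis S_strict : forall la mu, (psize mu < psize la)%N ->
  S la mu = (1 - z ^- (2 * (psize la - psize mu)))^-1 *
    \sum_(nu <- strict_parts la mu) ind (hstrip nu mu) *
      (z ^- (psize nu - psize mu + 2 * (psize la - psize nu)) * S la nu).

(** The diagonal term nu = mu, which [S_strict] has divided out, is put back. As S la nu vanishes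
    for |nu| > |la|, every N > m gives the same sum. *)
Lemma kmx_strict_rec m n N : (m < N)%N ->
  z ^+ (2 * m) *: kmx S m n = z ^+ n *: \sum_(j < N) z ^+ j *: (kmx S m j *m Emx F j n).
Proof.
move=> mN.
under eq_bigr do rewrite kmxM kmxZ.
have -> : \sum_(j < N) kmx (fun la mu => z ^+ j * \sum_(nu <- partsn j) S la nu * ind (hstrip nu mu)) m n =
  kmx (fun la mu => \sum_(nu <- partslt N) z ^+ psize nu * (S la nu * ind (hstrip nu mu))) m n.
  apply/matrixP => i j; rewrite summxE mxE big_partslt; apply: eq_bigr => k _.
  rewrite mxE mulr_sumr; apply: eq_big_seq => nu; rewrite mem_partsn => /eqP->.
  by [].
rewrite !kmxZ; apply: eq_kmx => la mu lam mun.
have small nu : (psize la < psize nu)%N -> S la nu = 0.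
  by move=> lt; rewrite S_diag 1?ltnW //; case: eqVneq lt => // ->; rewrite ltnn.
case: (ltnP m n) => [lt|le].
  rewrite small ?lam ?mun // mulr0 big1 ?mulr0 // => nu _.
  case: (asboolP (hstrip nu mu)) => [/hstrip_psize h|_]; last by rewrite !mulr0.
  by rewrite small ?mul0r ?mulr0 //; lia.
have -> : \sum_(nu <- partslt N) z ^+ psize nu * (S la nu * ind (hstrip nu mu)) =
   z ^+ n * S la mu + \sum_(nu <- strict_parts la mu) z ^+ psize nu * (S la nu * ind (hstrip nu mu)).
  rewrite (bigD1_seq mu) ?partslt_uniq ?mem_partslt ?mun ?(leq_ltn_trans le) //=.
  rewrite asboolT; last exact: hstrip_refl.
  rewrite mulr1; congr (_ + _).
  rewrite (bigID (fun nu => nu \in strict_parts la mu)) /= [X in _ + X]big1 ?addr0.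
    rewrite -[LHS]big_filter; apply: perm_big; apply: uniq_perm.
    - by rewrite filter_uniq // partslt_uniq.
    - by rewrite filter_uniq // partslt_uniq.
    move=> nu; rewrite mem_filter !mem_partslt.
    rewrite [in RHS]mem_filter mem_partslt mem_filter mem_partslt.
    case: eqVneq => [->|_]; first by rewrite ltnn.
    by case: ltnP => //= _; case: ltnP => //=; lia.
  move=> nu /andP[ne]; rewrite mem_filter mem_partslt negb_and -!leqNgt.
  case: (asboolP (hstrip nu mu)) => h; last by rewrite !mulr0.
  case/orP => [ge|gt]; last by rewrite small ?mul0r ?mulr0.
  case/eqP: ne; apply: (hstrip_eq h); apply/eqP; rewrite eqn_leq ge; exact: hstrip_psize.
move: le; rewrite leq_eqVlt => /orP[/eqP nm|lt].
  rewrite big_seq big1 => [|nu]; last by rewrite mem_filter mem_partslt lam mun; lia.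
  by rewrite addr0 mulrA -exprD nm; congr (_ * _); congr (_ ^+ _); lia.
have d0 : 1 - z ^- (2 * (m - n)) != 0.
  rewrite subr_eq0 eq_sym invr_eq1; apply: zX; lia.
have := @S_strict la mu; rewrite lam mun => /(_ lt) /(congr1 (fun x => (1 - z ^- (2 * (m - n))) * x)).
rewrite mulVKf // mulrBl mul1r => /(congr1 (fun x => z ^+ (2 * m) * x)).
rewrite mulrBr mulrA mulr_sumr => /eqP; rewrite subr_eq => /eqP ->.
rewrite mulrDr addrC mulrA -exprD; congr (_ + _).
  congr (_ * _); have -> : (2 * m = n + n + 2 * (m - n))%N by lia.
  by rewrite exprD mulfK // expf_neq0.
rewrite mulr_sumr; apply: eq_big_seq => nu.
rewrite mem_filter mem_partslt lam mun => /andP[lt1 lt2].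
have E : z ^+ (2 * m) * z ^- (psize nu - n + 2 * (m - psize nu)) = z ^+ n * z ^+ psize nu.
  rewrite -exprD.
  have -> : (2 * m = n + psize nu + (psize nu - n + 2 * (m - psize nu)))%N by lia.
  by rewrite exprD mulfK // expf_neq0.
rewrite [X in _ * X]mulrCA !mulrA -[z ^+ n * _]E; move: (z ^- _) => w; ring.
Qed.

Lemma pval_boxes la : z ^+ 2 != 1 -> exists2 s : seq int, size s = psize la &
  pval z la = (z - z^-1)^-1 + (z - z^-1) * \sum_(c <- s) qcont z c.
Proof.
move=> z2; elim/part_box_ind: la => [|la mu i c [s ss IH]].
  by exists [::] => //; rewrite big_nil mulr0 addr0 pval0.
exists (((nth 0%N mu i)%:Z - i%:Z) :: s); first by rewrite /= ss (covers_size c).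
rewrite (pval_cov zn0 z2 c) IH big_cons; ring.
Qed.

End StrictRecursion.

(** * Genericity of q^(1/2) *)

Section PolynomialEmbedding.
Variables (F : fieldType) (phi : {rmorphism {poly rat} -> F}).
Hypothesis phi_eq0 : forall p, (phi p == 0) = (p == 0).
Let z := phi 'X.

Lemma phiX_neq0 : z != 0.
Proof. by rewrite phi_eq0 polyX_eq0. Qed.

Lemma phiX_exp n : (0 < n)%N -> z ^+ n != 1.
Proof.
move=> n0; rewrite -subr_eq0 -(rmorph1 phi) -rmorphXn -rmorphB phi_eq0 subr_eq0.
by apply/eqP => /(congr1 (fun p : {poly rat} => size p)); rewrite size_polyXn size_poly1; lia.
Qed.

(** After multiplication by a power of z the sum is a polynomial whose value at 1 is the number of
    terms. With [pval_boxes] this shows that [pval] differs from K^-1 at nonempty partitions. *)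
Lemma phiX_sum (s : seq int) : s != [::] -> \sum_(c <- s) qcont z c != 0.
Proof.
move=> s0; pose M : int := \sum_(c <- s) `|c|.
have Mc c : c \in s -> c <= M.
  move=> cs; rewrite /M (big_rem c) //= (le_trans (ler_norm c)) // lerDl.
  by apply: sumr_ge0 => i _.
have E : z ^ (2 * M) * \sum_(c <- s) qcont z c = phi (\sum_(c <- s) 'X^(absz (2 * (M - c)))).
  rewrite mulr_sumr rmorph_sum; apply: eq_big_seq => c /Mc le.
  rewrite rmorphXn -/z -[RHS]/(z ^ (absz (2 * (M - c)))) /qcont -expfzDr ?phiX_neq0 //.
  congr (_ ^ _); lia.
apply: contraTneq isT => S0; move: E; rewrite S0 mulr0 => /esym/eqP; rewrite phi_eq0.
move=> /eqP/(congr1 (horner^~ 1)); rewrite horner_sum hornerC.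
under eq_bigr do rewrite hornerXn expr1n.
by rewrite big_const_seq count_predT iter_addr_0 => /eqP; rewrite pnatr_eq0 size_eq0 (negPf s0).
Qed.

Lemma phiX_pval la : la != part0 -> pval z la != (z - z^-1)^-1.
Proof.
have z2 : z ^+ 2 != 1 by exact: phiX_exp.
move=> la0; have [s ss ->] := pval_boxes phiX_neq0 la z2.
rewrite addrC -subr_eq0 addrK mulf_neq0 ?K_neq0 ?phiX_neq0 // phiX_sum //.
by apply: contraNneq la0 => s0; apply/eqP; apply: psize_eq0; rewrite -ss s0.
Qed.

End PolynomialEmbedding.

(** * Logarithms of power series *)
Section LogCoefficients.
Variable F : fieldType.
Hypothesis natF : forall k, (0 < k)%N -> k%:R != 0 :> F.

Definition trunc n N (Z : 'X_{1..n} -> F) : {mpoly F[n]} :=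
  \sum_(m : 'X_{1..n < N}) Z m *: 'X_[m].

(* [log_coef] over an arbitrary field. *)
Definition lcoef n (Z : 'X_{1..n} -> F) (d : 'X_{1..n}) : F :=
  let u : {mpoly F[n]} := trunc (mdeg d).+1 Z - 1 in
  \sum_(1 <= k < (mdeg d).+1) (-1) ^+ k.-1 / k%:R * (u ^+ k)@_d.

Section Congruence.
Variable n : nat.
Implicit Types (p q : {mpoly F[n]}) (d : 'X_{1..n}) (Z : 'X_{1..n} -> F).

Lemma mcoeff_trunc N Z d : (mdeg d < N)%N -> (trunc N Z)@_d = Z d.
Proof. exact: mcoeff_mpoly. Qed.

Definition eqm N p q := forall d, (mdeg d < N)%N -> p@_d = q@_d.

Lemma eqm_refl N p : eqm N p p. Proof. by []. Qed.

Lemma eqm_sym N p q : eqm N p q -> eqm N q p.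
Proof. by move=> e d /e. Qed.

Lemma eqm_trans N p q r : eqm N p q -> eqm N q r -> eqm N p r.
Proof. by move=> e1 e2 d lt; rewrite e1 ?e2. Qed.

Lemma eqmD N p q p' q' : eqm N p p' -> eqm N q q' -> eqm N (p + q) (p' + q').
Proof. by move=> e1 e2 d lt; rewrite !mcoeffD e1 ?e2. Qed.

Lemma eqmB N p q p' q' : eqm N p p' -> eqm N q q' -> eqm N (p - q) (p' - q').
Proof. by move=> e1 e2 d lt; rewrite !mcoeffB e1 ?e2. Qed.

Lemma eqmM N p q p' q' : eqm N p p' -> eqm N q q' -> eqm N (p * q) (p' * q').
Proof.
move=> e1 e2 d lt; rewrite !mcoeffM; apply: eq_bigr => -[[k1 h1] [k2 h2]] /eqP /= dE.
by rewrite e1 ?e2 //; move: lt; rewrite dE mdegD; lia.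
Qed.

Lemma eqmX N p q k : eqm N p q -> eqm N (p ^+ k) (q ^+ k).
Proof.
move=> e; elim: k => [|k IH]; first by rewrite !expr0.
by rewrite !exprS; apply: eqmM.
Qed.

Lemma eqm_deriv N i p q : eqm N.+1 p q -> eqm N p^`M(i) q^`M(i).
Proof.
by move=> e d lt; rewrite !mcoeff_mderiv e // mdegD mdeg1 addn1.
Qed.

Lemma trunc_eqm N N' Z : (N <= N')%N -> eqm N (trunc N Z) (trunc N' Z).
Proof.
by move=> le d lt; rewrite !mcoeff_trunc // (leq_trans lt).
Qed.

Lemma mcoeff_exp_small p k d : p@_0%MM = 0 -> (mdeg d < k)%N -> (p ^+ k)@_d = 0.
Proof.
move=> p0; elim: k d => // k IH d lt; rewrite exprS mcoeffM big1 // => -[[k1 h1] [k2 h2]] /eqP /= dE.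
case: (eqVneq k1 0%MM) => [->|ne]; first by rewrite p0 mul0r.
rewrite IH ?mulr0 //; move: lt ne; rewrite dE mdegD -mdeg_eq0; lia.
Qed.

Lemma mcoeff_sum_unit p q N : p@_0%MM = 1 -> eqm N (p * q) 0 -> eqm N q 0.
Proof.
move=> p0 e d; have [k le] := ubnP (mdeg d); elim: k d le => // k IH d le lt.
have := e d lt; rewrite mcoeffM mcoeff0.
have h0 : (mdeg (0%MM : 'X_{1..n}) < (mdeg d).+1)%N by rewrite mdeg0.
rewrite (bigD1 (BMultinom h0, BMultinom (ltnSn (mdeg d)))) /=; last by rewrite add0m.
rewrite p0 mul1r big1 ?addr0 // => -[[k1 h1] [k2 h2]] /= /andP[/eqP dE ne].
rewrite IH ?mcoeff0 ?mulr0 //; last by move: lt; rewrite dE mdegD; lia.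
have : k1 != 0%MM.
  by apply: contra ne => /eqP k10; rewrite -pair_eqE /= -!val_eqE /= dE k10 add0m !eqxx.
move: le; rewrite -mdeg_eq0 dE mdegD; lia.
Qed.

(** N bounds the degrees kept and K the powers in the logarithm. By [lcoefE] the coefficient at d is
    independent of both once they exceed the degree of d. *)
Definition logp N K Z : {mpoly F[n]} :=
  \sum_(1 <= k < K) ((-1) ^+ k.-1 / k%:R) *: (trunc N Z - 1) ^+ k.

Lemma trunc_sub1 N Z : (0 < N)%N -> Z 0%MM = 1 -> (trunc N Z - 1)@_0%MM = 0.
Proof.
by move=> N0 Z0; rewrite mcoeffB mcoeff_trunc ?mdeg0 // mcoeff1 Z0 eqxx subrr.
Qed.

Lemma lcoefE Z N K d : Z 0%MM = 1 -> (mdeg d < N)%N -> (mdeg d < K)%N ->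
  lcoef Z d = (logp N K Z)@_d.
Proof.
move=> Z0 dN dK; rewrite /logp (big_cat_nat (n := (mdeg d).+1)) //= mcoeffD.
rewrite [X in _ + X](_ : _ = 0) ?addr0.
  rewrite raddf_sum /=; apply: eq_bigr => k _; rewrite mcoeffZ; congr (_ * _).
  by apply: (eqmX _ (N := (mdeg d).+1)) => //; apply: eqmB => //; exact: trunc_eqm.
rewrite raddf_sum big_nat big1 //= => k /andP[lt _].
by rewrite mcoeffZ mcoeff_exp_small ?mulr0 // trunc_sub1 // (leq_trans _ dN).
Qed.

Lemma lcoef0 Z : lcoef Z 0%MM = 0.
Proof. by rewrite /lcoef mdeg0 big_geq. Qed.

(** With u = P - 1, the derivative of the logarithm is P' times a geometric sum in -u. Multiplied by
    P the sum telescopes to 1 - (-u)^N, and the last term has order at least N. *)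
Lemma logp_deriv Z N i : Z 0%MM = 1 ->
  eqm N (trunc N.+1 Z * (logp N.+1 N.+1 Z)^`M(i)) (trunc N.+1 Z)^`M(i).
Proof.
move=> Z0; set P := trunc _ _; set u := P - 1.
have derX k : (u ^+ k.+1)^`M(i) = k.+1%:R *: (u ^+ k * P^`M(i)).
  have du : u^`M(i) = P^`M(i) by rewrite /u mderivB -[1]/(1%:MP) mderivC subr0.
  elim: k => [|k IH]; first by rewrite expr1 expr0 mul1r scale1r.
  rewrite exprS mderivM IH du -scalerAr -[k.+2]addn1 natrD scalerDl scale1r addrC.
  by rewrite mulrA -exprS [_ * u ^+ _]mulrC.
have -> : (logp N.+1 N.+1 Z)^`M(i) = \sum_(k < N) (- u) ^+ k * P^`M(i).
  rewrite /logp raddf_sum /= big_add1 /= big_mkord; apply: eq_bigr => k _.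
  have sg (p : {mpoly F[n]}) : (-1) ^+ k *: p = (-1) ^+ k * p.
    elim: (nat_of_ord k) => [|l IH]; first by rewrite !expr0 scale1r mul1r.
    by rewrite !exprS -scalerA IH scaleN1r -mulrA mulN1r.
  by rewrite mderivZ derX scalerA divfK ?natF // (exprNn u) sg mulrA.
have -> : P * (\sum_(k < N) (- u) ^+ k * P^`M(i)) = P^`M(i) - (- u) ^+ N * P^`M(i).
  rewrite -mulr_suml mulrA -[X in _ = X - _]mul1r -mulrBl; congr (_ * _).
  apply: oppr_inj; rewrite [RHS]opprB subrX1 -mulNr; congr (_ * _).
  by rewrite /u opprB addrAC subrr sub0r.
move=> d lt; rewrite mcoeffB [X in _ - X](_ : _ = 0) ?subr0 //.
rewrite mcoeffM big1 // => -[[k1 h1] [k2 h2]] /eqP /= dE.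
rewrite mcoeff_exp_small ?mul0r //.
  by rewrite mcoeffN trunc_sub1 ?oppr0.
by move: lt; rewrite dE mdegD; lia.
Qed.

(* Both sides have the same logarithmic derivative. *)
Lemma lcoef_mul (Z Z1 Z2 : 'X_{1..n} -> F) : Z 0%MM = 1 -> Z1 0%MM = 1 -> Z2 0%MM = 1 ->
    (forall N, eqm N (trunc N Z) (trunc N Z1 * trunc N Z2)) ->
  forall d, lcoef Z d = lcoef Z1 d + lcoef Z2 d.
Proof.
move=> Z0 Z10 Z20 ZE d; case: (eqVneq d 0%MM) => [->|d0]; first by rewrite !lcoef0 addr0.
have [i di] : exists i, (0 < d i)%N.
  apply/existsP; apply: contraNT d0; rewrite negb_exists => /forallP H.
  by apply/eqP/mnmP => i; have := H i; rewrite mnm0E lt0n negbK => /eqP.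
pose N := mdeg d; pose L := logp N.+1 N.+1 Z - (logp N.+1 N.+1 Z1 + logp N.+1 N.+1 Z2).
have e1 := logp_deriv (N := N) i Z0; have e2 := logp_deriv (N := N) i Z10.
have e3 := logp_deriv (N := N) i Z20.
have eL : eqm N L^`M(i) 0.
  apply: (@mcoeff_sum_unit (trunc N.+1 Z)); first by rewrite mcoeff_trunc ?mdeg0.
  rewrite /L mderivB mderivD mulrBr mulrDr -(subrr (trunc N.+1 Z)^`M(i)).
  apply: eqmB => //; apply: eqm_sym.
  apply: eqm_trans (eqm_deriv i (ZE N.+1)) _; rewrite mderivM.
  have le : (N <= N.+1)%N by [].
  have ZE' : eqm N (trunc N.+1 Z) (trunc N.+1 Z1 * trunc N.+1 Z2).
    by move=> k lt; apply: ZE; rewrite ltnW.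
  apply: eqm_sym; apply: eqmD.
    apply: eqm_trans (eqmM ZE' (@eqm_refl _ _)) _.
    rewrite mulrAC; exact: eqmM.
  apply: eqm_trans (eqmM ZE' (@eqm_refl _ _)) _.
  rewrite -mulrA; exact: eqmM.
have dU : (d - U_(i) + U_(i))%MM = d.
  by apply: submK; apply/mnm_lepP => j; rewrite mnm1E; case: eqP => // <-.
have lt : (mdeg (d - U_(i))%MM < N)%N by rewrite /N -{2}dU mdegD mdeg1 addn1.
have := eL _ lt; rewrite mcoeff_mderiv dU mcoeff0 -mulr_natr => /eqP.
rewrite mulf_eq0 (negPf (natF _)) // orbF /L mcoeffB mcoeffD subr_eq0 => /eqP.
by rewrite -!lcoefE.
Qed.

(** As A is a monoid, all powers of Z - 1 are supported in it. *)
Lemma lcoef_supp (A : 'X_{1..n} -> Prop) Z : Z 0%MM = 1 -> A 0%MM ->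
    (forall a b, A a -> A b -> A (a + b)%MM) -> (forall d, ~ A d -> Z d = 0) ->
  forall d, ~ A d -> lcoef Z d = 0.
Proof.
move=> Z0 A0 AD ZA d nAd; rewrite /lcoef; set N := (mdeg d).+1.
rewrite big1 // => k _; rewrite (_ : (_ ^+ k)@_d = 0) ?mulr0 //.
have : (mdeg d < N)%N by []; move: N => N; elim: k d nAd => [|k IH] d nAd lt.
  by rewrite expr0 mcoeff1; case: eqVneq nAd => // ->.
rewrite exprS mcoeffM big1 // => -[[k1 h1] [k2 h2]] /eqP /= dE.
have [lt1 lt2] : (mdeg k1 < N)%N /\ (mdeg k2 < N)%N by move: lt; rewrite dE mdegD; lia.
case: (pselect (A k1)) => A1; last first.
  rewrite mcoeffB mcoeff_trunc // ZA // mcoeff1; case: eqVneq A1 => [->//|_ _].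
  by rewrite subr0 mul0r.
by rewrite (IH k2) ?mulr0 // => A2; apply: nAd; rewrite dE; exact: AD.
Qed.

End Congruence.

(** The index set of [mcoeffM] as a list of unbounded pairs, so that reindexing does not meet the
    degree bounds. *)
Definition mnm_pairs n (e : 'X_{1..n}) : seq ('X_{1..n} * 'X_{1..n}) :=
  [seq (bmnm k.1, bmnm k.2) |
    k <- enum [pred k : 'X_{1..n < (mdeg e).+1, (mdeg e).+1} | e == (k.1 + k.2)%MM]].

Lemma mnm_pairs_uniq n (e : 'X_{1..n}) : uniq (mnm_pairs e).
Proof.
rewrite map_inj_in_uniq ?enum_uniq // => -[a b] [c d] _ _ [/val_inj-> /val_inj->].
by [].
Qed.

Lemma mem_mnm_pairs n (e : 'X_{1..n}) x : (x \in mnm_pairs e) = (e == (x.1 + x.2)%MM).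
Proof.
apply/mapP/eqP => [[k]|eE]; first by rewrite mem_enum => /eqP eE ->.
have h1 : (mdeg x.1 < (mdeg e).+1)%N by rewrite eE mdegD ltnS leq_addr.
have h2 : (mdeg x.2 < (mdeg e).+1)%N by rewrite eE mdegD ltnS leq_addl.
exists (BMultinom h1, BMultinom h2); last by rewrite /= -surjective_pairing.
by rewrite mem_enum; apply/eqP.
Qed.

Lemma mcoeffM_pairs n (p q : {mpoly F[n]}) e :
  (p * q)@_e = \sum_(x <- mnm_pairs e) p@_x.1 * q@_x.2.
Proof. by rewrite mcoeffM /mnm_pairs big_map big_enum. Qed.

(* [h] identifies the exponents of [Z'] with a face of the monoid [A], which
   contains the support of [Z]. *)
Lemma lcoef_face n m (h : 'X_{1..m} -> 'X_{1..n}) (A : 'X_{1..n} -> Prop) C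
    (Z : 'X_{1..n} -> F) (Z' : 'X_{1..m} -> F) :
    Z 0%MM = 1 -> Z' 0%MM = 1 -> A 0%MM ->
    (forall a b, A a -> A b -> A (a + b)%MM) -> (forall d, ~ A d -> Z d = 0) ->
    (forall a b, h (a + b)%MM = (h a + h b)%MM) -> injective h -> h 0%MM = 0%MM ->
    (forall d, (mdeg (h d) <= C * mdeg d)%N) ->
    (forall a b d, A a -> A b -> (a + b)%MM = h d -> exists a' b', a = h a' /\ b = h b') ->
    (forall d, Z (h d) = Z' d) ->
  forall d, lcoef Z (h d) = lcoef Z' d.
Proof.
move=> Z0 Z'0 A0 AD ZA hD hI h0 hC face ZZ' d.
(* The map [h] may multiply degrees by up to C, so the two series are truncated at different
   degrees. *)
pose N' := (mdeg d).+1; pose N := (C * N').+1.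
have ltN e : (mdeg e < N')%N -> (mdeg (h e) < N)%N.
  move=> lt; rewrite /N ltnS; apply: leq_trans (hC e) _.
  by rewrite leq_mul2l ltnW // orbT.
pose u := trunc N Z - 1; pose u' := trunc N' Z' - 1.
have uA e : (mdeg e < N)%N -> ~ A e -> u@_e = 0.
  move=> lt nA; rewrite /u mcoeffB mcoeff_trunc // ZA // mcoeff1.
  by case: eqVneq nA => [->//|_ _]; rewrite subr0.
have uXA k e : (mdeg e < N)%N -> ~ A e -> (u ^+ k)@_e = 0.
  elim: k e => [|k IH] e lt nA.
    by rewrite expr0 mcoeff1; case: eqVneq nA => // ->.
  rewrite exprS mcoeffM big1 // => -[[k1 h1] [k2 h2]] /eqP /= dE.
  have [lt1 lt2] : (mdeg k1 < N)%N /\ (mdeg k2 < N)%N by move: lt; rewrite dE mdegD; lia.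
  case: (pselect (A k1)) => A1; last by rewrite uA ?mul0r.
  by rewrite (IH k2) ?mulr0 // => A2; apply: nA; rewrite dE; exact: AD.
have main k e : (mdeg e < N')%N -> (u ^+ k)@_(h e) = (u' ^+ k)@_e.
  elim: k e => [|k IH] e lt.
    by rewrite !expr0 !mcoeff1 -h0 (inj_eq hI).
  have lth := ltN _ lt.
  rewrite !exprS.
  rewrite !mcoeffM_pairs.
  pose H (x : 'X_{1..m} * 'X_{1..m}) := (h x.1, h x.2).
  (* A pair outside the image of [H] contributes 0: if both of its members were in A, the face
     property would put it in the image. *)
  rewrite (bigID (fun x => x \in map H (mnm_pairs e))) /= [X in _ + X]big1_seq ?addr0; last first.
    move=> x /andP[nH]; rewrite mem_mnm_pairs => /eqP eE.
    have [lt1 lt2] : (mdeg x.1 < N)%N /\ (mdeg x.2 < N)%N by move: lth; rewrite eE mdegD; lia.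
    case: (pselect (A x.1)) => A1; last by rewrite uA ?mul0r.
    case: (pselect (A x.2)) => A2; last by rewrite uXA ?mulr0.
    have [a [b [aE bE]]] := face _ _ _ A1 A2 (esym eE).
    case/negP: nH; apply/mapP; exists (a, b); last by rewrite /H /= -aE -bE; case: (x).
    by rewrite mem_mnm_pairs /=; apply/eqP/hI; rewrite hD -aE -bE.
  rewrite -big_filter (perm_big (map H (mnm_pairs e))) /=; last first.
    apply: uniq_perm; rewrite ?filter_uniq ?mnm_pairs_uniq //.
      by rewrite map_inj_uniq ?mnm_pairs_uniq // => -[a b] [a' b'] [/hI-> /hI->].
    move=> x; rewrite mem_filter; case: (boolP (x \in map H _)) => // /mapP[[a b]].
    by rewrite !mem_mnm_pairs => /eqP -> -> /=; rewrite hD eqxx.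
  rewrite big_map; apply: eq_big_seq => -[a b]; rewrite mem_mnm_pairs /= => /eqP eE.
  have [lt1 lt2] : (mdeg a < N')%N /\ (mdeg b < N')%N by move: lt; rewrite eE mdegD; lia.
  rewrite IH //; congr (_ * _); rewrite /u /u' !mcoeffB !mcoeff_trunc ?ltN // ZZ' !mcoeff1.
  by rewrite -h0 (inj_eq hI).
have lth : (mdeg (h d) < N)%N by apply: ltN.
have K1 : (mdeg (h d) < N + N')%N by exact: ltn_addr.
have K2 : (mdeg d < N + N')%N by exact: ltn_addl.
rewrite (lcoefE Z0 lth K1) (lcoefE (N := N') Z'0 _ K2) //.
rewrite !raddf_sum /=; apply: eq_bigr => k _.
by rewrite !mcoeffZ main.
Qed.

End LogCoefficients.

Lemma log_coefE n (Z : 'X_{1..n} -> ratfun) d : log_coef Z d = lcoef Z d.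
Proof. by []. Qed.

(** * The vertex with an empty middle leg *)
Section VertexAtQ.

Let phi : {rmorphism {poly rat} -> ratfun} := @tofrac {poly rat}.
Let phi_eq0 (p : {poly rat}) : (phi p == 0) = (p == 0). Proof. exact: tofrac_eq0. Qed.
Let S (la mu : part) : ratfun := schur_q la mu part0.

Lemma qhalf_neq0 : qhalf != 0. Proof. exact: (phiX_neq0 phi_eq0). Qed.

Let qhalf_X n : (0 < n)%N -> qhalf ^+ n != 1. Proof. exact: (phiX_exp phi_eq0). Qed.

Lemma natr_ratfun_neq0 k : (0 < k)%N -> k%:R != 0 :> ratfun.
Proof.
move=> k0; rewrite -(rmorph_nat phi) phi_eq0 -polyC1 -(rmorph_nat (@polyC rat)) polyC_eq0.
by rewrite pnatr_eq0 -lt0n.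
Qed.

Let S_diag la mu : (psize la <= psize mu)%N -> S la mu = (la == mu)%:R.
Proof. exact: schur_q_diag. Qed.

Let S_rec m n N : (m < N)%N ->
  qhalf ^+ (2 * m) *: kmx S m n = qhalf ^+ n *: \sum_(j < N) qhalf ^+ j *: (kmx S m j *m Emx ratfun j n).
Proof.
apply: kmx_strict_rec => //; first exact: qhalf_neq0.
move=> la mu lt; exact: schur_q_rec.
Qed.

Let pv la : la != part0 -> pval qhalf la != (qhalf - qhalf^-1)^-1.
Proof. exact: (phiX_pval phi_eq0). Qed.

Lemma vertexC_mid0 al be : vertexC al part0 be = vertex2 qhalf S al be.
Proof.
rewrite /vertexC conj_part0 [schur_q part0 _ _]S_diag // eqxx mulr1 /vertex2; congr (_ * _).
rewrite (fsum_seq (partslt_uniq (psize al).+1)); last first.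
  move=> mu _; rewrite mem_partslt ltnS -ltnNge => lt; rewrite -/(S al mu) S_diag 1?ltnW //.
  by case: eqVneq lt => [->|_]; rewrite ?ltnn // mul0r.
rewrite (eq_bigl xpredT) => [|mu]; last by apply/asboolP.
by rewrite big_partslt.
Qed.

(** These five facts are all that the rest of the proof uses about the values of the vertex. *)
Lemma vertexC_resolution : exists (zeta : nat -> ratfun) (p : part -> part -> {poly ratfun}),
  [/\ vertexC part0 part0 part0 = 1,
    forall m, zeta m =
      \sum_(eta <- partsn m) vertexC part0 part0 (conj_part eta) * vertexC eta part0 part0,
    forall al be m,
      \sum_(eta <- partsn m) vertexC al part0 (conj_part eta) * vertexC eta part0 be =
      \sum_(i < m.+1) (p al be)`_i * zeta (m - i)%N,
    forall al be i, (psize al + psize be < i)%N -> (p al be)`_i = 0 &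
    forall al be, (p al be)`_(psize al + psize be) =
      qhalf ^ (kappa be - kappa al) * vertexC al part0 be].
Proof.
exists (zeta0 qhalf S), (vertex_poly qhalf S); split.
- by rewrite vertexC_mid0 vertex2_0.
- move=> m; rewrite (zeta0_E qhalf_neq0 qhalf_X S_diag S_rec pv).
  by apply: eq_bigr => eta _; rewrite !vertexC_mid0.
- move=> al be m; rewrite -(vertex_sum qhalf_neq0 qhalf_X S_diag S_rec pv).
  by apply: eq_bigr => eta _; rewrite !vertexC_mid0.
- by move=> al be i; apply: (size_vertex_poly qhalf_neq0 qhalf_X).
- by move=> al be; rewrite vertexC_mid0 (lead_vertex_poly qhalf_neq0 qhalf_X S_diag).
Qed.

End VertexAtQ.

(** * The partition function of a canonical bundle *)

Lemma sign_exprz (F : fieldType) (m : int) (k : int) : (-1 : F) ^ (m + 2 * k) = (-1) ^ m.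
Proof.
rewrite expfzDr ?oppr_eq0 ?oner_eq0 // -exprz_exp (_ : (-1 : F) ^ 2 = 1) ?exp1rz ?mulr1 //.
by rewrite -[(-1) ^ 2]/((-1) ^+ 2) sqrrN expr1n.
Qed.

Section CanonicalBundle.
Variables (n : nat) (v : 'I_n -> int * int).
Hypothesis smv : smooth_rays v.

(** With one or two rays [ordS] is an involution, and the antisymmetric [det2] would take the value
    1 on both orders of the same pair. *)
Lemma smooth_gt2 : (0 < n)%N -> (2 < n)%N.
Proof.
move=> n0; rewrite ltnNge; apply/negP => n2; pose i : 'I_n := Ordinal n0.
have := smv i; have := smv (ordS i).
have iS : ordS (ordS i) = i.
  have H m : (0 < m <= 2)%N -> (((1 %% m).+1) %% m = 0)%N by case: m => [|[|[|]]].
  by apply: val_inj; apply: H; rewrite n0.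
rewrite iS; case: (v i) (v (ordS i)) => a b [c d]; rewrite /det2 /=; lia.
Qed.

Lemma ordS2_neq i : ordS (ordS i) != i :> 'I_n.
Proof.
have n3 := smooth_gt2 (leq_ltn_trans (leq0n i) (ltn_ord i)).
rewrite -val_eqE /=; have := ltn_ord i; rewrite leq_eqVlt => /orP[/eqP E|lt].
  rewrite E modnn modn_small; last by lia.
  lia.
rewrite (modn_small lt); move: lt; rewrite leq_eqVlt => /orP[/eqP E|lt].
  by rewrite E modnn; lia.
by rewrite modn_small //; lia.
Qed.

Lemma ordS_neq i : ordS i != i :> 'I_n.
Proof.
by apply: contra (ordS2_neq i) => /eqP E; rewrite {1}E E.
Qed.

Definition edge (i : 'I_n) : 'I_n.+1 * 'I_n.+1 := (ord0, lift ord0 i).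

Lemma edge_inj : injective edge.
Proof. by move=> i j /(congr1 snd) /= /lift_inj. Qed.

Lemma KS_conell i j c : is_cone (X := KS v) (lift ord0 i) (lift ord0 j) c -> j = ordS i.
Proof.
rewrite /is_cone; case/or3P => /imsetP[a _] //.
by move=> E; have := congr1 snd E; have := congr1 (fun s => s.1.2) E => /= /lift_inj -> /lift_inj.
Qed.

(** An outer side from i to i+1 lies in one triangle only: a triangle on its other side would give
    [ordS (ordS i) = i]. *)
Lemma E3_KS : E3 (KS v) = [set edge i | i : 'I_n]%SET.
Proof.
apply/setP => -[a b]; rewrite inE /=; apply/idP/imsetP => [|[i _ [-> ->]]]; last first.
  rewrite /= /is_side /=; apply/andP; split.
    by apply/existsP; exists (lift ord0 (ordS i)); rewrite KS_cone0.
  by apply/existsP; exists (lift ord0 (ord_pred i)); rewrite KS_cone1.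
case: (unliftP ord0 a) => [i|] ->; last first.
  case: (unliftP ord0 b) => [j|] -> //= _.
  by exists j.
case: (unliftP ord0 b) => [j|] -> // /and3P[_ /existsP[c /= h1] /existsP[d /= h2]].
have E1 := KS_conell h1; have E2 := KS_conell h2.
by have := ordS2_neq i; rewrite -E1 -E2 eqxx.
Qed.

Lemma edge_E3 i : edge i \in E3 (KS v).
Proof. by rewrite E3_KS; apply/imsetP; exists i. Qed.

Lemma E3_edge e : e \in E3 (KS v) -> exists i, e = edge i.
Proof. by rewrite E3_KS => /imsetP[i _ ->]; exists i. Qed.

(** Index of the formal variable that belongs to the curve D_i. *)
Definition erk i : 'I_#|E3 (KS v)| := enum_rank_in (edge_E3 i) (edge i).

Lemma erkK i : enum_val (erk i) = edge i.
Proof. by rewrite enum_rankK_in // edge_E3. Qed.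

Lemma erk_inj : injective erk.
Proof. by move=> i j E; apply: edge_inj; rewrite -!erkK E. Qed.

Lemma erk_surj j : exists i, erk i = j.
Proof.
have [i iE] := E3_edge (enum_valP j); exists i.
by apply: enum_val_inj; rewrite erkK.
Qed.

Lemma erk_bij : bijective erk.
Proof.
apply: inj_card_bij erk_inj _; rewrite !card_ord.
suff -> : #|E3 (KS v)| = #|[set edge i | i : 'I_n]%SET| by rewrite card_imset ?card_ord //; exact: edge_inj.
by apply: eq_card => e; rewrite E3_KS.
Qed.

Lemma surf_intii i : surf_int v i i = - det2 (v (ord_pred i)) (v (ordS i)).
Proof. by rewrite /surf_int eqxx eq_sym (negPf (ordS_neq i)) mul1r add0r. Qed.

Lemma sum_surf_int i : \sum_j surf_int v i j = 2 + surf_int v i i.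
Proof.
rewrite surf_intii /surf_int sumrB big_split /= -mulr_suml.
have sum1 (k : 'I_n) : \sum_j (j == k)%:R = 1%R :> int.
  by rewrite (bigD1 k) //= eqxx big1 ?addr0 // => j /negPf->.
have sum1' (k : 'I_n) : \sum_j (k == j)%:R = 1%R :> int.
  by under eq_bigr do rewrite eq_sym; exact: sum1.
rewrite sum1 sum1' mul1r (_ : \sum_j (i == ordS j)%:R = 1) //.
rewrite -[RHS](sum1 (ord_pred i)); apply: eq_bigr => j _; congr _%:R; congr nat_of_bool.
by apply/eqP/eqP => [->|->]; rewrite ?ordSK ?ord_predK.
Qed.

(** The zero section meets the curve in K_S . D_i = -2 - D_i^2, by adjunction, and the divisor of
    v_i meets it in D_i^2. The framing is half the difference, with the sign given by the
    direction. *)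
Lemma framing_KS (o : direction (KS v)) i :
  framing o (edge i) = if o (edge i) then -1 - surf_int v i i else 1 + surf_int v i i.
Proof.
have c0 : @curve (KS v) (edge i) 0 ord0 = - 2 - surf_int v i i.
  by rewrite curve_KS // mxE unlift_none sum_surf_int opprD.
have ci : @curve (KS v) (edge i) 0 (lift ord0 i) = surf_int v i i.
  by rewrite curve_KS // mxE liftK.
rewrite /framing /directed; case: (o (edge i)); rewrite /edge /flip /= -/(edge i) c0 ci.
  by rewrite (_ : _ - _ = (-1 - surf_int v i i) * 2) ?mulzK //; lia.
by rewrite (_ : _ - _ = (1 + surf_int v i i) * 2) ?mulzK //; lia.
Qed.

End CanonicalBundle.

Section SurfacePartition.
Variable n : nat.
Implicit Types (c : 'I_n -> int) (l : {ffun 'I_n -> part}) (f : 'I_n -> nat).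

(** Here c is the self-intersection of the curve, and the edge is directed so that its framing is -1
    - c. *)
Definition edge_weight (c : int) (la : part) : ratfun :=
  (-1) ^ ((psize la)%:Z * (- c)) * qhalf ^ (kappa la * (-1 - c)).

Definition surf_weight c l : ratfun :=
  (\prod_i edge_weight (c i) (l i)) *
  \prod_i vertexC (l i) part0 (conj_part (l (ordS i))).

Definition surf_Z c f : ratfun :=
  \sum_(l \in [set l : {ffun 'I_n -> part} | forall i, psize (l i) = f i]) surf_weight c l.

End SurfacePartition.

Section ZcoefKS.
Variables (n : nat) (v : 'I_n -> int * int).
Hypothesis smv : smooth_rays v.
Variable o : direction (KS v).
Notation ray := 'I_n.+1.

(* Makes the label seen from the triangle with side [edge i] independent of [o]. *)
Definition twist (e : ray * ray) (la : part) := if o e then la else conj_part la.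

Lemma twistK e : involutive (twist e).
Proof. by move=> la; rewrite /twist; case: (o e) => //; rewrite conj_partK. Qed.

Lemma psize_twist e la : psize (twist e la) = psize la.
Proof. by rewrite /twist; case: (o e) => //; rewrite psize_conj. Qed.

Definition labels (l : {ffun 'I_n -> part}) : {ffun ray * ray -> part} :=
  [ffun e => if [pick i | e == edge i] is Some i then twist e (l i) else part0].

Lemma labels_edge l i : labels l (edge i) = twist (edge i) (l i).
Proof.
rewrite ffunE; case: pickP => [j /eqP/edge_inj <- //|/(_ i)].
by rewrite eqxx.
Qed.

Lemma labels_out l e : e \notin E3 (KS v) -> labels l e = part0.
Proof.
rewrite E3_KS // ffunE; case: pickP => // i /eqP -> /negP[].
by apply/imsetP; exists i.
Qed.

Lemma leg_edge l i : leg o (labels l) (edge i) = l i.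
Proof.
rewrite /leg /= /directed -/(edge i) labels_edge /twist.
case: (o (edge i)); rewrite ?eqxx ?conj_partK //.
Qed.

Lemma leg_flip l i : leg o (labels l) (lift ord0 i, ord0) = conj_part (l i).
Proof.
rewrite /leg /= /flip /= -/(edge i) /directed labels_edge /twist.
by case: (o (edge i)); rewrite /flip /= ?eqxx // [_ == _]/(_ == _) /=.
Qed.

Lemma leg_outer l i j : leg o (labels l) (lift ord0 i, lift ord0 j) = part0.
Proof.
have H a b : labels l (lift ord0 a, lift ord0 b) = part0.
  apply: labels_out; rewrite E3_KS //; apply/imsetP => -[m _].
  by case.
by rewrite /leg; do 2 case: ifP => _; rewrite ?H ?conj_part0.
Qed.

(** Reversing an edge negates both its framing and the kappa of its label, and it changes the
    exponent of the sign by an even number. *)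
Lemma weight_labels l : weight o (labels l) = surf_weight (fun i => surf_int v i i) l.
Proof.
rewrite /weight /surf_weight; congr (_ * _).
  rewrite E3_KS // big_imset /=; last by move=> i j _ _; exact: edge_inj.
  apply: eq_big => [//|i _]; rewrite labels_edge psize_twist framing_KS // /edge_weight /twist.
  case: (o (edge i)); first by congr (_ ^ _ * _ ^ _); lia.
  congr (_ * _ ^ _); last by rewrite kappa_conj; lia.
  rewrite -[RHS](sign_exprz _ _ ((psize (l i))%:Z * (1 + surf_int v i i))).
  by congr (_ ^ _); ring.
rewrite /= big_imset /=; last by move=> i j _ _ /(congr1 (fun s => s.1.2)) /= /lift_inj.
by apply: eq_big => [//|i _]; rewrite leg_flip leg_outer -/(edge i) leg_edge.
Qed.

Lemma Zcoef_KS (d : 'X_{1..#|E3 (KS v)|}) :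
  Zcoef o d = surf_Z (fun i => surf_int v i i) (fun i => d (erk smv i)).
Proof.
rewrite /Zcoef /surf_Z.
rewrite (reindex_fsbig labels [set l : {ffun 'I_n -> part} | forall i, psize (l i) = d (erk smv i)]).
  by apply: eq_fsbigr => l _; exact: weight_labels.
split.
- move=> l /= sz; split; first by move=> e; exact: labels_out.
  move=> j; have [i <-] := erk_surj smv j.
  by rewrite erkK labels_edge psize_twist sz.
- move=> l l' _ _ E; apply/ffunP => i.
  by have := congr1 (fun la : {ffun ray * ray -> part} => la (edge i)) E;
    rewrite !labels_edge => /(inv_inj (twistK _)).
- move=> la /= [out sz]; exists [ffun i => twist (edge i) (la (edge i))].
    by move=> i /=; rewrite ffunE psize_twist -sz erkK.
  apply/ffunP => e; case: (boolP (e \in E3 (KS v))) => [|eE]; last by rewrite labels_out // out.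
  by rewrite E3_KS // => /imsetP[i _ ->]; rewrite labels_edge ffunE twistK.
Qed.

End ZcoefKS.

(** * The partition function of the blowup *)

Lemma finite_labels n (f : 'I_n -> nat) :
  finite_set [set l : {ffun 'I_n -> part} | forall i, psize (l i) = f i].
Proof.
pose M := (\sum_i f i).+1.
apply: (@sub_finite_set _ _ [set` [seq [ffun i => nth part0 (partslt M) (g i)] |
   g : {ffun 'I_n -> 'I_(size (partslt M))}]]); last exact: finite_seq.
move=> l /= sz; have lt i : (index (l i) (partslt M) < size (partslt M))%N.
  by rewrite index_mem mem_partslt sz ltnS (bigD1 i) //= leq_addr.
apply/mapP; exists [ffun i => Ordinal (lt i)]; first by rewrite mem_enum.
apply/ffunP => i; rewrite !ffunE /= nth_index // mem_partslt sz ltnS (bigD1 i) //=.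
exact: leq_addr.
Qed.

Lemma exprz_split (F : fieldType) (s q : F) (a b c d : int) : s != 0 -> q != 0 ->
  s ^ (a + b) * q ^ (c + d) = s ^ a * q ^ c * (s ^ b * q ^ d).
Proof. by move=> s0 q0; rewrite !expfzDr // mulrACA. Qed.

Lemma oppr1_neq0 (F : fieldType) : (-1 : F) != 0.
Proof. by rewrite oppr_eq0 oner_eq0. Qed.

Lemma sign_framing_cancel (F : fieldType) (q : F) (a b : nat) (x y : int) (A B V : F) : q != 0 ->
  A * ((-1) ^+ a * q ^ x * ((-1) ^+ b * q ^ y)) * B *
    ((-1) ^+ (a + b) * (q ^ (- y - x) * V)) = A * (V * B).
Proof.
move=> q0; have E1 : ((-1) ^+ a * (-1) ^+ b) * (-1) ^+ (a + b) = 1 :> F.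
  by rewrite -!exprD addnn -mul2n exprM sqrrN !expr1n.
have E2 : (q ^ x * q ^ y) * q ^ (- y - x) = 1.
  by rewrite -!expfzDr // (_ : x + y + (- y - x) = 0) //; ring.
move: ((-1) ^+ a) ((-1) ^+ b) ((-1) ^+ (a + b)) (q ^ x) (q ^ y) (q ^ (- y - x)) E1 E2.
move=> s1 s2 s3 q1 q2 q3 E1 E2.
transitivity ((s1 * s2 * s3) * (q1 * q2 * q3) * (A * (V * B))); first by ring.
by rewrite E1 E2 !mul1r.
Qed.

Lemma edge_weight_sub x y la : edge_weight (x - y) la =
  edge_weight x la * ((-1) ^ ((psize la)%:Z * y) * qhalf ^ (kappa la * y)).
Proof.
rewrite /edge_weight.
have -> : (psize la)%:Z * (- (x - y)) = (psize la)%:Z * (- x) + (psize la)%:Z * y by ring.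
have -> : kappa la * (-1 - (x - y)) = kappa la * (-1 - x) + kappa la * y by ring.
exact: exprz_split (oppr1_neq0 _) qhalf_neq0.
Qed.

Lemma edge_weight_sub1 x la : edge_weight (x - 1) la =
  edge_weight x la * ((-1) ^+ psize la * qhalf ^ kappa la).
Proof. by rewrite edge_weight_sub !mulr1. Qed.

Section BlowupPartition.
Variables (n : nat) (k : 'I_n) (c : 'I_n -> int) (ch : 'I_n.+1 -> int).
Hypothesis kS : ordS k != k.
Hypothesis ch_exc : ch (exc k) = -1.
Hypothesis ch_lift : forall i, ch (lift (exc k) i) = c i - (i == k)%:R - (i == ordS k)%:R.

Variables (zeta : nat -> ratfun) (p : part -> part -> {poly ratfun}).
Hypothesis zetaE : forall al be m,
  \sum_(eta <- partsn m) vertexC al part0 (conj_part eta) * vertexC eta part0 be =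
  \sum_(i < m.+1) (p al be)`_i * zeta (m - i)%N.
Hypothesis p_small : forall al be i, (psize al + psize be < i)%N -> (p al be)`_i = 0.
Hypothesis p_top : forall al be, (p al be)`_(psize al + psize be) =
  qhalf ^ (kappa be - kappa al) * vertexC al part0 be.

Implicit Types (l : {ffun 'I_n -> part}) (f : 'I_n -> nat) (eta : part).

Definition glue (x : {ffun 'I_n -> part} * part) : {ffun 'I_n.+1 -> part} :=
  [ffun j => if unlift (exc k) j is Some i then x.1 i else x.2].

Lemma glue_exc x : glue x (exc k) = x.2.
Proof. by rewrite ffunE unlift_none. Qed.

Lemma glue_lift x i : glue x (lift (exc k) i) = x.1 i.
Proof. by rewrite ffunE liftK. Qed.

Definition rest_weight l : ratfun :=
  (\prod_i edge_weight (ch (lift (exc k) i)) (l i)) *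
  \prod_(i | i != k) vertexC (l i) part0 (conj_part (l (ordS i))).

(** E has self-intersection -1, hence framing 0, and its edge contributes a sign only. *)
Lemma surf_weight_glue l eta : surf_weight ch (glue (l, eta)) =
  rest_weight l * ((-1) ^+ psize eta *
    (vertexC (l k) part0 (conj_part eta) * vertexC eta part0 (conj_part (l (ordS k))))).
Proof.
rewrite /surf_weight (bigD1_ord (exc k)) //= glue_exc.
rewrite [X in _ * X](bigD1_ord (exc k)) //= glue_exc ordS_exc glue_lift.
rewrite [X in _ * (_ * X)](bigD1 k) //= glue_lift ordS_lift_exc eqxx glue_exc.
have -> : edge_weight (ch (exc k)) eta = (-1) ^+ psize eta.
  by rewrite /edge_weight ch_exc opprK mulr1 subrr mulr0 expr0z mulr1.
rewrite /rest_weight.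
have -> : \prod_(i < n) edge_weight (ch (lift (exc k) i)) (glue (l, eta) (lift (exc k) i)) =
          \prod_(i < n) edge_weight (ch (lift (exc k) i)) (l i).
  by apply: eq_bigr => i _; rewrite glue_lift.
have -> : \prod_(i < n | i != k) vertexC (glue (l, eta) (lift (exc k) i)) part0
     (conj_part (glue (l, eta) (ordS (lift (exc k) i)))) =
   \prod_(i < n | i != k) vertexC (l i) part0 (conj_part (l (ordS i))).
  by apply: eq_bigr => i ik; rewrite ordS_lift_exc (negPf ik) !glue_lift.
have gen (R : comNzRingType) (a b s x y : R) : s * a * (y * (x * b)) = a * b * (s * (x * y)) by ring.
exact: gen.
Qed.

(* Coefficients, with respect to the variable of the exceptional curve, of the
   quotient of the partition function by that of the conifold. *)
Definition resid f j : ratfun :=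
  \sum_(l \in [set l : {ffun 'I_n -> part} | forall i, psize (l i) = f i])
    rest_weight l * ((-1) ^+ j * (p (l k) (conj_part (l (ordS k))))`_j).

(** The sum over the label of E is evaluated first, by [zetaE]; the sign (-1)^m is then shared
    between the two factors of the convolution. *)
Lemma surf_Z_blowup (fh : 'I_n.+1 -> nat) :
  surf_Z ch fh = \sum_(i < (fh (exc k)).+1)
    ((-1) ^+ (fh (exc k) - i) * zeta (fh (exc k) - i)%N) *
      resid (fun i => fh (lift (exc k) i)) i.
Proof.
set m := fh (exc k); pose f (i : 'I_n) := fh (lift (exc k) i); rewrite -/f.
rewrite /surf_Z.
rewrite (reindex_fsbig glue ([set l : {ffun 'I_n -> part} | forall i, psize (l i) = f i] `*`
   [set` partsn m])); last first.
  split.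
  - move=> [l eta] /= [sz]; rewrite mem_partsn => /eqP etam j.
    by case: (unliftP (exc k) j) => [i|] ->; rewrite ?glue_lift ?glue_exc /= ?sz.
  - move=> [l eta] [l' eta'] _ _ E.
    have := congr1 (fun g : {ffun 'I_n.+1 -> part} => g (exc k)) E.
    rewrite !glue_exc /= => ->; congr pair; apply/ffunP => i.
    have := congr1 (fun g : {ffun 'I_n.+1 -> part} => g (lift (exc k) i)) E.
    by rewrite !glue_lift.
  - move=> g /= sz; exists ([ffun i => g (lift (exc k) i)], g (exc k)) => /=.
      by split; [move=> i; rewrite ffunE sz | rewrite mem_partsn sz].
    apply/ffunP => j; case: (unliftP (exc k) j) => [i|] ->; rewrite ?glue_lift ?glue_exc //=.
    by rewrite ffunE.
rewrite -(pair_fsbig _ (fun l eta => surf_weight ch (glue (l, eta)))) //; last first.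
- exact: finite_seq.
- exact: finite_labels.
under eq_fsbigr => l _.
  rewrite -fsbig_seq ?partsn_uniq //.
  rewrite (eq_big_seq (fun eta => rest_weight l * (-1) ^+ m *
     (vertexC (l k) part0 (conj_part eta) * vertexC eta part0 (conj_part (l (ordS k)))))); last first.
    by move=> eta; rewrite mem_partsn => /eqP etam; rewrite surf_weight_glue etam -mulrA.
  rewrite -mulr_sumr zetaE mulr_sumr.
  over.
rewrite fsbig_finite; last exact: finite_labels.
rewrite exchange_big /=; apply: eq_bigr => i _.
rewrite /resid mulr_fsumr fsbig_finite; last exact: finite_labels.
apply: eq_bigr => l _.
have -> : (-1) ^+ m = (-1) ^+ (m - i) * (-1) ^+ i :> ratfun.
  by rewrite -exprD subnK // -ltnS.
have gen (R : comNzRingType) (a b s t u : R) : a * (t * s) * (b * u) = t * u * (a * (s * b)) by ring.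
exact: gen.
Qed.

Lemma resid_small f j : (f k + f (ordS k) < j)%N -> resid f j = 0.
Proof.
move=> lt; apply: fsbig1 => l /= sz.
by rewrite p_small ?mulr0 // psize_conj !sz.
Qed.

(** The blowup lowers the self-intersections of D_k and D_(k+1) by one, which multiplies their edge
    weights by (-1)^|l| q^(kappa(l)/2). These factors cancel against (-1)^j and the power of q in
    the leading coefficient of p, and the vertex of K_S for the cone of v_k and v_(k+1) remains. *)
Lemma resid_top f : resid f (f k + f (ordS k))%N = surf_Z c f.
Proof.
apply: eq_fsbigr => l /set_mem /= sz.
have -> : (f k + f (ordS k))%N = (psize (l k) + psize (conj_part (l (ordS k))))%N.
  by rewrite psize_conj !sz.
rewrite p_top psize_conj kappa_conj /rest_weight /surf_weight.
rewrite [in RHS](bigD1 k (P := xpredT) (F := fun i => vertexC (l i) part0 _)) //=.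
have -> : \prod_i edge_weight (ch (lift (exc k) i)) (l i) =
  (\prod_i edge_weight (c i) (l i)) *
   (((-1) ^+ psize (l k) * qhalf ^ kappa (l k)) *
    ((-1) ^+ psize (l (ordS k)) * qhalf ^ kappa (l (ordS k)))).
  have gen (R : comNzRingType) (a b s t u : R) : a * s * (b * t * u) = a * (b * u) * (s * t) by ring.
  rewrite (bigD1 k) //= (bigD1 (ordS k)) //=.
  rewrite [X in _ = X * _](bigD1 k) //= [X in _ = (_ * X) * _](bigD1 (ordS k)) //=.
  have -> : ch (lift (exc k) k) = c k - 1 by rewrite ch_lift eqxx eq_sym (negPf kS) subr0.
  have -> : ch (lift (exc k) (ordS k)) = c (ordS k) - 1 by rewrite ch_lift eqxx (negPf kS) subr0.
  rewrite !edge_weight_sub1 (eq_bigr (fun i => edge_weight (c i) (l i))) ; first exact: gen.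
  by move=> i /andP[/negPf ik /negPf iS]; rewrite ch_lift ik iS !subr0.
exact: sign_framing_cancel qhalf_neq0.
Qed.

End BlowupPartition.

Section Monomials.
Variables (n : nat) (v : 'I_n -> int * int).
Hypothesis smv : smooth_rays v.
Notation mono := 'X_{1..#|E3 (KS v)|}.
Local Notation erk := (erk smv).

Definition mkmono (f : 'I_n -> nat) : mono := (\sum_i U_(erk i) *+ f i)%MM.

Lemma mkmonoE f i : mkmono f (erk i) = f i.
Proof.
rewrite mnm_sumE (bigD1 i) //= mulmnE mnm1E eqxx mul1n big1 ?addn0 // => j ne.
by rewrite mulmnE mnm1E (inj_eq (@erk_inj _ _ smv)) (negPf ne).
Qed.

Lemma mono_ext (d e : mono) : (forall i, d (erk i) = e (erk i)) -> d = e.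
Proof. by move=> E; apply/mnmP => j; have [i <-] := erk_surj smv j. Qed.

Lemma mdeg_erk (d : mono) : mdeg d = (\sum_i d (erk i))%N.
Proof. by rewrite mdegE (reindex erk) //=; apply: onW_bij; exact: erk_bij. Qed.

End Monomials.

(** * Supports of the logarithm on the blowup *)

Section BlowupLog.
Variables (n : nat) (v : 'I_n -> int * int) (k : 'I_n).
Hypothesis smv : smooth_rays v.
Let smh := smooth_blowup k smv.
Variables (o : direction (KS v)) (oh : direction (KS (blowup v k))).
Notation monoh := 'X_{1..#|E3 (KS (blowup v k))|}.
Notation mono := 'X_{1..#|E3 (KS v)|}.
Local Notation er := (erk smv).
Local Notation erh := (erk smh).

Lemma surf_int_exc : surf_int (blowup v k) (exc k) (exc k) = -1.
Proof.
rewrite (surf_intii smh) ordS_exc.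
have -> : ord_pred (exc k) = lift (exc k) k.
  by apply: ordS_inj; rewrite ord_predK ordS_lift_exc eqxx.
by rewrite /blowup !liftK smv.
Qed.

Lemma surf_int_lift i : surf_int (blowup v k) (lift (exc k) i) (lift (exc k) i) =
  surf_int v i i - (i == k)%:R - (i == ordS k)%:R.
Proof.
have kS := ordS_neq smv k.
have det2Dl (x y w : int * int) : det2 (x + y) w = det2 x w + det2 y w.
  by rewrite /det2 /=; ring.
have det2Dr (x y w : int * int) : det2 w (x + y) = det2 w x + det2 w y.
  by rewrite /det2 /=; ring.
have predE : ord_pred (lift (exc k) i) = if i == ordS k then exc k else lift (exc k) (ord_pred i).
  apply: ordS_inj; rewrite ord_predK; case: eqVneq => [->|ne]; first by rewrite ordS_exc.
  rewrite ordS_lift_exc (_ : (ord_pred i == k) = false) ?ord_predK //.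
  by apply/negbTE; apply: contra ne => /eqP <-; rewrite ord_predK.
rewrite (surf_intii smh) (surf_intii smv) predE ordS_lift_exc.
case: (eqVneq i k) => [->|ik].
  rewrite eq_sym (negPf kS) subr0 /blowup !liftK unlift_none det2Dr.
  by have := smv (ord_pred k); rewrite ord_predK => ->; rewrite opprD addrC.
case: (eqVneq i (ordS k)) => [->|iS].
  by rewrite subr0 /blowup !liftK unlift_none det2Dl ordSK smv opprD.
by rewrite /blowup !liftK !subr0.
Qed.

Variables (zeta : nat -> ratfun) (p : part -> part -> {poly ratfun}).
Hypothesis zetaE : forall al be m,
  \sum_(eta <- partsn m) vertexC al part0 (conj_part eta) * vertexC eta part0 be =
  \sum_(i < m.+1) (p al be)`_i * zeta (m - i)%N.
Hypothesis p_small : forall al be i, (psize al + psize be < i)%N -> (p al be)`_i = 0.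
Hypothesis p_top : forall al be, (p al be)`_(psize al + psize be) =
  qhalf ^ (kappa be - kappa al) * vertexC al part0 be.
Hypothesis V0 : vertexC part0 part0 part0 = 1.
Hypothesis zeta0E : forall m, zeta m =
  \sum_(eta <- partsn m) vertexC part0 part0 (conj_part eta) * vertexC eta part0 part0.

Let cs i := surf_int v i i.
Let ch j := surf_int (blowup v k) j j.

Definition exceptional (d : monoh) : bool := [forall i, d (erh (lift (exc k) i)) == 0%N].

Definition zeta_sgn m : ratfun := (-1) ^+ m * zeta m.

(** The factor Zc(Q_E), as a series in all variables; [Zres] below is the factor Z'. *)
Definition Zexc (d : monoh) : ratfun :=
  if exceptional d then zeta_sgn (d (erh (exc k))) else 0.

Definition Zres (d : monoh) : ratfun :=
  resid k ch p (fun i => d (erh (lift (exc k) i))) (d (erh (exc k))).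

Lemma mono_blowup_ext (d e : monoh) :
  (forall i, d (erh (lift (exc k) i)) = e (erh (lift (exc k) i))) ->
  d (erh (exc k)) = e (erh (exc k)) -> d = e.
Proof.
by move=> El Ee; apply: mono_ext => j; case: (unliftP (exc k) j) => [i|] ->.
Qed.

Definition emono m : monoh := mkmono smh (fun j => if j == exc k then m else 0%N).

Lemma emono_exc m : emono m (erh (exc k)) = m.
Proof. by rewrite mkmonoE eqxx. Qed.

Lemma emono_lift m i : emono m (erh (lift (exc k) i)) = 0%N.
Proof. by rewrite mkmonoE eq_sym (negPf (neq_lift _ _)). Qed.

Lemma exceptionalP (d : monoh) : reflect (d = emono (d (erh (exc k)))) (exceptional d).
Proof.
apply: (iffP forallP) => [H|-> i]; last by rewrite emono_lift.
by apply: mono_blowup_ext => [i|]; rewrite ?emono_exc // emono_lift; apply/eqP/H.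
Qed.

(** [Zexc] is supported on the multiples of E, so the product of series reduces to the one-variable
    convolution of [surf_Z_blowup]. *)
Lemma Zcoef_blowup N :
  eqm N (trunc N (Zcoef oh)) (trunc N Zexc * trunc N Zres).
Proof.
move=> d lt; rewrite mcoeff_trunc // mcoeffM_pairs (Zcoef_KS smh).
rewrite (surf_Z_blowup (ch := ch) surf_int_exc zetaE).
set m := d _.
have le_m i : (i <= m)%N -> (emono i + (d - emono i))%MM = d.
  move=> im; apply: mono_blowup_ext => [j|]; rewrite mnmDE mnmBE ?emono_lift ?emono_exc ?subn0 //.
  exact: subnKC.
(* The pairs that can contribute; i is the exceptional degree left to [Zres]. *)
pose P i := (emono (m - i), (d - emono (m - i))%MM).
have [r rE] : exists r, r = map P (iota 0 m.+1) by eexists.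
rewrite [RHS](bigID (fun x => x \in r)) /= [X in _ + X]big1_seq ?addr0; last first.
  move=> x /andP[nP]; rewrite mem_mnm_pairs => /eqP dE.
  have lt1 : (mdeg x.1 < N)%N by apply: leq_ltn_trans lt; rewrite dE mdegD leq_addr.
  rewrite (mcoeff_trunc _ lt1) /Zexc;
    case: (boolP (exceptional x.1)) => [/exceptionalP E|_]; last by rewrite mul0r.
  case/negP: nP; rewrite rE; apply/mapP; exists (m - x.1 (erh (exc k)))%N; first by rewrite mem_iota ltnS leq_subr.
  have xm : (x.1 (erh (exc k)) <= m)%N by rewrite /m dE mnmDE leq_addr.
  rewrite /P subKn // -E; case: x dE {lt1 E xm} => a b /= ->; congr pair.
  by rewrite addmC addmK.
rewrite -[RHS]big_filter (perm_big r) /=; last first.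
  apply: uniq_perm; rewrite ?filter_uniq ?mnm_pairs_uniq //.
    rewrite rE map_inj_in_uniq ?iota_uniq // => i j; rewrite !mem_iota !ltnS /= => im jm.
    by move=> /(congr1 (fun x : monoh * monoh => x.1 (erh (exc k)))); rewrite /= !emono_exc; lia.
  move=> x; rewrite mem_filter; case: (boolP (x \in r)) => // xr; rewrite mem_mnm_pairs.
  have /mapP[i _ ->] : x \in map P (iota 0 m.+1) by rewrite -rE.
  by rewrite /= le_m ?leq_subr ?eqxx.
rewrite rE big_map -[iota 0 m.+1]/(index_iota 0 m.+1) big_mkord; apply: eq_bigr => i _.
have im : (i <= m)%N by rewrite -ltnS.
have dE := le_m _ (leq_subr i m).
have [lt1 lt2] : (mdeg (emono (m - i)) < N)%N /\ (mdeg (d - emono (m - i))%MM < N)%N.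
  by split; apply: leq_ltn_trans lt; rewrite -[X in (_ <= mdeg X)%N]dE mdegD ?leq_addr ?leq_addl.
rewrite /P !mcoeff_trunc // /Zexc ifT; last by apply/exceptionalP; rewrite emono_exc.
rewrite emono_exc; congr (_ * _); rewrite /Zres mnmBE emono_exc subKn //.
by congr (resid _ _ _ _ _); apply/funext => j; rewrite mnmBE emono_lift subn0.
Qed.

Lemma surf_Z0 m (cc : 'I_m -> int) : surf_Z cc (fun=> 0%N) = 1.
Proof.
rewrite /surf_Z.
rewrite (_ : [set l : {ffun 'I_m -> part} | forall i, psize (l i) = 0%N] = [set [ffun=> part0]]).
  rewrite fsbig_set1 /surf_weight !big1 ?mulr1 // => i _; rewrite !ffunE.
    by rewrite conj_part0 V0.
  by rewrite /edge_weight /kappa psize0 big_ord0 !mul0r !expr0z mulr1.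
apply/seteqP; split=> l /=.
  by move=> sz; apply/ffunP => i; rewrite ffunE; exact: psize_eq0.
by move=> -> i; rewrite ffunE.
Qed.

Lemma zeta_0 : zeta 0%N = 1.
Proof. by rewrite zeta0E partsn0 big_seq1 conj_part0 V0 mulr1. Qed.

Lemma Zcoef_KS0 m (w : 'I_m -> int * int) (smw : smooth_rays w) (o' : direction (KS w)) :
  Zcoef o' 0%MM = 1.
Proof.
rewrite (Zcoef_KS smw) -[RHS](surf_Z0 (fun i => surf_int w i i)); congr surf_Z.
by apply/funext => i; rewrite mnm0E.
Qed.

Lemma Zexc0 : Zexc 0%MM = 1.
Proof.
rewrite /Zexc ifT; last by apply/forallP => i; rewrite mnm0E.
by rewrite mnm0E /zeta_sgn expr0 mul1r zeta_0.
Qed.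

Lemma Zres_edge (d : monoh) :
  d (erh (exc k)) = (d (erh (lift (exc k) k)) + d (erh (lift (exc k) (ordS k))))%N ->
  Zres d = surf_Z cs (fun i => d (erh (lift (exc k) i))).
Proof.
move=> E; rewrite /Zres E.
by rewrite (resid_top (c := cs) (ordS_neq smv k) surf_int_lift p_top (fun i => d (erh (lift (exc k) i)))).
Qed.

Lemma Zres0 : Zres 0%MM = 1.
Proof.
rewrite Zres_edge ?mnm0E // -[RHS](surf_Z0 cs); congr surf_Z.
by apply/funext => i; rewrite mnm0E.
Qed.

Lemma log_blowup d : log_coef (Zcoef oh) d = lcoef Zexc d + lcoef Zres d.
Proof.
rewrite log_coefE; apply: (lcoef_mul natr_ratfun_neq0).
- exact: (Zcoef_KS0 smh).
- exact: Zexc0.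
- exact: Zres0.
- exact: Zcoef_blowup.
Qed.

Lemma lcoef_Zexc_supp d : ~~ exceptional d -> lcoef Zexc d = 0.
Proof.
move=> nd; apply: (@lcoef_supp _ _ exceptional); rewrite ?Zexc0 //.
- by apply/forallP => i; rewrite mnm0E.
- move=> a b /forallP Ha /forallP Hb; apply/forallP => i.
  by rewrite mnmDE (eqP (Ha i)) (eqP (Hb i)).
- by move=> e /negP/negbTE ne; rewrite /Zexc ne.
- exact/negP.
Qed.

(* d.E >= 0, see [dot_exc_mono_row]. *)
Definition nonneg (d : monoh) : Prop :=
  (d (erh (exc k)) <= d (erh (lift (exc k) k)) + d (erh (lift (exc k) (ordS k))))%N.

Lemma nonneg0 : nonneg 0%MM. Proof. by rewrite /nonneg !mnm0E. Qed.

Lemma nonnegD a b : nonneg a -> nonneg b -> nonneg (a + b)%MM.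
Proof. by rewrite /nonneg !mnmDE; lia. Qed.

Lemma Zres_supp d : ~ nonneg d -> Zres d = 0.
Proof. by rewrite /nonneg => nd; apply: (resid_small _ p_small); lia. Qed.

Lemma lcoef_Zres_supp d : ~ nonneg d -> lcoef Zres d = 0.
Proof.
by apply: (@lcoef_supp _ _ nonneg); [exact: Zres0 | exact: nonneg0 | exact: nonnegD | exact: Zres_supp].
Qed.

(** The total transform of the cycle: the multiplicity of E is the one that makes the intersection
    number with E zero. *)
Definition lift_mono (d : mono) : monoh := mkmono smh
  (fun j => if unlift (exc k) j is Some i then d (er i) else d (er k) + d (er (ordS k)))%N.

Lemma lift_mono_lift d i : lift_mono d (erh (lift (exc k) i)) = d (er i).
Proof. by rewrite mkmonoE liftK. Qed.

Lemma lift_mono_exc d : lift_mono d (erh (exc k)) = (d (er k) + d (er (ordS k)))%N.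
Proof. by rewrite mkmonoE unlift_none. Qed.

Lemma lift_mono_surj (e : monoh) :
  e (erh (exc k)) = (e (erh (lift (exc k) k)) + e (erh (lift (exc k) (ordS k))))%N ->
  e = lift_mono (mkmono smv (fun i => e (erh (lift (exc k) i)))).
Proof.
move=> E; apply: mono_blowup_ext => [i|]; first by rewrite lift_mono_lift mkmonoE.
by rewrite lift_mono_exc !mkmonoE.
Qed.

(** The exponents with d.E = 0 form a face of the half-space d.E >= 0: two nonnegative numbers with
    sum 0 both vanish. The constant 3 arises because the added exceptional degree is a sum of two
    coordinates of d, each at most the degree of d. *)
Lemma lcoef_Zres_lift d : lcoef Zres (lift_mono d) = log_coef (Zcoef o) d.
Proof.
rewrite log_coefE; apply: (@lcoef_face _ _ _ lift_mono nonneg 3).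
- exact: Zres0.
- exact: (Zcoef_KS0 smv).
- exact: nonneg0.
- exact: nonnegD.
- exact: Zres_supp.
- move=> a b; apply: mono_blowup_ext => [i|]; rewrite mnmDE ?lift_mono_lift ?lift_mono_exc !mnmDE //.
  by rewrite addnACA.
- move=> a b E; apply: (mono_ext (smv := smv)) => i.
  by rewrite -!lift_mono_lift E.
- by apply: mono_blowup_ext => [i|]; rewrite ?lift_mono_lift ?lift_mono_exc !mnm0E.
- move=> e; rewrite (mdeg_erk smh) (mdeg_erk smv) (bigD1_ord (exc k)) //= lift_mono_exc.
  under eq_bigr do rewrite lift_mono_lift.
  have le i : (e (er i) <= \sum_i e (er i))%N by rewrite (bigD1 i) //= leq_addr.
  have := leq_add (le k) (le (ordS k)); move: (e (er k) + _)%N => a.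
  by rewrite -/n => h; rewrite mulSn addnC leq_add2l (leq_trans h) // mul2n addnn.
- move=> a b e; rewrite /nonneg => Ha Hb abE.
  have E j : (a (erh j) + b (erh j))%N = lift_mono e (erh j) by rewrite -abE mnmDE.
  have := E (exc k); have := E (lift (exc k) k); have := E (lift (exc k) (ordS k)).
  rewrite !lift_mono_lift lift_mono_exc => E1 E2 E3.
  by do 2 eexists; split; apply: lift_mono_surj; lia.
- move=> e; rewrite Zres_edge ?lift_mono_exc ?lift_mono_lift // (Zcoef_KS smv).
  by congr surf_Z; apply/funext => i; rewrite lift_mono_lift.
Qed.

Lemma log_blowup_neg d : ~~ exceptional d -> ~ nonneg d -> log_coef (Zcoef oh) d = 0.
Proof. by move=> h1 h2; rewrite log_blowup lcoef_Zexc_supp // lcoef_Zres_supp // addr0. Qed.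

Lemma log_blowup_lift d : log_coef (Zcoef oh) (lift_mono d) = log_coef (Zcoef o) d.
Proof.
(* An exceptional exponent orthogonal to E is 0, where all logarithms vanish. *)
rewrite log_blowup lcoef_Zres_lift; case: (boolP (exceptional (lift_mono d))) => [/forallP H|nd].
  have -> : d = 0%MM.
    by apply: (mono_ext (smv := smv)) => i; rewrite mnm0E -lift_mono_lift (eqP (H i)).
  rewrite (_ : lift_mono 0 = 0%MM) ?lcoef0 ?add0r //.
  by apply: mono_blowup_ext => [i|]; rewrite ?lift_mono_lift ?lift_mono_exc !mnm0E.
by rewrite lcoef_Zexc_supp // add0r.
Qed.

(** As m E has intersection -m with E, it lies outside the support of the logarithm of [Zres]. *)
Lemma log_blowup_exc m : (0 < m)%N -> log_coef (Zcoef oh) (emono m) = lcoef Zexc (emono m).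
Proof.
move=> m0; rewrite log_blowup lcoef_Zres_supp ?addr0 //.
by rewrite /nonneg emono_exc !emono_lift; lia.
Qed.

End BlowupLog.

(** * The resolved conifold *)

Section Conifold.

Local Notation X := conifold.
Let a0 : 'I_(nrays X) := inord 0.
Let a1 : 'I_(nrays X) := inord 1.
Let a2 : 'I_(nrays X) := inord 2.
Let a3 : 'I_(nrays X) := inord 3.
Let e0 := (a0, a2).

Let v0 : val a0 = 0%N. Proof. by rewrite /= inordK. Qed.
Let v1 : val a1 = 1%N. Proof. by rewrite /= inordK. Qed.
Let v2 : val a2 = 2%N. Proof. by rewrite /= inordK. Qed.
Let v3 : val a3 = 3%N. Proof. by rewrite /= inordK. Qed.

Lemma conifold_conesE x y w : ((x, y, w) \in cones X) =
  [&& val x == 0, val y == 1 & val w == 2]%N || [&& val x == 0, val y == 2 & val w == 3]%N.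
Proof.
by rewrite !inE !xpair_eqE -!andbA -!val_eqE v0 v1 v2 v3.
Qed.

Lemma conifold_cone w : is_cone a0 a2 w = (w == a3).
Proof.
rewrite /is_cone !conifold_conesE -val_eqE v0 v2 v3.
by case: (val w) => [|[|[|[|]]]].
Qed.

Lemma conifold_cone_flip w : is_cone a2 a0 w = (w == a1).
Proof.
rewrite /is_cone !conifold_conesE -val_eqE v0 v2 v1.
by case: (val w) => [|[|[|[|]]]].
Qed.

Lemma E3_conifold : E3 X = [set e0]%SET.
Proof.
apply/setP => -[x y]; rewrite !inE /=; apply/idP/eqP => [|[-> ->]]; last first.
  rewrite /= v0 v2 /=; apply/andP; split; apply/existsP.
    by exists a3; rewrite conifold_cone.
  by exists a1; rewrite conifold_cone_flip.
case/and3P => lt /existsP[w /=]; rewrite /is_cone !conifold_conesE => H1.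
case/existsP => w' /=; rewrite /is_cone !conifold_conesE => H2.
suff [E1 E2] : val x = 0%N /\ val y = 2%N by congr pair; apply: val_inj; rewrite ?v0 ?v2.
move: H1 H2 lt; rewrite [(x < y)%N]/(val x < val y)%N.
move: (val x) (val y) (val w) (val w') => i j p q.
by move=> H1 H2 lt; split; lia.
Qed.

Lemma conifold_P1E : conifold_P1 = delta_mx 0 a3 + delta_mx 0 a1 - delta_mx 0 a0 - delta_mx 0 a2.
Proof.
rewrite /conifold_P1 /curve (eq_bigl _ _ conifold_cone) big_pred1_eq.
rewrite (eq_bigl _ _ conifold_cone_flip) big_pred1_eq /=.
have n0 : nat_of_ord a0 = 0%N := v0; have n1 : nat_of_ord a1 = 1%N := v1.
have n2 : nat_of_ord a2 = 2%N := v2; have n3 : nat_of_ord a3 = 3%N := v3.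
rewrite -/a0 -/a1 -/a2 -/a3 n0 n1 n2 n3 /=.
by rewrite (_ : det3 _ _ _ = 1) // (_ : det3 _ _ _ = 1) // !scale1r.
Qed.

(** The divisors of the two ends of the diagonal both have intersection -1 with the curve. *)
Lemma conifold_framing o : framing o e0 = 0.
Proof.
have E x : @curve X e0 0 x = (conifold_P1 : 'rV[int]_4) 0 x by [].
have h x : ((conifold_P1 : 'rV[int]_4) 0 x : int) =
    (x == a3)%:R + (x == a1)%:R - (x == a0)%:R - (x == a2)%:R.
  by rewrite conifold_P1E !mxE.
rewrite /framing /directed; case: (o e0); rewrite /e0 /flip /= -/e0 !E !h -!val_eqE v0 v1 v2 v3 /=.
  by [].
by [].
Qed.

Lemma e0_E3 : e0 \in E3 X. Proof. by rewrite E3_conifold inE. Qed.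

Definition crk : 'I_#|E3 X| := enum_rank_in e0_E3 e0.

Lemma crk_uniq j : j = crk.
Proof.
have E : enum_val j = e0.
  by have := enum_valP j; move: (enum_val j) => e; rewrite E3_conifold inE => /eqP.
by apply: enum_val_inj; rewrite E enum_rankK_in // e0_E3.
Qed.

Lemma crkK : enum_val crk = e0.
Proof. by rewrite enum_rankK_in // e0_E3. Qed.

Variable o : direction X.

Definition ctwist (la : part) := if o e0 then la else conj_part la.

Lemma ctwistK : involutive ctwist.
Proof. by move=> la; rewrite /ctwist; case: (o e0) => //; rewrite conj_partK. Qed.

Lemma psize_ctwist la : psize (ctwist la) = psize la.
Proof. by rewrite /ctwist; case: (o e0) => //; rewrite psize_conj. Qed.

Definition clabels (la : part) : {ffun 'I_(nrays X) * 'I_(nrays X) -> part} :=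
  [ffun e => if e == e0 then ctwist la else part0].

Lemma cleg0 la : leg o (clabels la) (a0, a2) = la.
Proof.
rewrite /leg /= [(a0 < a2)%N](_ : _ = true); last by rewrite -[a0 : nat]/(val a0) -[a2 : nat]/(val a2) v0 v2.
rewrite -/e0 ffunE eqxx /directed /ctwist; case: (o e0); rewrite ?eqxx //.
by rewrite /flip xpair_eqE -!val_eqE /= -[a0 : nat]/(val a0) -[a2 : nat]/(val a2) v0 v2 /= conj_partK.
Qed.

Lemma cleg1 la : leg o (clabels la) (a2, a0) = conj_part la.
Proof.
rewrite /leg /= [(a2 < a0)%N](_ : _ = false); last by rewrite -[a0 : nat]/(val a0) -[a2 : nat]/(val a2) v0 v2.
rewrite /flip /= -/e0 ffunE eqxx /directed /ctwist; case: (o e0); rewrite /flip /= ?eqxx //.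
by rewrite xpair_eqE -!val_eqE /= -[a0 : nat]/(val a0) -[a2 : nat]/(val a2) v0 v2.
Qed.

Lemma cleg_out la x y : (x, y) != e0 -> (y, x) != e0 -> leg o (clabels la) (x, y) = part0.
Proof.
move=> /negPf h1 /negPf h2; rewrite /leg.
by do 2 case: ifP => _; rewrite ffunE /flip /= ?h1 ?h2 ?conj_part0.
Qed.

Lemma weight_clabels la : weight o (clabels la) =
  (-1) ^+ psize la * (vertexC part0 part0 (conj_part la) * vertexC la part0 part0).
Proof.
have out x y : ~~ ((val x == 0%N) && (val y == 2%N)) -> ~~ ((val y == 0%N) && (val x == 2%N)) ->
    leg o (clabels la) (x, y) = part0.
  by move=> h1 h2; apply: cleg_out; rewrite xpair_eqE -!val_eqE v0 v2.
rewrite /weight E3_conifold big_set1 conifold_framing ffunE eqxx psize_ctwist.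
rewrite add0r mulr1 mulr0 expr0z mulr1; congr (_ * _).
rewrite big_setU1 /= ?big_set1 /=; last first.
  by rewrite inE !xpair_eqE -!val_eqE v0 v1 v2 v3.
rewrite -/a0 -/a1 -/a2 -/a3 cleg0 cleg1.
by rewrite !out ?v0 ?v1 ?v2 ?v3.
Qed.

Lemma Zcoef_conifold (zeta : nat -> ratfun) (d : 'X_{1..#|E3 X|}) :
  (forall m, zeta m =
    \sum_(eta <- partsn m) vertexC part0 part0 (conj_part eta) * vertexC eta part0 part0) ->
  Zcoef o d = (-1) ^+ d crk * zeta (d crk).
Proof.
move=> zE; rewrite /Zcoef (reindex_fsbig clabels [set` partsn (d crk)]).
  rewrite -fsbig_seq ?partsn_uniq // zE mulr_sumr; apply: eq_big_seq => la.
  by rewrite mem_partsn => /eqP sz; rewrite weight_clabels sz.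
split.
- move=> la /=; rewrite mem_partsn => /eqP sz; split.
    by move=> e; rewrite E3_conifold inE ffunE => /negPf ->.
  by move=> j; rewrite (crk_uniq j) crkK ffunE eqxx psize_ctwist.
- move=> la la' _ _ /(congr1 (fun l : {ffun _ -> part} => l e0)).
  by rewrite !ffunE eqxx => /(inv_inj ctwistK).
- move=> l /= [out sz]; exists (ctwist (l e0)).
    by rewrite /= mem_partsn psize_ctwist -sz crkK.
  apply/ffunP => e; rewrite ffunE ctwistK; case: eqVneq => [->//|ne].
  by rewrite out // E3_conifold inE.
Qed.

End Conifold.

(** * Laurent expansions and curve classes *)
Local Open Scope quotient_scope.

Section LaurentZero.

(* If all coefficients vanish, then so does the sum of the b_j P(x_j) for every
   polynomial P; choose P nonzero at the last x_j only. *)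
Lemma exp_coef_neq0 (b : {poly rat}) : b != 0 -> exists n : nat, exp_coef b n != 0.
Proof.
move=> b0; apply/not_existsP => H.
have {}H n : \sum_(j < size b) (ratr b`_j : CC) * ('i * j%:R / 2) ^+ n = 0.
  have := H n; move=> /negP; rewrite negbK /exp_coef => /eqP.
  rewrite -mulr_suml => /eqP; rewrite mulf_eq0 invr_eq0 pnatr_eq0 -leqn0 leqNgt fact_gt0 orbF.
  by move=> /eqP.
pose x (j : nat) : CC := 'i * j%:R / 2.
have Hp (P : {poly CC}) : \sum_(j < size b) ratr b`_j * P.[x j] = 0.
  under eq_bigr do rewrite horner_coef mulr_sumr.
  rewrite exchange_big /= big1 // => n _.
  under eq_bigr do rewrite mulrCA.
  by rewrite -mulr_sumr H mulr0.
have sb : (0 < size b)%N by rewrite size_poly_gt0.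
have lt : ((size b).-1 < size b)%N by rewrite prednK.
have x_inj : injective x.
  move=> i j; rewrite /x => /(mulIf _) E; apply/eqP; rewrite -(eqr_nat CC); apply/eqP.
  by apply: (mulfI (neq0Ci _)); apply: E; rewrite invr_eq0 pnatr_eq0.
have := Hp (\prod_(l < (size b).-1) ('X - (x l)%:P)).
rewrite (bigD1 (Ordinal lt)) //= [X in _ + X]big1 ?addr0 => [|j ne]; last first.
  have jl : (j < (size b).-1)%N.
    by have := ltn_ord j; move: ne; rewrite -val_eqE /=; lia.
  rewrite horner_prod (bigD1 (Ordinal jl)) //= hornerXsubC subrr mul0r mulr0 //.
move=> /eqP; rewrite mulf_eq0 fmorph_eq0 -/(lead_coef b) lead_coef_eq0 (negPf b0) /=.
rewrite horner_prod prodf_seq_eq0 => /hasP[l _ /=]; rewrite hornerXsubC subr_eq0 => /eqP/x_inj E.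
by have := ltn_ord l; rewrite -E ltnn.
Qed.

(** The product of the expansion of the denominator b with c is zero, while its lowest coefficient
    would be the product of their lowest coefficients. *)
Lemma is_laurent0 c : is_laurent 0 c -> c = fun=> 0.
Proof.
move=> [[m cm] [a [b [b0 ab H]]]].
have a0 : a = 0.
  apply/eqP; rewrite -tofrac_eq0; move/esym/eqP: ab.
  by rewrite mulf_eq0 invr_eq0 !tofrac_eq0 (negPf b0) orbF.
have exn k : exp_coef b (Negz k) = 0 by [].
have {}H k : \sum_(j \in [set: int]) exp_coef b j * c (k - j) = 0.
  by rewrite H a0; case: k => // n; rewrite /exp_coef size_poly0 big_ord0.
apply/funext => k0; apply/eqP; apply: contraT => ck0.
have ex1 : exists n, c (m + n%:Z) != 0.
  exists (absz (k0 - m)); rewrite (_ : m + _ = k0) //.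
  by case: (ltP k0 m) => h; [rewrite cm ?eqxx // in ck0 | lia].
have ex2 := exp_coef_neq0 b0.
pose n1 := ex_minn ex1; pose n2 := ex_minn ex2.
have [c1 min1] : c (m + n1%:Z) != 0 /\ forall n, c (m + n%:Z) != 0 -> (n1 <= n)%N.
  by rewrite /n1; case: ex_minnP.
have [e2 min2] : exp_coef b n2 != 0 /\ forall n : nat, exp_coef b n != 0 -> (n2 <= n)%N.
  by rewrite /n2; case: ex_minnP.
have := H (m + n1%:Z + n2%:Z).
rewrite (@fsum_seq _ _ _ [:: n2%:Z]) //; last first.
  move=> j _; rewrite inE => jn; apply/eqP; apply: contraNT jn; rewrite mulf_eq0 negb_or.
  case: j => j; last by rewrite exn eqxx.
  move=> /andP[/min2 le2 cj]; apply/eqP; congr Posz.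
  case: (ltP (m + n1%:Z + n2%:Z - j%:Z) m) => h; first by rewrite cm ?eqxx in cj.
  have := min1 (n1 + n2 - j)%N.
  by rewrite (_ : m + (n1 + n2 - j)%N%:Z = m + n1%:Z + n2%:Z - j%:Z) ?cj => [/(_ isT)|]; lia.
rewrite big_cons big_nil asboolT // addr0 addrK => /eqP.
by rewrite mulf_eq0 (negPf c1) (negPf e2).
Qed.

(** This serves the vanishing (i). In (ii) and (iii) the rational functions themselves agree before
    expansion. *)
Lemma laurent0 k : laurent 0 k = 0.
Proof.
rewrite /laurent; case: xgetP => [c _ Hc|//].
by rewrite (is_laurent0 Hc).
Qed.

End LaurentZero.

(** * Numerical classes on a canonical bundle *)

Section Classes.
Variables (n : nat) (v : 'I_n -> int * int).
Hypothesis smv : smooth_rays v.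

Lemma sum_surf_intl (a : 'rV[int]_n) j : \sum_i a 0 i * surf_int v i j =
  a 0 (ord_pred j) + a 0 (ordS j) - a 0 j * det2 (v (ord_pred j)) (v (ordS j)).
Proof.
have sum1 (f : 'I_n -> int) k : \sum_i f i * (i == k)%:R = f k.
  rewrite (bigD1 k) //= eqxx mulr1 big1 ?addr0 // => i /negPf->.
  by rewrite mulr0.
have eqS i : (j == ordS i) = (i == ord_pred j).
  by apply/eqP/eqP => [->|->]; rewrite ?ordSK ?ord_predK.
rewrite -(sum1 (a 0)) -(sum1 (a 0)) -big_split /=.
rewrite -(sum1 (fun i => a 0 i * det2 (v (ord_pred i)) (v (ordS i)))) -sumrB.
by apply: eq_bigr => i _; rewrite /surf_int eqS; ring.
Qed.

Lemma wall_combination (ap as_ aj D m1 m2 p1 p2 s1 s2 c1 c2 : int) :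
    ap + as_ = aj * D -> m1 * (p1 + s1) + m2 * (p2 + s2) = m1 * (c1 * D) + m2 * (c2 * D) ->
  ap - (m1 * p1 + m2 * p2) + (as_ - (m1 * s1 + m2 * s2)) = (aj - (m1 * c1 + m2 * c2)) * D.
Proof.
move=> E E2.
transitivity (ap + as_ - (m1 * (p1 + s1) + m2 * (p2 + s2))); first by ring.
by rewrite E E2; ring.
Qed.

(* After subtracting a principal divisor, [a] vanishes at two adjacent rays, and
   the wall relations propagate this around the fan. *)
Lemma numerically_trivial (a : 'rV[int]_n) :
  (forall j, \sum_i a 0 i * surf_int v i j = 0) -> a \in principal v.
Proof.
move=> H; apply/asboolP.
case: (posnP n) => [n0|n0].
  by exists (0, 0) => i; suff : false by []; have := ltn_ord i; rewrite [X in (_ < X)%N]n0.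
pose i0 : 'I_n := Ordinal n0.
pose m := (a 0 i0 * (v (ordS i0)).2 - a 0 (ordS i0) * (v i0).2,
           a 0 (ordS i0) * (v i0).1 - a 0 i0 * (v (ordS i0)).1).
exists m; pose L i := a 0 i - (m.1 * (v i).1 + m.2 * (v i).2).
have Lrec j : L (ord_pred j) + L (ordS j) = L j * det2 (v (ord_pred j)) (v (ordS j)).
  have := H j; rewrite sum_surf_intl => /eqP; rewrite subr_eq0 => /eqP E.
  have := surf_wall smv j => /(congr1 (fun x => m.1 * x.1 + m.2 * x.2)).
  rewrite mulrz_pair /= !mulrzz => E2; exact: wall_combination E E2.
have d1 := smv i0; rewrite /det2 in d1.
have L0 : L i0 = 0.
  rewrite /L /m /=; set x := a 0 i0; set y := a 0 (ordS i0).
  transitivity (x - x * ((v i0).1 * (v (ordS i0)).2 - (v i0).2 * (v (ordS i0)).1)); first by ring.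
  by rewrite d1 mulr1 subrr.
have L1 : L (ordS i0) = 0.
  rewrite /L /m /=; set x := a 0 i0; set y := a 0 (ordS i0).
  transitivity (y - y * ((v i0).1 * (v (ordS i0)).2 - (v i0).2 * (v (ordS i0)).1)); first by ring.
  by rewrite d1 mulr1 subrr.
have LL t : L (iter t (@ordS n) i0) = 0 /\ L (iter t.+1 (@ordS n) i0) = 0.
  elim: t => [|t [IH1 IH2]]; first by split.
  split=> //; have := Lrec (iter t.+1 (@ordS n) i0).
  by rewrite [ord_pred _]/= ordSK IH1 IH2 add0r mul0r.
move=> i; have -> : i = iter i (@ordS n) i0.
  apply: val_inj => /=.
  have it t : (t < n)%N -> val (iter t (@ordS n) i0) = t.
    elim: t => [//|t IH] lt /=; rewrite -[nat_of_ord _]/(val _) IH ?modn_small //; exact: ltnW.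
  by rewrite -[RHS]/(val _) it.
by apply/eqP; rewrite -subr_eq0; apply/eqP; case: (LL i).
Qed.

(** Intersecting with the divisors of the rays v_j recovers the numerical class on the surface, and
    [numerically_trivial] applies. The condition on curve classes thus becomes an equation in
    [H2]. *)
Lemma zero_section_inj : injective (@zero_section n v).
Proof.
move=> a b; rewrite -(reprK a) -(reprK b) !zero_section_pi // => E.
apply/eqP; rewrite -Quotient.idealrBE; apply: numerically_trivial => j.
have /rowP/(_ (lift ord0 j)) := E; rewrite !summxE => E'.
under eq_bigr do rewrite !mxE mulrBl.
rewrite sumrB; apply/eqP; rewrite subr_eq0; apply/eqP.
have F (x : 'rV[int]_n) : (\sum_i (@curve (KS v) (ord0, lift ord0 i) *~ x 0 i) 0 (lift ord0 j)) =
   \sum_i x 0 i * surf_int v i j.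
  apply: eq_bigr => i _; rewrite curve_KS // -scaler_int !mxE liftK intz //.
by rewrite -!F.
Qed.

Notation mono := 'X_{1..#|E3 (KS v)|}.
Local Notation er := (erk smv).

Definition mono_row (d : mono) : 'rV[int]_n := \row_i (d (er i))%:Z.

Lemma curve_classE (d : mono) : curve_class d = zero_section (\pi_(H2 v) (mono_row d)).
Proof.
rewrite zero_section_pi // /curve_class (reindex er) /=; last by apply: onW_bij; exact: erk_bij.
by apply: eq_bigr => i _; rewrite erkK mxE.
Qed.

Lemma curve_class_eq (d : mono) (beta : H2 v) :
  curve_class d = zero_section beta <-> \pi_(H2 v) (mono_row d) = beta.
Proof. by rewrite curve_classE; split=> [/zero_section_inj|->]. Qed.

End Classes.

(** * Comparison of the invariants *)

Section BlowupClasses.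
Variables (n : nat) (v : 'I_n -> int * int) (k : 'I_n).
Hypothesis smv : smooth_rays v.
Let smh := smooth_blowup k smv.
Notation monoh := 'X_{1..#|E3 (KS (blowup v k))|}.
Notation mono := 'X_{1..#|E3 (KS v)|}.
Local Notation er := (erk smv).
Local Notation erh := (erk smh).

Lemma blowup_lift i : blowup v k (lift (exc k) i) = v i.
Proof. by rewrite /blowup liftK. Qed.

Lemma ord_pred_exc : ord_pred (exc k) = lift (exc k) k.
Proof. by apply: ordS_inj; rewrite ord_predK ordS_lift_exc eqxx. Qed.

Lemma dot_exc_mono_row (d : monoh) :
  dot_exc (\pi_(H2 (blowup v k)) (mono_row smh d)) =
  (d (erh (lift (exc k) k)))%:Z + (d (erh (lift (exc k) (ordS k))))%:Z - (d (erh (exc k)))%:Z.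
Proof.
rewrite (dot_exc_pi _ _ smv) sum_surf_intl !mxE ordS_exc.
by rewrite ord_pred_exc !blowup_lift smv mulr1.
Qed.

Lemma pushforward_mono_row (d : monoh) :
  pushforward (\pi_(H2 (blowup v k)) (mono_row smh d)) =
  \pi_(H2 v) (\row_i (d (erh (lift (exc k) i)))%:Z).
Proof.
by rewrite pushforward_pi; congr (\pi _); apply/rowP => i; rewrite !mxE.
Qed.

Lemma mono_row_emono m :
  \pi_(H2 (blowup v k)) (mono_row smh (emono k smv m)) = exc_class v k *+ m.
Proof.
rewrite /exc_class -raddfMn /=; congr (\pi _); apply/rowP => j; rewrite mulmxnE !mxE mkmonoE.
by case: eqVneq; rewrite ?natz // mul0rn.
Qed.

Lemma dot_excMn m : dot_exc (exc_class v k *+ m) = - m%:Z.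
Proof. by rewrite -mono_row_emono dot_exc_mono_row emono_exc !emono_lift !add0r. Qed.

Lemma dot_exc_class (beta : H2 (blowup v k)) (d : monoh) :
  \pi_(H2 (blowup v k)) (mono_row smh d) = beta ->
  dot_exc beta = (d (erh (lift (exc k) k)))%:Z + (d (erh (lift (exc k) (ordS k))))%:Z
                 - (d (erh (exc k)))%:Z.
Proof. by move=> <-; exact: dot_exc_mono_row. Qed.

Lemma nonneg_dot_exc (beta : H2 (blowup v k)) (d : monoh) :
  \pi_(H2 (blowup v k)) (mono_row smh d) = beta -> nonneg smv d -> 0 <= dot_exc beta.
Proof.
by move=> /dot_exc_class ->; rewrite /nonneg -PoszD subr_ge0 lez_nat.
Qed.

(** The same character works on both surfaces: its value at the inserted ray v_k + v_(k+1) is the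
    sum of its values at v_k and v_(k+1), just as the multiplicity of E is the sum of the two
    neighbouring ones when the intersection with E is 0. *)
Lemma lift_mono_class (d : mono) (beta : H2 (blowup v k)) : dot_exc beta = 0 ->
  \pi_(H2 (blowup v k)) (mono_row smh (lift_mono k smv d)) = beta <->
  \pi_(H2 v) (mono_row smv d) = pushforward beta.
Proof.
move=> b0; split=> [<-|].
  rewrite pushforward_mono_row; congr (\pi _); apply/rowP => i.
  by rewrite !mxE lift_mono_lift.
set b := repr beta; have bE : beta = \pi_(H2 (blowup v k)) b by rewrite reprK.
move: b0; rewrite bE pushforward_pi (dot_exc_pi _ _ smv) sum_surf_intl ordS_exc.
rewrite ord_pred_exc !blowup_lift smv mulr1 => /eqP; rewrite subr_eq0 => /eqP b0 /eqP.
rewrite -Quotient.idealrBE => /asboolP[m Hm].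
have {}Hm i : (d (er i))%:Z - b 0 (lift (exc k) i) = m.1 * (v i).1 + m.2 * (v i).2.
  by have := Hm i; rewrite !mxE.
apply/eqP; rewrite -Quotient.idealrBE; apply/asboolP; exists m => j; rewrite !mxE.
case: (unliftP (exc k) j) => [i|] ->; rewrite /blowup.
  by rewrite lift_mono_lift liftK Hm.
rewrite lift_mono_exc unlift_none -b0 /= !mulrDr addrACA -!Hm PoszD; ring.
Qed.

Variables (o : direction (KS v)) (oh : direction (KS (blowup v k))) (oc : direction conifold).
Variables (zeta : nat -> ratfun) (p : part -> part -> {poly ratfun}).
Hypothesis zetaE : forall al be m,
  \sum_(eta <- partsn m) vertexC al part0 (conj_part eta) * vertexC eta part0 be =
  \sum_(i < m.+1) (p al be)`_i * zeta (m - i)%N.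
Hypothesis p_small : forall al be i, (psize al + psize be < i)%N -> (p al be)`_i = 0.
Hypothesis p_top : forall al be, (p al be)`_(psize al + psize be) =
  qhalf ^ (kappa be - kappa al) * vertexC al part0 be.
Hypothesis V0 : vertexC part0 part0 part0 = 1.
Hypothesis zeta0E : forall m, zeta m =
  \sum_(eta <- partsn m) vertexC part0 part0 (conj_part eta) * vertexC eta part0 part0.

Lemma GW_blowup_neg g (beta : H2 (blowup v k)) :
  ~ (exists m : int, beta = exc_class v k *~ m) -> dot_exc beta < 0 ->
  GW oh g (zero_section beta) = 0.
Proof.
move=> nE neg; rewrite /GW fsbig1 ?laurent0 // => d /= /(curve_class_eq smh) E.
apply: (log_blowup_neg (smv := smv) oh zetaE p_small p_top V0 zeta0E).
  apply/negP => /exceptionalP dE; apply: nE; exists (d (erh (exc k)))%:Z.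
  by rewrite -E dE mono_row_emono emono_exc.
by move=> /(nonneg_dot_exc E); rewrite leNgt neg.
Qed.

(** Every exponent of class beta is orthogonal to E, hence of the form [lift_mono]. This gives a
    bijection between the two index sets, and corresponding logarithmic coefficients agree. *)
Lemma GW_blowup_orth g (beta : H2 (blowup v k)) : dot_exc beta = 0 ->
  GW oh g (zero_section beta) = GW o g (zero_section (pushforward beta)).
Proof.
move=> b0; rewrite /GW; congr (laurent _ _).
rewrite (reindex_fsbig (lift_mono k smv) [set d | curve_class d = zero_section (pushforward beta)]).
  by apply: eq_fsbigr => d _; exact: (log_blowup_lift smv o oh zetaE p_small p_top V0 zeta0E).
split.
- by move=> d /= /(curve_class_eq smv) E; apply/(curve_class_eq smh)/lift_mono_class.
- move=> d e _ _ E; apply: (mono_ext (smv := smv)) => i.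
  by rewrite -(lift_mono_lift k) E lift_mono_lift.
- move=> d /= /(curve_class_eq smh) E.
  have := dot_exc_class E; rewrite b0 => dE.
  have L : d = lift_mono k smv (mkmono smv (fun i => d (erh (lift (exc k) i)))).
    by apply: lift_mono_surj; apply/eqP; rewrite -eqz_nat PoszD eq_sym -subr_eq0 -dE.
  exists (mkmono smv (fun i => d (erh (lift (exc k) i)))); last by rewrite -L.
  by apply/(curve_class_eq smv); apply/(lift_mono_class _ b0); rewrite -L.
Qed.

(** On the multiples of E the series [Zexc] is the partition function of the conifold, so
    [lcoef_face] applies with these multiples as the whole monoid. *)
Lemma log_conifold m :
  lcoef (Zexc smv zeta) (emono k smv m) = log_coef (Zcoef oc) (U_(crk) *+ m)%MM.
Proof.
rewrite log_coefE -[X in emono k smv X](_ : (U_(crk) *+ m)%MM crk = m); last first.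
  by rewrite mulmnE mnm1E eqxx mul1n.
have eD a b : emono k smv (a + b)%N = (emono k smv a + emono k smv b)%MM.
  by apply: mono_blowup_ext => [i|]; rewrite mnmDE ?emono_exc ?emono_lift.
have e0 : emono k smv 0 = 0%MM.
  by apply: mono_blowup_ext => [i|]; rewrite mnm0E ?emono_exc ?emono_lift.
apply: (@lcoef_face _ _ _ (fun d => emono k smv (d crk)) (@exceptional _ _ _ smv) 1).
- exact: (Zexc0 k smv V0 zeta0E).
- by rewrite (Zcoef_conifold _ _ zeta0E) mnm0E expr0 mul1r (zeta_0 V0 zeta0E).
- by rewrite -e0; apply/exceptionalP; rewrite emono_exc.
- move=> a b /exceptionalP -> /exceptionalP ->; rewrite -eD.
  by apply/exceptionalP; rewrite emono_exc.
- by move=> d /negP/negbTE nd; rewrite /Zexc nd.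
- by move=> a b; rewrite mnmDE eD.
- move=> a b E; apply/mnmP => j; rewrite (crk_uniq j).
  by rewrite -(emono_exc k smv (a crk)) E emono_exc.
- by rewrite mnm0E.
- move=> d; rewrite mul1n (mdeg_erk smh) (bigD1_ord (exc k)) //= emono_exc big1 ?addn0.
    by rewrite mdegE (bigD1 crk) //= leq_addr.
  by move=> i _; rewrite emono_lift.
- move=> a b d /exceptionalP aE /exceptionalP bE _.
  exists (U_(crk) *+ a (erh (exc k)))%MM, (U_(crk) *+ b (erh (exc k)))%MM.
  by rewrite !mulmnE !mnm1E eqxx !mul1n.
- move=> d; rewrite (Zcoef_conifold _ _ zeta0E) /Zexc emono_exc ifT //.
  by apply/exceptionalP; rewrite emono_exc.
Qed.

Lemma curve_class_conifold m (d : 'X_{1..#|E3 conifold|}) :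
  curve_class d = conifold_P1 *+ m <-> d = (U_(crk) *+ m)%MM.
Proof.
have cE : curve_class d = conifold_P1 *+ d crk.
  rewrite /curve_class (bigD1 crk) //= crkK big1 ?addr0 // => j.
  by rewrite (crk_uniq j) eqxx.
rewrite cE; split=> [|->]; last by rewrite mulmnE mnm1E eqxx mul1n.
(* The divisor of ray 0 has intersection -1 with the curve and so determines its multiplicity. *)
move=> /rowP/(_ (inord 0)); rewrite !mulmxnE conifold_P1E !mxE /=.
rewrite -!val_eqE /= !inordK //= => E; apply/mnmP => j.
by rewrite (crk_uniq j) mulmnE mnm1E eqxx mul1n; lia.
Qed.

Lemma GW_blowup_exc g m : (0 < m)%N ->
  GW oh g (zero_section (exc_class v k) *+ m) = GW oc g (conifold_P1 *+ m).
Proof.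
move=> m0; rewrite /GW; congr (laurent _ _).
have cE : zero_section (exc_class v k) *+ m = zero_section (exc_class v k *+ m).
  rewrite -mono_row_emono -curve_classE /exc_class (zero_section_pi smh) /curve_class.
  rewrite (reindex erh) /=; last by apply: onW_bij; exact: erk_bij.
  rewrite -sumrMnl; apply: eq_bigr => i _; rewrite erkK mxE mkmonoE.
  by rewrite eqxx; case: (i == exc k); rewrite /= ?mulr1z ?mulr0z ?mul0rn.
rewrite cE (@fsum_seq _ _ _ [:: emono k smv m]) //.
  rewrite big_cons big_nil asboolT; last by apply/(curve_class_eq smh)/mono_row_emono.
  rewrite addr0 (log_blowup_exc smv oh zetaE p_small p_top V0 zeta0E) // log_conifold.
  rewrite (@fsum_seq _ _ _ [:: (U_(crk) *+ m)%MM]) //.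
    by rewrite big_cons big_nil asboolT ?addr0 //; apply/curve_class_conifold.
  by move=> d /curve_class_conifold ->; rewrite inE eqxx.
(* An exponent d of class m E has d.E = -m < 0, so it can contribute only as a multiple of E, and
   comparing the intersections with E makes this multiple m. *)
move=> d /= /(curve_class_eq smh) E; rewrite inE => ne.
have := dot_exc_class E; rewrite dot_excMn => dE.
apply: (log_blowup_neg (smv := smv) oh zetaE p_small p_top V0 zeta0E).
  apply: contra ne => /exceptionalP dE2; move: dE; rewrite dE2 emono_exc !emono_lift.
  by rewrite !add0r => /oppr_inj[<-].
by move=> /(nonneg_dot_exc E); rewrite dot_excMn oppr_ge0 lez_nat leqNgt m0.
Qed.

End BlowupClasses.

Theorem proposition6p1 (n : nat) (v : 'I_n -> int * int) (k : 'I_n)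
    (hS : complete_smooth v)
    (o : direction (KS v)) (oh : direction (KS (blowup v k)))
    (oc : direction conifold) (g : nat) :
  [/\ forall beta : H2 (blowup v k),
        ~ (exists m : int, beta = exc_class v k *~ m) ->
        dot_exc beta < 0 ->
        GW oh g (zero_section beta) = 0,
      forall beta : H2 (blowup v k),
        dot_exc beta = 0 ->
        GW oh g (zero_section beta) = GW o g (zero_section (pushforward beta))
    & forall d : nat, (1 <= d)%N ->
        GW oh g (zero_section (exc_class v k) *+ d) = GW oc g (conifold_P1 *+ d)].
Proof.
have [zeta [p [V0 zeta0E zetaE p_small p_top]]] := vertexC_resolution.
have smv := hS.1.
split=> [beta|beta|d].
- exact: (GW_blowup_neg smv oh zetaE p_small p_top V0 zeta0E).
- exact: (GW_blowup_orth smv o oh zetaE p_small p_top V0 zeta0E).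
- exact: (GW_blowup_exc smv oh oc zetaE p_small p_top V0 zeta0E).
Qed.
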